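(* Let $n$ be a positive integer and let $\Psi=A_{n-1}$ or $\Psi=B_n$. Let $f$ be the map from the set $\mathrm{NN}(\Psi)$ of nonnesting partitions of type $\Psi$ to the set $\mathrm{NC}(\Psi)$ of noncrossing partitions of type $\Psi$ defined recursively in the context. Then $f:\mathrm{NN}(\Psi)\to \mathrm{NC}(\Psi)$ is a bijection, and it preserves the triples of openers, closers and transients: $(op(f(\pi)),cl(f(\pi)),tr(f(\pi)))=(op(\pi),cl(\pi),tr(\pi))$ for every $\pi\in \mathrm{NN}(\Psi)$.
   Context: **Roots and reflections.** Let $e_1,\dots,e_n$ be the standard basis of $\mathbb{R}^n$ and $[\pm n]=\{\pm1,\dots,\pm n\}$. Type $A_{n-1}$: positive roots $\Phi^+=\{e_i-e_j: 1\le j<i\le n\}$, simple roots $r_i=e_{i+1}-e_i$ ($1\le i\le n-1$). The positive roots are the sums $r_i+\cdots+r_j$ with $1\le i\le j\le n-1$; such a root is identified with the transposition $(i\; j+1)\in\mathfrak{S}_n$. Type $B_n$: positive roots $\Phi^+=\{e_i:1\le i\le n\}\cup\{e_i\pm e_j:1\le j<i\le n\}$, simple roots $r_1=e_1$, $r_i=e_i-e_{i-1}$ ($2\le i\le n$). Then $e_i=\sum_{k=1}^i r_k$, and for $i>j$, $e_i-e_j=\sum_{k=j+1}^i r_k$ and $e_i+e_j=2\sum_{k=1}^j r_k+\sum_{k=j+1}^i r_k$. The roots $e_i$, $e_i-e_j$, $e_i+e_j$ are identified respectively with the permutations $(i,-i)$, $(i,j)(-i,-j)$, $(i,-j)(-i,j)$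 of $[\pm n]$. Products of permutations are composed from right to left, and a permutation is identified with the partition of $[n]$ (type $A$) or $[\pm n]$ (type $B$) into its cycles, fixed points being singleton blocks. **$\mathrm{NN}$ and $\mathrm{NC}$.** The root order on $\Phi^+$ is $\alpha\le\beta$ iff $\beta-\alpha$ is a nonnegative integer combination of simple roots. $\mathrm{NN}(\Psi)$ is the set of antichains of $(\Phi^+,\le)$. An antichain is also viewed as a set partition of $[n]$ (resp. $[\pm n]$): the one whose blocks are the classes of the equivalence relation generated by $x\sim y$ whenever $x,y$ are exchanged by the permutation of some root in the antichain. $\mathrm{NC}(A_{n-1})$ is the set of noncrossing partitions of $[n]$, i.e. those with no $a<b<c<d$ such that $a,c$ lie in one block and $b,d$ in another. $\mathrm{NC}(B_n)$ is the set of partitions of $[\pm n]$ that are invariant under $x\mapsto -x$ and noncrossing with respect to the linear order $1,2,\dots,n,-1,-2,\dots,-n$. (These are the usual realizations, via cycles, of the interval $[1,c]$ in the absolute order, with $c=(1\,2\cdots n)$, resp. $c=(1,\dots,n,-1,\dots,-n)$.) **Openers, closers, transients.** Type $A$: for a partition of $[n]$, $op$ is the set of least elements of blocks, $cl$ the set of greatest elements of blocks, and $tr$ the set of remaining elements of $[n]$. Type $B$: for a partition of $[\pm n]$, $op$ is the set of least elements of the blocks having only positive integers; $cl$ consists of the greatest elements of the blocks having only positive integers together with the absolute values of the least and of the greatest elements (for the usual order of integers) of the blocks having both positive and negative integers; $tr=[n]\setminus(op\cup cl)$. **Notation for roots.** For $\beta=r_i+\cdots+r_j$ (no double roots): $\mathrm{supp}(\beta)=\overline{\mathrm{supp}}(\beta)=\{r_i,\dots,r_j\}$,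 first index $i$, last index $j$. For (type $B$ only) $\alpha=2r_1+\cdots+2r_j+r_{j+1}+\cdots+r_i$, which is said to have double roots $2r_1,\dots,2r_j$: $\mathrm{supp}(\alpha)=\{2r_1,\dots,2r_j,r_{j+1},\dots,r_i\}$, $\overline{\mathrm{supp}}(\alpha)=\{r_1,\dots,r_i\}$, first index $1$, last index $i$, last double index $j$, and $D_\alpha=\{r_2,\dots,r_j\}$. If $\beta$ has no double roots and $\mathrm{supp}(\alpha)\cap\mathrm{supp}(\beta)\ne\emptyset$, then $\alpha\cup\beta$ and $\alpha\cap\beta$ are the positive roots with supports $\mathrm{supp}(\alpha)\cup(\mathrm{supp}(\beta)\setminus\overline{\mathrm{supp}}(\alpha))$ and $\overline{\mathrm{supp}}(\alpha)\cap\mathrm{supp}(\beta)$; if $\alpha$ has double roots, the d-intersection $\alpha\cap^d\beta$ is the positive root with support $D_\alpha\cap\mathrm{supp}(\beta)$. Antichains are written as tuples $(\alpha_1,\dots,\alpha_m)$ ordered by strictly increasing last index. (In type $B$ the roots having double roots then come before, or are followed only by, roots without double roots: $\alpha_1,\dots,\alpha_\ell$ have double roots and $\alpha_{\ell+1},\dots,\alpha_m$ have none, for some $0\le\ell\le m$.) An antichain is connected if $\mathrm{supp}(\alpha_i)\cap\mathrm{supp}(\alpha_{i+1})\neq\emptyset$ for all $i<m$; the connected components of an antichain are its maximal connected runs of consecutive roots. **The map $f$.** $f$ of the empty antichain is the identity; $f(\alpha_1)=\alpha_1$ for a single positive root. Let $\alpha=(\alpha_1,\dots,\alpha_m)$ be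 a connected antichain, $m\ge2$. (a) If no $\alpha_i$ has double roots, $f(\alpha)=\left(\bigcup_{k=1}^m\alpha_k\right) f(\overline\alpha_2,\dots,\overline\alpha_m)$, where $\overline\alpha_k=\alpha_{k-1}\cap\alpha_k$ (this is again an antichain, not necessarily connected). (b) Suppose $\alpha_1,\dots,\alpha_\ell$ have double roots ($\ell\ge1$) and $\alpha_{\ell+1},\dots,\alpha_m$ have none. Put $\Gamma_d=(\alpha_1,\dots,\alpha_\ell)$, $\Gamma=(\alpha_{\ell+1},\dots,\alpha_m)$. *l-links:* let $m'$ be the largest index of an element $\alpha_{m'}$ of $\Gamma$ with first index $i\ne1$ such that some element of $\Gamma_d$ has the term $2r_i$; let $\alpha_k$ be the rightmost such element of $\Gamma_d$; l-link $\alpha_k$ with $\alpha_{m'}$. Then ignore $\alpha_k$ and $\alpha_{m'}$ and repeat with the remaining roots, until no such $m'$ exists. *u-links:* call admissible the elements of $\Gamma$ whose first index is not $1$ and which are not l-linked. Let $m'$ be the smallest index of an admissible root $\alpha_{m'}$, with first index $i$, for which there is an element $\alpha_k$ to its left ($k<m'$) in $\alpha$ with $r_i$ or $2r_i$ in its support and not yet u-linked to an element on its right; take the leftmost such $\alpha_k$ and u-link $\alpha_k$ with $\alpha_{m'}$. Remove $\alpha_{m'}$ from the admissible roots and repeat until no such $m'$ exists. Let $T$ be the set consisting of all last double indices of the roots of $\Gamma_d$ that are not l-linked, and all last indices of the roots of $\alpha$ that are not u-linked to an element on their right. Define $$f(\alpha)=\pi_1\cdots\pi_\ell\,\pi_0\,\theta_1\cdots\theta_q\,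 f(\theta_{q+1},\dots,\theta_s),$$ where: for $j=1,\dots,\ell$ successively, $\pi_j=2r_1+\cdots+2r_{j'}+r_{j'+1}+\cdots+r_{j''}$ with $j'$ and $j''$ the smallest and largest elements of $T$ not yet used; $\pi_0=r_1+\cdots+r_t$, with $t$ the only element of $T$ not yet used, if $\Gamma$ is nonempty and $\alpha_{\ell+1}$ has first index $1$, and $\pi_0$ is the identity otherwise; $\theta_1,\dots,\theta_q$ are the d-intersections $\alpha_k\cap^d\alpha_{m'}$ of the l-linked pairs, listed starting from the rightmost $\alpha_k$ in $\Gamma_d$; $\theta_{q+1},\dots,\theta_s$ are the intersections $\alpha_k\cap\alpha_{m'}$ of the u-linked pairs, listed starting from the leftmost $\alpha_{m'}$ in $\Gamma$. (c) For an antichain with several connected components, $f$ is the product, from left to right, of the values of $f$ on its connected components in order. In type $A$ only (a) and (c) occur. *)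

(* Defs.v *)
From HB Require Import structures.
From mathcomp Require Import all_boot all_order all_algebra all_fingroup.
Set Implicit Arguments.
Unset Strict Implicit.
Unset Printing Implicit Defensive.
Import Order.TTheory GRing.Theory Num.Theory.
Local Open Scope ring_scope.

(* For a given n, TypeA stands for A_{n-1} and TypeB for B_n. *)
Inductive cartan := TypeA | TypeB.

Definition rank (Psi : cartan) (n : nat) : nat :=
  if Psi is TypeA then n.-1 else n.

(* Root i 0 j is r_i + ... + r_j, and, for 0 < j, Root 1 j i is
   2r_1 + ... + 2r_j + r_(j+1) + ... + r_i.  Indices start at 1. *)
Record proot := Root { fidx : nat; didx : nat; lidx : nat }.

Definition root_triple (b : proot) := (fidx b, didx b, lidx b).
Definition triple_root (t : nat * nat * nat) := Root t.1.1 t.1.2 t.2.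
Lemma root_tripleK : cancel root_triple triple_root. Proof. by case. Qed.
HB.instance Definition _ := Choice.copy proot (can_type root_tripleK).

Definition dbl (b : proot) : bool := (0 < didx b)%N.

Definition coef (b : proot) (k : nat) : nat :=
  if (fidx b <= k <= lidx b)%N then (if (k <= didx b)%N then 2 else 1) else 0.

Definition pos_roots (Psi : cartan) (n : nat) : seq proot :=
  [seq Root i 0 j | j <- iota 1 (rank Psi n), i <- iota 1 j] ++
  (if Psi is TypeB then [seq Root 1 j i | i <- iota 1 n, j <- iota 1 i.-1]
   else [::]).

Definition posroot (Psi : cartan) (n : nat) : finType :=
  seq_sub (pos_roots Psi n).

(* This is e_i when 1 <= i <= n, and 0 otherwise. *)
Definition basis_vec (n i : nat) : 'rV[int]_n := \row_k (k.+1 == i)%:R.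

Definition simple_root (Psi : cartan) (n k : nat) : 'rV[int]_n :=
  match Psi with
  | TypeA => basis_vec n k.+1 - basis_vec n k
  | TypeB => if k == 1%N then basis_vec n 1 else basis_vec n k - basis_vec n k.-1
  end.

Definition root_vec (Psi : cartan) (n : nat) (b : proot) : 'rV[int]_n :=
  match Psi with
  | TypeA => basis_vec n (lidx b).+1 - basis_vec n (fidx b)
  | TypeB =>
      if dbl b then basis_vec n (lidx b) + basis_vec n (didx b)
      else if fidx b == 1%N then basis_vec n (lidx b)
      else basis_vec n (lidx b) - basis_vec n (fidx b).-1
  end.

Lemma basis_vec0 n : basis_vec n 0 = 0.
Proof. by apply/rowP=> k; rewrite !mxE. Qed.

Lemma sum_simple_root (Psi : cartan) (n m M : nat) : (m <= M)%N ->
  \sum_(1 <= k < M.+1) simple_root Psi n k *+ (k <= m)%N =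
    if Psi is TypeA then basis_vec n m.+1 - basis_vec n 1 else basis_vec n m.
Proof.
move=> mM; rewrite (@big_cat_nat _ _ _ m.+1) //= addrC big_nat big1 ?add0r.
  rewrite big_nat (eq_bigr (simple_root Psi n)); last by move=> k /andP[_ /ltnSE ->].
  rewrite -big_nat; case: Psi; first by rewrite telescope_sumr.
  case: m {mM} => [|m]; first by rewrite big_geq ?basis_vec0.
  elim: m => [|m IHm]; first by rewrite big_nat1.
  by rewrite big_nat_recr //= IHm addrC subrK.
by move=> k /andP[mk _]; rewrite leqNgt mk.
Qed.

Lemma root_vecE (Psi : cartan) (n : nat) (b : proot) :
  b \in pos_roots Psi n ->
  root_vec Psi n b =
    \sum_(1 <= k < (rank Psi n).+1) simple_root Psi n k *+ coef b k.
Proof.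
rewrite mem_cat => /orP[/allpairsPdep[j [i [jm im ->]]]|].
  move: jm im; rewrite !mem_iota !add1n => /andP[j0 /ltnSE jm] /andP[i0 ij].
  have im : (i.-1 <= rank Psi n)%N.
    exact: leq_trans (leq_pred i) (leq_trans (ltnSE ij) jm).
  apply: (addIr (\sum_(1 <= k < (rank Psi n).+1) simple_root Psi n k *+ (k <= i.-1)%N)).
  rewrite -big_split sum_simple_root //=.
  rewrite (eq_big_nat _ _ (F2 := fun k => simple_root Psi n k *+ (k <= j)%N)).
    rewrite sum_simple_root //= {jm im}; case: Psi; rewrite /root_vec /dbl /=.
      by rewrite prednK // addrA subrK.
    by case: eqP => [->|_]; rewrite ?basis_vec0 ?addr0 ?subrK.
  move=> k /andP[k0 _]; rewrite -mulrnDr /coef /= (leqNgt k 0) k0 /=.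
  rewrite -[(k <= i.-1)%N]ltnS prednK // ltnNge; case: (leqP i k) => ik; rewrite ?addn0 ?add0n //=.
  by rewrite (leq_trans (ltnW ik) (ltnSE ij)).
case: Psi => // /allpairsPdep[i [j [im ji ->]]].
move: im ji; rewrite !mem_iota !add1n => /andP[i0 im] /andP[j0 ji].
rewrite prednK // in ji.
rewrite (eq_big_nat _ _ (F2 := fun k => simple_root TypeB n k *+ (k <= i)%N
                                 + simple_root TypeB n k *+ (k <= j)%N)).
  by rewrite big_split !sum_simple_root // ?(leq_trans (ltnW ji)) // /root_vec /dbl /= j0.
move=> k /andP[k0 _]; rewrite -mulrnDr /coef /= k0 /=.
case: (leqP k i) => ki //; last by rewrite leqNgt (leq_trans ji (ltnW ki)).
by case: (k <= j)%N.
Qed.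

Definition root_le (Psi : cartan) (n : nat) (a b : proot) : Prop :=
  exists c : nat -> nat,
    root_vec Psi n b - root_vec Psi n a =
      \sum_(1 <= k < (rank Psi n).+1) simple_root Psi n k *+ c k.

Definition NN (Psi : cartan) (n : nat) (A : {set posroot Psi n}) : Prop :=
  forall a b, a \in A -> b \in A -> root_le Psi n (val a) (val b) -> a = b.

(* Distinct elements of an antichain have distinct last indices, so for an
   antichain the result is strictly increasing in the last index. *)
Definition tuple_of (Psi : cartan) (n : nat) (A : {set posroot Psi n}) :
  seq proot := sort (fun a b => lidx a <= lidx b)%N [seq val a | a <- enum A].

(* In type A, i : 'I_n stands for i+1; in type B, (i, false) stands for i+1
   and (i, true) for -(i+1). *)
Definition pt (Psi : cartan) (n : nat) : finType :=
  match Psi with TypeA => 'I_n | TypeB => ('I_n * bool)%type end.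

Definition label (Psi : cartan) (n : nat) : pt Psi n -> int :=
  match Psi return pt Psi n -> int with
  | TypeA => fun x : 'I_n => (x.+1)%:Z
  | TypeB => fun x : 'I_n * bool => (-1) ^+ x.2 * (x.1.+1)%:Z
  end.

Definition absval (Psi : cartan) (n : nat) : pt Psi n -> 'I_n :=
  match Psi return pt Psi n -> 'I_n with
  | TypeA => fun x : 'I_n => x
  | TypeB => fun x : 'I_n * bool => x.1
  end.

(* The position of a point in the linear order 1, ..., n, -1, ..., -n. *)
Definition position (Psi : cartan) (n : nat) : pt Psi n -> nat :=
  match Psi return pt Psi n -> nat with
  | TypeA => fun x : 'I_n => x
  | TypeB => fun x : 'I_n * bool => (x.2 * n + x.1)%N
  end.

Definition oswap (T : finType) (x y : option T) : {perm T} :=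
  if x is Some x' then if y is Some y' then tperm x' y' else 1%g else 1%g.

(* insub i.-1 is the element of 'I_n that stands for i, for 1 <= i <= n. *)
Definition swapA (n i j : nat) : {perm 'I_n} := oswap (insub i.-1) (insub j.-1).

Definition spoint (n i : nat) (s : bool) : option ('I_n * bool) :=
  omap (fun x : 'I_n => (x, s)) (insub i.-1).

Definition swapB (n : nat) (i : nat) (s : bool) (j : nat) (t : bool) :
  {perm 'I_n * bool} := oswap (spoint n i s) (spoint n j t).

Definition reflection (Psi : cartan) (n : nat) (b : proot) : {perm pt Psi n} :=
  match Psi return {perm pt Psi n} with
  | TypeA => swapA n (fidx b) (lidx b).+1
  | TypeB =>
      let i := lidx b in
      if dbl b then
        (swapB n i false (didx b) true * swapB n i true (didx b) false)%g
      else if fidx b == 1%N then swapB n i false i true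
      else
        (swapB n i false (fidx b).-1 false * swapB n i true (fidx b).-1 true)%g
  end.

Definition noncrossing (T : finType) (pos : T -> nat) (P : {set {set T}}) :
  bool :=
  [forall B in P, forall C in P, forall a in B, forall c in B,
    forall b in C, forall d in C,
      [&& pos a < pos b, pos b < pos c & pos c < pos d]%N ==> (B == C)].

Definition invariant_under_opp (Psi : cartan) (n : nat) :
  {set {set pt Psi n}} -> bool :=
  match Psi return {set {set pt Psi n}} -> bool with
  | TypeA => fun=> true
  | TypeB => fun P : {set {set 'I_n * bool}} =>
      [forall B in P, [set (x.1, ~~ x.2) | x in B] \in P]
  end.

Definition NC (Psi : cartan) (n : nat) : {set {set {set pt Psi n}}} :=
  [set P | [&& partition P [set: pt Psi n], invariant_under_opp P
             & noncrossing (@position Psi n) P]].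

Section OpenersClosers.
Variables (Psi : cartan) (n : nat).
Implicit Types (B : {set pt Psi n}) (P : {set {set pt Psi n}}).

Definition least_in B x : bool :=
  (x \in B) && [forall y in B, label x <= label y].
Definition greatest_in B x : bool :=
  (x \in B) && [forall y in B, label y <= label x].
Definition positive_block B : bool := [forall x in B, 0 < label x].
Definition mixed_block B : bool :=
  [exists x in B, 0 < label x] && [exists x in B, label x < 0].

(* In type A every block is positive, so op P and cl P are the sets of the
   least, respectively greatest, elements of the blocks. *)
Definition op P : {set 'I_n} :=
  [set absval x | x : pt Psi n
     & [exists B in P, positive_block B && least_in B x]].

Definition cl P : {set 'I_n} :=
  [set absval x | x : pt Psi n
     & [exists B in P, (positive_block B && greatest_in B x)
                    || (mixed_block B && (least_in B x || greatest_in B x))]].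

Definition tr P : {set 'I_n} := ~: (op P :|: cl P).

Definition antichain_partition (A : {set posroot Psi n}) :
  {set {set pt Psi n}} :=
  equivalence_partition
    (connect [rel x y | [exists a in A, reflection Psi n (val a) x == y]])
    [set: pt Psi n].

End OpenersClosers.

(* The pair (c, k) stands for the term c r_k, so 2r_k and r_k are distinct. *)
Definition supp (b : proot) : seq (nat * nat) :=
  [seq (coef b k, k) | k <- iota 1 (lidx b) & (0 < coef b k)%N].

Definition meets (a b : proot) : bool := has (mem (supp b)) (supp a).

(* The supports involved are intervals of indices whenever a and b meet and
   b has no double roots (and, for dcap, a and b are l-linked). *)
Definition cup (a b : proot) : proot :=
  Root (minn (fidx a) (fidx b)) (didx a) (maxn (lidx a) (lidx b)).
Definition cap (a b : proot) : proot :=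
  Root (maxn (fidx a) (fidx b)) 0 (minn (lidx a) (lidx b)).
Definition dcap (a b : proot) : proot :=
  Root (maxn 2 (fidx b)) 0 (minn (didx a) (lidx b)).

Fixpoint components (s : seq proot) : seq (seq proot) :=
  if s is a :: s' then
    match components s' with
    | (b :: c) :: cs =>
        if meets a b then (a :: b :: c) :: cs else [:: a] :: (b :: c) :: cs
    | _ => [:: [:: a]]
    end
  else [::].

(* The argument N of llinks and ulinks bounds the number of rounds, each of
   which removes an element of G, respectively of adm.  Here D and G list
   the roots of Gamma_d and Gamma that are not yet l-linked. *)
Definition lpartners (D : seq proot) (b : proot) : seq proot :=
  [seq a <- D | (fidx b != 1%N) && (fidx b <= didx a)%N].

Fixpoint llinks (N : nat) (D G : seq proot) : seq (proot * proot) :=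
  if N is N'.+1 then
    match rev [seq b <- G | lpartners D b != [::]] with
    | b :: _ =>
        let a := last b (lpartners D b) in
        (a, b) :: llinks N' (rem a D) (rem b G)
    | [::] => [::]
    end
  else [::].

(* Here s is the whole antichain, adm lists the admissible roots, and used the
   roots already u-linked to an element on their right. *)
Definition upartners (s used : seq proot) (b : proot) : seq proot :=
  [seq a <- take (index b s) s
     | (a \notin used) && (fidx a <= fidx b <= lidx a)%N].

Fixpoint ulinks (N : nat) (s adm used : seq proot) : seq (proot * proot) :=
  if N is N'.+1 then
    match [seq b <- adm | upartners s used b != [::]] with
    | b :: _ =>
        let a := head b (upartners s used b) in
        (a, b) :: ulinks N' s (rem b adm) (a :: used)
    | [::] => [::]
    end
  else [::].

(* The values of f are kept as words in the positive roots, whose products are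
   taken in word_perm.  The next two definitions are for a connected antichain
   s of at least two roots, without, respectively with, double roots; g is used
   for the recursive calls. *)
Definition f_nodouble (g : seq proot -> seq proot) (s : seq proot) : seq proot :=
  if s is a :: s' then foldl cup a s' :: g (pairmap cap a s') else [::].

Definition f_double (g : seq proot -> seq proot) (s : seq proot) : seq proot :=
  let D := [seq a <- s | dbl a] in
  let G := [seq a <- s | ~~ dbl a] in
  let L := llinks (size G) D G in
  let adm := [seq b <- G | (fidx b != 1%N) && (b \notin [seq p.2 | p <- L])] in
  let U := ulinks (size adm) s adm [::] in
  let T := sort leq (undup
    ([seq didx a | a <- D & a \notin [seq p.1 | p <- L]] ++
     [seq lidx a | a <- s & a \notin [seq p.1 | p <- U]])) in
  let l := size D in
  let pis :=
    [seq Root 1 (nth 0%N T j) (nth 0%N T (size T - j.+1)) | j <- iota 0 l] in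
  let pi0 :=
    if G is b :: _ then
      if fidx b == 1%N then [:: Root 1 0 (nth 0%N T l)] else [::]
    else [::] in
  let thetas_l :=
    [seq dcap p.1 p.2 | p <- sort (fun p q => lidx q.1 <= lidx p.1)%N L] in
  let thetas_u :=
    [seq cap p.1 p.2 | p <- sort (fun p q => lidx p.2 <= lidx q.2)%N U] in
  pis ++ pi0 ++ thetas_l ++ g thetas_u.

Definition f_connected (g : seq proot -> seq proot) (s : seq proot) : seq proot :=
  match s with
  | [::] => [::]
  | [:: a] => [:: a]
  | _ => if has dbl s then f_double g s else f_nodouble g s
  end.

(* N bounds the depth of the recursion; f_wordE below shows that the bound
   size s is never reached. *)
Fixpoint f_rec (N : nat) (s : seq proot) : seq proot :=
  if N is N'.+1 then flatten [seq f_connected (f_rec N') c | c <- components s]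
  else [::].

Definition f_word (s : seq proot) : seq proot := f_rec (size s) s.

Lemma size_components s c : c \in components s -> (size c <= size s)%N.
Proof.
have E t : t != [::] -> components t != [::].
  by case: t => //= a t _; case: components => [|[|b l] cs] //; case: ifP.
elim: s c => //= a s IHs c.
case Es: (components s) => [|[|b l] cs]; rewrite ?inE.
- by move/eqP->.
- by move/eqP->.
have sl : (size (b :: l) <= size s)%N by rewrite IHs // Es mem_head.
have scs c' : c' \in cs -> (size c' <= size s)%N.
  by move=> h; rewrite IHs // Es inE h orbT.
case: ifP => _; rewrite !inE.
  by case/orP=> [/eqP->|/scs /leqW].
by case/or3P=> [/eqP->|/eqP->|/scs /leqW] //; apply: leqW.
Qed.

Lemma size_ulinks N s adm used : (size (ulinks N s adm used) <= N)%N.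
Proof.
elim: N s adm used => //= N IHN s adm used.
by case: [seq _ <- _ | _] => //= b l; rewrite ltnS.
Qed.

Lemma eq_f_connected (g h : seq proot -> seq proot) s :
  (forall t, (size t < size s)%N -> g t = h t) ->
  f_connected g s = f_connected h s.
Proof.
case: s => [|a [|b s]] // gh; rewrite /f_connected.
case: ifP => [dbl_s|_]; last by rewrite /f_nodouble gh // size_pairmap.
rewrite /f_double; set adm := [seq x <- _ | _ && _].
rewrite [X in _ ++ _ ++ _ ++ X]gh //.
rewrite size_map size_sort (leq_ltn_trans (size_ulinks _ _ _ _)) //.
rewrite size_filter (leq_ltn_trans (count_size _ _)) // size_filter.
have := count_predC dbl (a :: b :: s).
move: dbl_s; rewrite has_count => d0 <-.
rewrite -[X in (X < _)%N]add0n ltn_add2r; exact: d0.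
Qed.

Lemma f_wordE s :
  f_word s = flatten [seq f_connected f_word c | c <- components s].
Proof.
have rec N : forall t, (size t <= N)%N ->
    f_rec N t = flatten [seq f_connected f_word c | c <- components t].
  elim/ltn_ind: N => -[|N] IHN t; first by rewrite leqn0 => /nilP->.
  move=> tN /=; congr flatten; apply/eq_in_map => c /size_components ct.
  apply: eq_f_connected => u uc.
  have uN : (size u <= N)%N by rewrite -ltnS (leq_trans uc) ?(leq_trans ct).
  by rewrite IHN // /f_word IHN.
exact: rec.
Qed.

(* Products are composed from right to left, whereas (s * t)%g x = t (s x). *)
Definition word_perm (Psi : cartan) (n : nat) (w : seq proot) :
  {perm pt Psi n} := foldr (fun b s => (s * reflection Psi n b)%g) 1%g w.

Definition f_perm (Psi : cartan) (n : nat) (A : {set posroot Psi n}) :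
  {perm pt Psi n} := word_perm Psi n (f_word (tuple_of A)).

Definition f_map (Psi : cartan) (n : nat) (A : {set posroot Psi n}) :
  {set {set pt Psi n}} := porbits (f_perm A).

(* Main.v *)
(* A root r_i + ... + r_j is an arc from i - 1 to j, and a root with double
   roots has two right ends, its last double index and its last index.  The
   closers and the openers of an antichain are the complements of the sets of
   left ends and of right ends, and these sets determine the antichain.  The
   map f keeps both sets but matches them like brackets, and joins the
   unmatched right ends to the negative half in nested pairs.  The resulting
   arcs form a noncrossing forest, so the cycles of the product of their
   transpositions, in any order, are its components: f(A) is a noncrossing
   partition with the openers and closers of A.  Conversely, bracket matchings
   being unique, a noncrossing partition is determined by its openers and
   closers, and the ballot condition that it imposes on them is what is needed
   to build an antichain. *)
From mathcomp Require Import all_boot all_order all_algebra all_fingroup zify.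
Require Import Defs.
Set Implicit Arguments.
Unset Strict Implicit.
Unset Printing Implicit Defensive.
Import Order.TTheory GRing.Theory Num.Theory.

(** * Products of transpositions along a forest *)

(** Since the order of the factors does not affect the cycles, words are only studied up to
    [perm_eq]: what is tracked is the multiset of first indices, the multiset of right ends, and the
    absence of crossings. Induction along the recursion of f is needed only without double roots.
    Rule (b) calls f on intersections, which have no double roots, so [f_double] is analysed
    directly from the outcome [f_word_simple]. For that purpose [f_word_simple] carries one clause
    more than type A needs, on the points lying under an arc: the right ends in T are joined to the
    negative half, so no arc may pass over them. One count governs type B: right ends minus left
    ends is twice the number of double roots, plus one if a root without double roots starts at r_1.
    It fixes the shape of the central part of the word, makes the reconstruction of an antichain
    unambiguous, and dictates the construction of a preimage. In type B the bracket matching settles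
    only the positive half of a noncrossing partition; the blocks with both signs are recovered from
    an order-reversing involution on their least positive elements. *)

Lemma uniq_map_inj (T U : eqType) (f : T -> U) (s : seq T) :
  uniq (map f s) -> {in s &, injective f}.
Proof.
elim: s => //= a s IH /andP[aN us] x y; rewrite !inE.
move=> /predU1P[->|xs] /predU1P[->|ys] // fxy; last exact: IH.
  by rewrite fxy map_f in aN.
by rewrite -fxy map_f in aN.
Qed.

Section Graph.
Variable V : finType.
Implicit Types (ed : seq (V * V)) (x y : V) (lab : V -> int).

Definition adj ed x y := ((x, y) \in ed) || ((y, x) \in ed).

Lemma connect_adjC ed : connect_sym (adj ed).
Proof. by apply: sym_connect_sym => x y; apply: orbC. Qed.

Lemma connect_adj_sub ed ed' :
  {subset ed <= ed'} -> subrel (connect (adj ed)) (connect (adj ed')).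
Proof.
move=> sub; apply: connect_sub => x y /orP[] /sub h; apply: connect1.
  by rewrite /adj h.
by rewrite /adj h orbT.
Qed.

Definition ascending lab ed := {in ed, forall e, (lab e.1 < lab e.2)%R}.

(** The new factor is multiplied on the right because [word_perm] composes from right to left. *)
Definition eperm ed : {perm V} :=
  foldr (fun e s => (s * tperm e.1 e.2)%g) 1%g ed.

Lemma eperm_cat ed ed' : eperm (ed ++ ed') = (eperm ed' * eperm ed)%g.
Proof. by elim: ed => [|e ed IH] /=; rewrite ?mulg1 // IH mulgA. Qed.

(* From a vertex that is not a right end, following edges upwards already
   reaches the whole component, because right ends have a single left
   neighbour. *)
Lemma component_min lab ed x y :
  ascending lab ed -> uniq (map snd ed) -> x \notin map snd ed ->
  connect (adj ed) x y -> (lab x <= lab y)%R.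
Proof.
move=> asc usnd xN.
pose up := [rel u v | (u, v) \in ed].
have reach_lab z : connect up x z -> (lab x <= lab z)%R.
  case/connectP => p; elim: p x {xN} => [|u p IH] x /=; first by move=> _ ->.
  case/andP=> /asc /= xu pth zE; exact: le_trans (ltW xu) (IH u pth zE).
suff closed_up z : connect (adj ed) x z -> connect up x z by move=> /closed_up /reach_lab.
case/connectP => p; elim/last_ind: p z => [|p u IH] z /=; first by move=> _ ->.
rewrite rcons_path last_rcons => /andP[pth] e ->; set v := last x p in e.
have xv : connect up x v by apply: IH.
case/orP: e => [vu|uv]; first exact: connect_trans xv (connect1 vu).
case/connectP: xv => q; elim/last_ind: q => [|q w _] /=.
  by move=> _ vx; case/mapP: xN; exists (u, v).
rewrite rcons_path last_rcons => /andP[pq wq] vw; rewrite -vw in wq.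
have [->] := uniq_map_inj usnd uv wq erefl.
by apply/connectP; exists q.
Qed.

Lemma component_max lab ed x y :
  ascending lab ed -> uniq (map fst ed) -> x \notin map fst ed ->
  connect (adj ed) x y -> (lab y <= lab x)%R.
Proof.
move=> asc ufst xN xy; pose sw := fun e : V * V => (e.2, e.1).
rewrite -lerN2; apply: (@component_min (fun z => - lab z)%R (map sw ed)).
- by move=> _ /mapP[e /asc lte ->]; rewrite ltrN2.
- by rewrite -map_comp.
- by rewrite -map_comp.
rewrite (eq_connect (e' := adj ed)) // => u v; rewrite /adj.
have h a b : ((a, b) \in map sw ed) = ((b, a) \in ed).
  apply/mapP/idP => [[[c d] cd [-> ->]] //|ba]; by exists (b, a).
by rewrite !h orbC.
Qed.

Lemma porbit_mul_tperm s x y z : x \notin porbit s y ->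
  porbit s z \subset porbit (tperm x y * s)%g z /\ x \in porbit (tperm x y * s)%g y.
Proof.
move=> xNy; set t := tperm x y; set s' := (t * s)%g.
have xy : x != y by apply: contraNneq xNy => ->; apply: porbit_id.
have xy' : x \in porbit s' y.
  apply/negP => /negP xN.
  (* Were x still outside the cycle of y, both multiplications by the transposition would lower the
     number of cycles by one, yet the second one gives [s] back. *)
  have h1 := porbits_mul_tperm s x y; have h2 := porbits_mul_tperm s' x y.
  move: h1 h2 => /=; rewrite -/t -/s' /s' mulgA tperm2 mul1g -/s' xN xNy xy; lia.
split=> //; have step u : s u \in porbit s' u.
  have xy'' : porbit s' x = porbit s' y by apply/eqP; rewrite eq_porbit_mem.
  have img v : s (t v) \in porbit s' v.
    by have := mem_porbit s' 1 v; rewrite expg1 permM.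
  have [->|ux] := eqVneq u x; first by have := img y; rewrite tpermR xy''.
  have [->|uy] := eqVneq u y; first by have := img x; rewrite tpermL xy''.
  by have := img u; rewrite tpermD // eq_sym.
apply/subsetP => _ /porbitP[i ->].
elim: i => [|i IH]; first by rewrite perm1 porbit_id.
by rewrite expgSr permM; move: IH; rewrite -!eq_porbit_mem => /eqP <-;
  rewrite eq_porbit_mem step.
Qed.

(* In any order of the factors, each transposition merges two cycles: its left
   end is the greatest element of its component in the remaining graph. *)
Lemma porbit_eperm lab ed x y :
  ascending lab ed -> uniq (map fst ed) ->
  (y \in porbit (eperm ed) x) = connect (adj ed) x y.
Proof.
elim: ed x y => [|[a b] ed IH] x y asc /=.
  move=> _; apply/idP/connectP => [/porbitP[i]|[[|z p]] //=].
    by rewrite expg1n perm1 => ->; exists [::].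
  by move=> _ ->; apply: porbit_id.
case/andP=> aN ufst; set s := eperm ed; set t := tperm a b.
have asc' : ascending lab ed by move=> e he; apply: asc; rewrite inE he orbT.
have {}IH u v := IH u v asc' ufst.
have ab : (lab a < lab b)%R by apply: (asc (a, b)); rewrite mem_head.
(* Inverses have the same cycles and put the new transposition on the left, the side on which
   [porbit_mul_tperm] multiplies. The vertex [a], no longer a left end in [ed], is the greatest of
   its component there, so [b] lies in another one. *)
have aNb : a \notin porbit s^-1 b.
  rewrite porbitV porbit_sym IH; apply/negP => /(component_max asc' ufst aN).
  by rewrite leNgt ab.
have {}IH u v : (v \in porbit s^-1 u) = connect (adj ed) u v by rewrite porbitV IH.
rewrite -porbitV invMg /t tpermV.
apply/idP/idP.
  case/porbitP => i ->; elim: i => [|i IHi]; first by rewrite perm1.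
  rewrite expgSr permM; apply: connect_trans IHi _; rewrite permM;
    move: (((_ ^+ i)%g : {perm V}) x) => z.
  apply: (@connect_trans _ _ (tperm a b z)).
    case: tpermP => [->|->|_ _]; last exact: connect0.
      by apply: connect1; rewrite /adj mem_head.
    by apply: connect1; rewrite /adj mem_head orbT.
  apply: (@connect_adj_sub ed); first by move=> e he; rewrite inE he orbT.
  by rewrite -IH; have := mem_porbit s^-1 1 (tperm a b z); rewrite expg1.
case/connectP=> p + ->; elim: p x => [|z p IHp] x /=; first by rewrite porbit_id.
case/andP=> xz /IHp {IHp}; set l := last z p => lz.
suff: z \in porbit (tperm a b * s^-1) x by rewrite -eq_porbit_mem => /eqP <-.
have [sub ba] := porbit_mul_tperm x aNb.
have edge u v : (u, v) \in ed -> v \in porbit (tperm a b * s^-1) u.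
  move=> uv; have [/subsetP sub' _] := porbit_mul_tperm u aNb.
  by apply: sub'; rewrite IH connect1 // /adj uv.
case/orP: xz; rewrite inE => /predU1P[[-> ->]|/edge //]; first by rewrite porbit_sym.
  by [].
by move=> xz; rewrite porbit_sym.
Qed.

Lemma connect_exit (e : rel V) (p : pred V) x y : connect e x y ->
  p x -> ~~ p y -> exists u v, [/\ connect e x u, e u v, p u & ~~ p v].
Proof.
case/connectP => q; elim: q x => [|z q IH] x /=; first by move=> _ -> ->.
case/andP=> xz pth ly px pNy; case pz: (p z); last by exists x, z; rewrite pz connect0.
have [u [v [zu uv pu pv]]] := IH z pth ly pz pNy.
by exists u, v; split=> //; apply: connect_trans zu; apply: connect1.
Qed.

(** * Noncrossing graphs have noncrossing components *)

Definition noncrossing_adj (pos : V -> nat) ed := forall x y u v,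
  adj ed x y -> adj ed u v -> ~ [/\ pos x < pos u, pos u < pos y & pos y < pos v].

(* Some edge of the component of a, c spans b, hence spans the whole component
   of b, d; symmetrically some edge of the latter spans the former. *)
Lemma noncrossing_connect (pos : V -> nat) ed a b c d :
  injective pos -> noncrossing_adj pos ed ->
  connect (adj ed) a c -> connect (adj ed) b d ->
  pos a < pos b -> pos b < pos c -> pos c < pos d -> connect (adj ed) a b.
Proof.
move=> pos_inj nc a_c bd ab bc cd; apply/negPn/negP => aNb.
have sC := @connect_adjC ed.
have adjC u v : adj ed u v = adj ed v u by apply: orbC.
(* A path leaving the span of the edge x y has a first edge w z with w inside and z outside. As z
   lies in another component it is neither x nor y, so w z crosses x y. *)
have trapped x y u v : adj ed x y -> connect (adj ed) u v -> ~~ connect (adj ed) x u ->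
    pos x < pos u < pos y -> pos x < pos v < pos y.
  move=> xy uv xNu hu; apply/negPn/negP => hv.
  have [w [z [uw wz hw hz]]] := connect_exit (p := fun w => pos x < pos w < pos y) uv hu hv.
  have xNz : ~~ connect (adj ed) x z.
    apply: contra xNu => xz; apply: connect_trans xz _.
    by rewrite sC; apply: connect_trans uw (connect1 wz).
  have zx : pos z != pos x by apply: contraNneq xNz => /pos_inj ->.
  have zy : pos z != pos y by apply: contraNneq xNz => /pos_inj ->; apply: connect1.
  have h1 := @nc x y w z xy wz; have h2 := @nc z w x y; rewrite adjC wz xy in h2.
  have {}h2 := h2 isT isT; move: hw hz zx zy h1 h2 => /andP[h3 h4] h5 h6 h7 h8 h9.
  case: (ltnP (pos z) (pos x)) => h10; first by apply: h9.
  by apply: h8; split=> //; clear -h3 h4 h5 h6 h7 h10; lia.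
have [x [y [ax xy]]] := connect_exit (p := fun z => pos z < pos b) a_c ab ltac:(by rewrite
  -leqNgt ltnW).
move=> xb; rewrite -leqNgt leq_eqVlt => /predU1P[/pos_inj yb|by_].
  by case/negP: aNb; rewrite yb; apply: connect_trans ax (connect1 xy).
have [u [v [bu uv]]] := connect_exit (p := fun z => pos z < pos c) bd bc ltac:(by rewrite
  -leqNgt ltnW).
have bNa : ~~ connect (adj ed) b a by rewrite sC.
move=> uc; rewrite -leqNgt leq_eqVlt => /predU1P[/pos_inj vc|cv].
  case/negP: bNa; apply: connect_trans (connect_trans bu (connect1 uv)) _.
  by rewrite -vc sC.
have xNb : ~~ connect (adj ed) x b by apply: contra aNb; apply: connect_trans.
have uNc : ~~ connect (adj ed) u c.
  apply: contra bNa => uc'; apply: connect_trans bu (connect_trans uc' _).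
  by rewrite sC.
(* The edge x y spans b, hence u; the edge u v spans c, hence x. So each of x and u would precede
   the other. *)
have /andP[h1 _] := trapped _ _ _ _ xy bu xNb ltac:(by rewrite xb).
have cx : connect (adj ed) c x by rewrite sC in a_c; apply: connect_trans a_c ax.
have /andP[h2 _] := trapped _ _ _ _ uv cx uNc ltac:(by rewrite uc).
by have := ltn_trans h1 h2; rewrite ltnn.
Qed.

End Graph.

(** * The word f without double roots *)

(** These are not the simple roots r_i, but all roots with coefficients 0 and 1 only. *)
Definition simple b := ~~ dbl b && (0 < fidx b <= lidx b).
Definition arc_lt a b := (fidx a < fidx b) && (lidx a < lidx b).
(* The arc of a root b without double roots joins fidx b - 1 to lidx b. *)
Definition crosses a b := (fidx a < fidx b <= lidx a) && (lidx a < lidx b).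
(** The point t lies strictly under the arc; as the arc starts at [fidx b - 1], the left inequality
    is large. *)
Definition covers t b := fidx b <= t < lidx b.

Lemma arc_lt_trans : transitive arc_lt.
Proof. by move=> b a c; rewrite /arc_lt; lia. Qed.

Lemma coef_gt0 b k : (0 < coef b k) = (fidx b <= k <= lidx b).
Proof. by rewrite /coef; case: ifP => // _; case: ifP. Qed.

Lemma meets_coefP a b : 0 < fidx a -> reflect (exists2 k, 0 < coef a k & coef a k = coef b
  k) (meets a b).
Proof.
move=> a0; apply: (iffP hasP) => [[_ /mapP[k + ->]]|[k ak abk]].
  rewrite mem_filter => /andP[ak _] /mapP[k' _ [h hk]]; exists k => //.
  by rewrite h hk.
have ka : 0 < k by move: ak; rewrite coef_gt0; lia.
have mem x : fidx x <= k <= lidx x -> (coef x k, k) \in supp x.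
  rewrite -(coef_gt0 x) => h; apply/mapP; exists k => //; rewrite mem_filter h mem_iota.
  by move: h; rewrite coef_gt0; lia.
exists (coef a k, k); first by rewrite mem // -(coef_gt0 a).
by rewrite abk; apply: mem; rewrite -(coef_gt0 b) -abk.
Qed.

Lemma simple_coef b k : simple b -> coef b k = (fidx b <= k <= lidx b).
Proof.
case/andP; rewrite /coef /dbl => h1 h2.
by case: (fidx b <= k <= lidx b) / boolP => // h; case: (leqP k (didx b)) => //; lia.
Qed.

Lemma meets_simple a b : simple a -> simple b -> arc_lt a b ->
  meets a b = (fidx b <= lidx a).
Proof.
move=> sa sb /andP[h1 h2]; have a0 : 0 < fidx a by case/and3P: sa.
apply/(meets_coefP _ a0)/idP => [[k]|h].
  by rewrite !simple_coef //; lia.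
by exists (fidx b); rewrite !simple_coef //; case/and3P: sb; lia.
Qed.

Lemma components_cons a s : exists c s',
  [/\ s = c ++ s', components (a :: s) = (a :: c) :: components s',
      path meets a c & if s' is b :: _ then ~~ meets (last a c) b else true].
Proof.
elim: s a => [|b s IH] a; first by exists [::], [::].
have [c [s' [sE cE pc sep]]] := IH b.
rewrite [components (a :: _)]/=; rewrite /= in cE; rewrite cE.
case: ifP => ab; last by exists [::], (b :: s); split=> //=; rewrite ?cE ?ab.
by exists (b :: c), s'; split=> //=; rewrite ?sE ?ab.
Qed.

(** Peels off the first connected component; inductions on [f_word] go through this form. The
    separation clause speaks of two neighbouring roots only, and spreads to all roots by
    monotonicity of the indices. *)
Lemma f_word_cons a s : exists c s',
  [/\ s = c ++ s', f_word (a :: s) = f_connected f_word (a :: c) ++ f_word s',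
      path meets a c & if s' is b :: _ then ~~ meets (last a c) b else true].
Proof.
have [c [s' [sE cE pc sep]]] := components_cons a s.
by exists c, s'; split=> //; rewrite f_wordE cE /= -f_wordE.
Qed.

Lemma foldl_cup f d a s : f <= fidx a -> path arc_lt a s ->
  foldl cup (Root f d (lidx a)) s = Root f d (lidx (last a s)).
Proof.
elim: s a => //= b s IH a fa /andP[/andP[h1 h2] p].
have -> : cup (Root f d (lidx a)) b = Root f d (lidx b).
  by rewrite /cup /=; congr Root; lia.
by apply: IH => //; lia.
Qed.

Lemma foldl_cup_root a s : ~~ dbl a -> path arc_lt a s ->
  foldl cup a s = Root (fidx a) 0 (lidx (last a s)).
Proof.
by case: a => f d l; rewrite /dbl -eqn0Ngt => /= /eqP -> p; rewrite -foldl_cup.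
Qed.

Lemma cap_arc_lt a b : arc_lt a b -> cap a b = Root (fidx b) 0 (lidx a).
Proof. by case/andP => h1 h2; rewrite /cap; congr Root; lia. Qed.

Section Pairmap.
Variables (a : proot) (s : seq proot).
Hypothesis arc_lt_s : path arc_lt a s.

(** Intersecting consecutive roots loses only the first index of the head and, by [lidx_pairmap],
    the last index of the last root. These two are the indices of the union, so rule (a) permutes
    the first indices and the last indices separately. *)
Lemma fidx_pairmap : map fidx (pairmap cap a s) = map fidx s.
Proof.
elim: s a arc_lt_s => //= b s' IH a' /andP[ab p]; rewrite IH //.
by case/andP: ab => h _; congr (_ :: _); lia.
Qed.

Lemma lidx_pairmap : map lidx (pairmap cap a s) = map lidx (belast a s).
Proof.
elim: s a arc_lt_s => //= b s' IH a' /andP[ab p]; rewrite IH //.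
by case/andP: ab => _ h; congr (_ :: _); lia.
Qed.

Lemma simple_pairmap : all simple (a :: s) -> path meets a s -> all simple (pairmap cap a s).
Proof.
elim: s a arc_lt_s => //= b s' IH a' /andP[ab p] /and3P[sa sb ss] /andP[mab m].
rewrite IH //= ?sb // andbT cap_arc_lt //.
move: mab; rewrite meets_simple // => h; case/and3P: sb => _ h4 h5.
by case/and3P: sa; rewrite /simple /dbl /=; lia.
Qed.

Lemma sorted_pairmap : sorted arc_lt (pairmap cap a s).
Proof.
case: s arc_lt_s => //= b s' /andP[ab p].
elim: s' a b ab p => //= c s' IH a' b' ab /andP[bc p]; rewrite IH // andbT.
by rewrite !cap_arc_lt // /arc_lt /=; case/andP: ab; case/andP: bc; lia.
Qed.

Lemma arc_lt_bounds x : x \in a :: s ->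
  fidx a <= fidx x /\ lidx x <= lidx (last a s).
Proof.
elim: s a x arc_lt_s => [|b s' IH] a' x /= p; first by rewrite inE => /eqP ->.
case/andP: p => /andP[h1 h2] p; rewrite inE => /predU1P[->|].
  by have [_] := IH _ _ p (mem_head _ _); lia.
by case/(IH _ _ p); lia.
Qed.

(** Consecutive arcs of a connected antichain overlap or touch beyond their left ends, so the union
    passes over no point that was not already under some arc. *)
Lemma covers_hull t : all simple (a :: s) -> path meets a s ->
  covers t (Root (fidx a) 0 (lidx (last a s))) -> has (covers t) (a :: s).
Proof.
elim: s a arc_lt_s => [|b s' IH] a' /=; first by rewrite orbF.
case/andP=> ab p /and3P[sa sb ss] /andP[mab m] ht.
case: (ltnP t (lidx a')) => hta; first by rewrite {1}/covers hta; case/andP: ht => ->.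
apply/orP; right; apply: IH => //; first by rewrite /= sb ss.
by move: mab; rewrite meets_simple // /covers /=; case/andP: ht => /= _ ->; lia.
Qed.

Lemma covers_pairmap t : ~~ has (covers t) s -> ~~ has (covers t) (pairmap cap a s).
Proof.
elim: s a arc_lt_s => //= b s' IH a' /andP[ab p]; rewrite !negb_or => /andP[h1 h2].
rewrite IH // andbT cap_arc_lt //; move: h1; case/andP: ab; rewrite /covers /=; lia.
Qed.

End Pairmap.

(** In rule (a) the union has the least first index and the greatest last index, so it crosses no
    other arc, and the intersections are one root fewer, whence the induction on the size. Arcs of
    different components are disjoint or share an end. The clause on [covers] serves rule (b), where
    free right ends must stay uncovered. *)
Lemma f_word_simple s : all simple s -> sorted arc_lt s ->
  [/\ all simple (f_word s), perm_eq (map fidx (f_word s)) (map fidx s),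
      perm_eq (map lidx (f_word s)) (map lidx s),
      {in f_word s &, forall a b, ~~ crosses a b} &
      forall t, ~~ has (covers t) s -> ~~ has (covers t) (f_word s)].
Proof.
have [N] := ubnP (size s); elim: N s => // N IH [_ _ _|a s /= sN /andP[sa ss] arc_lt_s];
  first by split=> // x.
have [c [s' [sE -> pc sep]]] := f_word_cons a s.
have ss' : all simple s' by move: ss; rewrite sE all_cat => /andP[].
have sc : all simple (a :: c) by move: ss; rewrite sE all_cat => /andP[h _]; rewrite /= sa.
move: arc_lt_s; rewrite sE cat_path => /andP[arc_lt_c arc_lt_s'].
have [] := IH s' _ ss' (path_sorted arc_lt_s'); first by rewrite sE size_cat in sN; lia.
set w2 := f_word s' => s2 f2 l2 nc2 cov2.
have : [/\ all simple (f_connected f_word (a :: c)),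
      perm_eq (map fidx (f_connected f_word (a :: c))) (map fidx (a :: c)),
      perm_eq (map lidx (f_connected f_word (a :: c))) (map lidx (a :: c)),
      {in f_connected f_word (a :: c) &, forall a b, ~~ crosses a b} &
      forall t, ~~ has (covers t) (a :: c) ->
        ~~ has (covers t) (f_connected f_word (a :: c))].
  case: c sE pc sep sc arc_lt_c arc_lt_s' => [|b c] sE pc sep sc arc_lt_c arc_lt_s'.
    by split=> // x y; rewrite !inE => /eqP -> /eqP ->; rewrite /crosses ltnn.
  have -> : f_connected f_word [:: a, b & c] = f_nodouble f_word [:: a, b & c].
    rewrite /f_connected ifF //; apply/hasPn => x /(allP sc).
    by case/andP.
  rewrite /f_nodouble -[pairmap _ _ _]/(pairmap cap a (b :: c)).
  rewrite foldl_cup_root //; last by case/andP: sa.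
  have [] := IH (pairmap cap a (b :: c)) _ (simple_pairmap arc_lt_c sc pc) (sorted_pairmap
    arc_lt_c).
    by rewrite size_pairmap; move: sN; rewrite sE size_cat; clear; lia.
  set w1 := f_word _ => s1; rewrite fidx_pairmap // lidx_pairmap // => f1 l1 nc1 cov1.
  set o := Root _ _ _.
  have inner x : x \in w1 -> fidx a <= fidx x /\ lidx x <= lidx o.
    move=> xw; split.
      have := map_f fidx xw; rewrite (perm_mem f1) => /mapP[y yc ->].
      by have [] := arc_lt_bounds arc_lt_c (mem_behead (s := a :: b :: c) yc).
    have := map_f lidx xw; rewrite (perm_mem l1) => /mapP[y yc ->].
    by have [] := arc_lt_bounds arc_lt_c (mem_belast yc).
  split.
  - rewrite [all _ _]/= s1 andbT; case/and3P: sa => _ h2 h3.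
    have [_ h4] := arc_lt_bounds arc_lt_c (mem_head _ _).
    by rewrite /simple /o /dbl /= h2; apply: leq_trans h3 h4.
  - by rewrite /= perm_cons.
  - rewrite (lastI a (b :: c)) map_rcons perm_sym perm_rcons perm_sym.
    by rewrite [map _ (o :: _)]/= perm_cons.
  - move=> x y; rewrite !inE => /predU1P[->|xw] /predU1P[->|yw].
    + by rewrite /crosses ltnn.
    + by rewrite /crosses [lidx o < _]ltnNge (inner y yw).2 andbF.
    + by rewrite /crosses ltnNge (inner x xw).1.
    + exact: nc1.
  - move=> t ht; rewrite [has _ _]/= negb_or; apply/andP; split.
      by apply: contra ht; apply: covers_hull.
    apply: cov1; apply: covers_pairmap => //.
    by move: ht; rewrite [has _ (a :: _)]/= negb_or => /andP[].
set w1 := f_connected _ _; case=> s1 f1 l1 nc1 cov1.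
(* The components are separated between [last a c] and the head of [s']; last indices are largest at
   the former and first indices smallest at the latter. *)
have sepc x y : x \in a :: c -> y \in s' -> lidx x < fidx y.
  move=> xc ys'; have [_ h1] := arc_lt_bounds arc_lt_c xc.
  case: s' {sE s2 f2 l2 nc2 cov2 w2 sN} sep ys' ss' arc_lt_s' => // b s' sep ys' ss' /=
    /andP[ll arc_lt_s'].
  have [h2 _] := arc_lt_bounds arc_lt_s' ys'.
  have sl : simple (last a c) by apply: (allP sc); apply: mem_last.
  have sb : simple b by case/andP: ss'.
  rewrite meets_simple // -ltnNge in sep.
  exact: leq_ltn_trans h1 (leq_trans sep h2).
have lw1 x y : x \in w1 -> y \in w2 -> lidx x < fidx y.
  move=> /(map_f lidx); rewrite (perm_mem l1) => /mapP[x' x'c ->].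
  by move=> /(map_f fidx); rewrite (perm_mem f2) => /mapP[y' y's ->]; apply: sepc.
split.
- by rewrite all_cat s1.
- by rewrite -map_cons -cat_cons !map_cat perm_cat.
- by rewrite -map_cons -cat_cons !map_cat perm_cat.
- move=> x y; rewrite !mem_cat => /orP[xw|xw] /orP[yw|yw].
  + exact: nc1.
  + by rewrite /crosses [fidx y <= _]leqNgt lw1 ?andbF.
  + have := lw1 _ _ yw xw; case/and3P: (allP s2 _ xw) => _ _; clear; rewrite /crosses; lia.
  + exact: nc2.
- move=> t; rewrite -[covers t a || _]/(has (covers t) ((a :: c) ++ s')) !has_cat.
  move: (cov1 t) (cov2 t); case: (has _ (a :: c)) => //= h1 h2 h3.
  by rewrite negb_or h1 // h2.
Qed.

(** * l-links, u-links and the word f with double roots *)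

Section Pairwise.
Variables (T : eqType) (r : rel T).
Implicit Types (s : seq T) (x y : T).

Lemma pairwise_cmp s x y : pairwise r s -> x \in s -> y \in s ->
  [\/ x = y, r x y | r y x].
Proof.
elim: s => //= a s IH /andP[/allP ra ps]; rewrite !inE.
move=> /predU1P[->|xs] /predU1P[->|ys].
- by constructor 1.
- by constructor 2; apply: ra.
- by constructor 3; apply: ra.
- exact: IH.
Qed.

Lemma pairwise_head s x x0 : pairwise r s -> x \in s ->
  x = head x0 s \/ r (head x0 s) x.
Proof.
case: s => //= a s /andP[/allP ra _]; rewrite inE => /predU1P[->|/ra]; by [left|right].
Qed.

Lemma pairwise_last s x x0 : pairwise r s -> x \in s ->
  x = last x0 s \/ r x (last x0 s).
Proof.
case/lastP: s => // s a; rewrite last_rcons -cats1 pairwise_cat allrel1r => /and3P[/allP ra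
  _ _].
by rewrite mem_cat inE => /orP[/ra|/eqP]; [right|left].
Qed.

End Pairwise.

Definition wf_root b := [&& 0 < fidx b, fidx b <= lidx b, didx b < lidx b & dbl b ==> (fidx
  b == 1)].

(** For well-formed roots this is incomparability in the root order together with a smaller last
    index, as [antichain_lt_coef] and [coef_antichain_lt] show. The case analysis records that
    double roots come first, with decreasing double indices. *)
Definition antichain_lt a b := (lidx a < lidx b) &&
  (if dbl b then dbl a && (didx b < didx a) else dbl a || (fidx a < fidx b)).

(** A linked pair stands for the arc from [fidx p.2 - 1] to [didx p.1]. Each round takes the
    rightmost left end that can be matched and the nearest right end beyond it, which is bracket
    matching from the right. The last three clauses say that arcs do not cross, that no free double
    index lies under an arc, and that an unmatched left end is passed neither by an arc starting
    before it nor by a free double index. *)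
Lemma llinksP N D G : size G <= N ->
  pairwise (fun a b => didx b < didx a) D -> pairwise (fun a b => fidx a < fidx b) G ->
  uniq D -> uniq G -> let L := llinks N D G in
  [/\ [/\ uniq (map fst L), {subset map fst L <= D}, uniq (map snd L) & {subset map snd L
    <= G}],
   {in L, forall p, fidx p.2 != 1 /\ fidx p.2 <= didx p.1},
   {in L &, forall p q, ~ [/\ fidx p.2 < fidx q.2, fidx q.2 <= didx p.1 & didx p.1 < didx q.1]},
   (forall a, a \in D -> a \notin map fst L ->
     {in L, forall p, fidx p.2 <= didx a -> didx p.1 <= didx a}) &
   (forall b, b \in G -> b \notin map snd L -> fidx b != 1 ->
     {in L, forall p, fidx p.2 < fidx b -> didx p.1 < fidx b} /\
     forall a, a \in D -> a \notin map fst L -> didx a < fidx b)].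
Proof.
elim: N D G => [|N IH] D G sN pD pG uD uG /=.
  by case: G sN {pG uG} => // _; split.
case E: (rev _) => [|b t].
  split=> //= b bG _ b1; split=> // a aD _.
  have : b \notin rev [seq b <- G | lpartners D b != [::]] by rewrite E.
  rewrite mem_rev mem_filter bG andbT negbK => /eqP Eb.
  have : a \notin lpartners D b by rewrite Eb.
  by rewrite mem_filter aD b1 andbT -ltnNge.
have {E}E : [seq b <- G | lpartners D b != [::]] = rcons (rev t) b.
  by rewrite -[LHS]revK E rev_cons.
(* Double indices decrease along [D], so the last partner has the least double index; the default
   [b] is never returned because the list of partners is not empty. *)
set a := last b _.
have : b \in rcons (rev t) b by rewrite mem_rcons mem_head.
rewrite -E mem_filter => /andP[bn bG].
have bmax b' a' : b' \in G -> fidx b' != 1 -> a' \in D -> fidx b' <= didx a' -> fidx b' <=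
  fidx b.
  move=> b'G b'1 a'D h; have b'f : b' \in [seq b <- G | lpartners D b != [::]].
    rewrite mem_filter b'G andbT; apply/eqP => e.
    have : a' \in lpartners D b' by rewrite mem_filter b'1 h.
    by rewrite e.
  have := pairwise_last b' (pairwise_filter _ pG) b'f.
  by rewrite E last_rcons => -[->//|/ltnW].
have al : a \in lpartners D b.
  by rewrite /a; case: (lpartners D b) bn => //= x u _; apply: mem_last.
move: (al); rewrite mem_filter => /andP[/andP[b1 ba] aD].
have amin a' : a' \in D -> fidx b <= didx a' -> didx a <= didx a'.
  move=> a'D h; have a'f : a' \in lpartners D b by rewrite mem_filter b1 h.
  by have [->|/ltnW] := pairwise_last b (pairwise_filter _ pD) a'f.
have sD : {subset rem a D <= D} by apply: mem_subseq; apply: rem_subseq.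
have sG : {subset rem b G <= G} by apply: mem_subseq; apply: rem_subseq.
have szG : size (rem b G) <= N.
  by rewrite size_rem // -ltnS (leq_trans _ sN) //; case: (G) bG.
have := IH (rem a D) (rem b G) szG (subseq_pairwise (rem_subseq _ _) pD)
  (subseq_pairwise (rem_subseq _ _) pG) (rem_uniq _ uD) (rem_uniq _ uG).
set L := llinks _ _ _ => -[[u1 s1 u2 s2] P1 P2 P3 P4].
have inL p : p \in L -> [/\ p.1 \in D, p.2 \in G, p.1 != a & p.2 != b].
  move=> pL; have := s1 _ (map_f fst pL); have := s2 _ (map_f snd pL).
  by rewrite !mem_rem_uniq // !inE => /andP[-> ->] /andP[-> ->].
split.
- split=> /=.
  + by rewrite u1 andbT; apply/mapP => -[p /inL[_ _ /eqP h _] /esym].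
  + by move=> x; rewrite inE => /predU1P[->|/s1/sD].
  + by rewrite u2 andbT; apply/mapP => -[p /inL[_ _ _ /eqP h] /esym].
  + by move=> x; rewrite inE => /predU1P[->|/s2/sG].
- by move=> p; rewrite inE => /predU1P[->|/P1].
- move=> p q; rewrite !inE => /predU1P[->|pL] /predU1P[->|qL] /=.
  + by case; rewrite ltnn.
  + have [qD qG _ _] := inL q qL; have [q1 q2] := P1 q qL.
    by case; rewrite ltnNge (bmax _ _ qG q1 qD q2).
  + have [pD' pG' _ _] := inL p pL.
    by case=> _ h1; rewrite ltnNge amin.
  + exact: P2.
- move=> x xD; rewrite /= inE negb_or => /andP[xa xL] p; rewrite inE => /predU1P[-> /=|pL].
    exact: amin.
  by apply: P3 => //; rewrite mem_rem_uniq // inE xa.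
- move=> y yG; rewrite /= inE negb_or => /andP[yb yL] y1.
  have yr : y \in rem b G by rewrite mem_rem_uniq // inE yb.
  have [h1 h2] := P4 y yr yL y1; split=> [p|x xD].
    rewrite inE => /predU1P[-> /= by_|/h1 //].
    by rewrite ltnNge; apply: contraL by_ => h; rewrite -leqNgt (bmax y a).
  rewrite inE negb_or => /andP[xa xL]; apply: h2 => //.
  by rewrite mem_rem_uniq // inE xa.
Qed.

Lemma mem_take_index (s : seq proot) b x :
  pairwise (fun a b => lidx a < lidx b) s -> b \in s ->
  (x \in take (index b s) s) = (x \in s) && (lidx x < lidx b).
Proof.
elim: s => //= a s IH /andP[/allP ra ps]; rewrite !inE.
have [<- _|ba /= bs] := eqVneq a b; rewrite /= ?inE.
  have [->|_ /=] := eqVneq x a; rewrite ?ltnn //.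
  by apply/esym/negbTE/negP => /andP[/ra h1 h2]; lia.
rewrite IH //.
by have [->|//] := eqVneq x a; rewrite /= ra.
Qed.

(** Every admissible root gets linked because its immediate predecessor, which meets it, is still
    free: by the hypothesis on [used], a used root is separated from each remaining admissible root
    by another root of [s]. Taking the leftmost partner makes the links monotone, and makes any
    skipped root end before the arc of every later link begins. *)
Lemma ulinksP s N adm used : size adm <= N ->
  pairwise (fun a b => lidx a < lidx b) s -> {in s &, forall a b, lidx a < lidx b -> ~~ dbl
    b -> fidx a <= fidx b} ->
  {subset adm <= s} -> pairwise (fun a b => fidx a < fidx b) adm ->
  pairwise (fun a b => lidx a < lidx b) adm -> all (predC dbl) adm ->
  {in adm, forall b, exists x, [/\ x \in s, lidx x < lidx b, fidx b <= lidx x &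
     {in s, forall y, lidx y < lidx b -> lidx y <= lidx x}]} ->
  {in used & adm, forall u b, exists v, [/\ v \in s, lidx u < lidx v & lidx v < lidx b]} ->
  let U := ulinks N s adm used in
  [/\ map snd U = adm, pairwise (fun p q => lidx p.1 < lidx q.1) U,
   {in U, forall p, [/\ p.1 \in s, p.1 \notin used, lidx p.1 < lidx p.2 & fidx p.2 <= lidx
     p.1]} &
   forall x, x \in s -> x \notin used -> x \notin map fst U ->
     {in U, forall p, lidx x < lidx p.1 -> lidx x < fidx p.2}].
Proof.
move=> + ps fs; elim: N adm used => [|N IH] [|b adm] used //=; try by move=> *;
  split=> // ? ? ? ? ?.
move=> sN sub /andP[/allP fb pf] /andP[/allP lb pl] /andP[ndb nda] pred inv.
have bs : b \in s by apply: sub; rewrite mem_head.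
have partnersE x : (x \in upartners s used b) =
    [&& x \in s, x \notin used, lidx x < lidx b & fidx b <= lidx x].
  rewrite mem_filter mem_take_index //; case xs: (x \in s); rewrite /= ?andbF //.
  case xb: (lidx x < lidx b); rewrite /= ?andbF // ?andbT.
  by rewrite (fs _ _ _ _ xb ndb) // xs.
have bn : upartners s used b != [::].
  have [x [xs xb bx xmax]] := pred b (mem_head _ _).
  suff : x \in upartners s used b by apply: contraL => /eqP ->.
  rewrite partnersE xs xb bx !andbT /=; apply/negP => xu.
  have [v [vs xv vb]] := inv x b xu (mem_head _ _).
  by have := xmax v vs vb; rewrite leqNgt xv.
rewrite bn; set a := head b _.
have au : a \in upartners s used b.
  by rewrite /a; case: (upartners _ _ _) bn => //= x u _; rewrite mem_head.
have amin x : x \in upartners s used b -> x = a \/ lidx a < lidx x.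
  move=> xu; have pw : pairwise (fun a b => lidx a < lidx b) (upartners s used b).
    by apply: pairwise_filter; apply: subseq_pairwise ps; apply: take_subseq.
  exact: (pairwise_head b pw xu).
move: (au); rewrite partnersE => /and4P[as_ aNu ab ba].
rewrite eqxx.
have sub' : {subset adm <= s} by move=> x xa; apply: sub; rewrite inE xa orbT.
have := IH adm (a :: used) _ sub' pf pl nda _ _.
case=> //.
- by move=> x xa; apply: pred; rewrite inE xa orbT.
- move=> u x; rewrite inE => /predU1P[->|uu] xa.
    by exists b; split=> //; apply: lb.
  by apply: inv => //; rewrite inE xa orbT.
set U := ulinks _ _ _ _ => Usnd Ufst U1 U2.
split; first by rewrite /= Usnd.
- rewrite /= Ufst andbT; apply/allP => p pU /=.
  have [h1 h2 h3 h4] := U1 p pU; rewrite inE negb_or in h2; case/andP: h2 => pa pu.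
  have pb : fidx b < fidx p.2 by apply: fb; rewrite -Usnd map_f.
  case: (ltnP (lidx p.1) (lidx b)) => hpb; last exact: leq_trans ab hpb.
  have [] := amin p.1; rewrite ?partnersE ?h1 ?pu ?hpb //=.
    exact: leq_trans (ltnW pb) h4.
  by move/eqP; rewrite (negbTE pa).
- move=> p; rewrite inE => /predU1P[->|pU] //.
  have [h1 h2 h3 h4] := U1 p pU; split=> //.
  by move: h2; rewrite inE negb_or => /andP[].
- move=> x xs xu; rewrite /= inE negb_or => /andP[xa xU] p;
  rewrite inE => /predU1P[-> /= xla|pU].
    rewrite ltnNge; apply/negP => bx.
    have [] := amin x; first by rewrite partnersE xs xu bx (ltn_trans xla ab).
      by move/eqP; rewrite (negbTE xa).
    by rewrite ltnNge (ltnW xla).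
  by apply: U2 => //; rewrite inE negb_or xa.
Qed.

Definition nonnesting s := all wf_root s && pairwise antichain_lt s.

Lemma perm_cat_filterN (T : eqType) (u s : seq T) : uniq u -> uniq s ->
  {subset u <= s} -> perm_eq (u ++ [seq x <- s | x \notin u]) s.
Proof.
move=> uu us sub; rewrite perm_sym -(perm_filterC (mem u) s) perm_sym perm_cat2r.
apply: uniq_perm => //; first exact: filter_uniq.
by move=> x; rewrite mem_filter /=; case xu: (x \in u) => //=; rewrite sub.
Qed.

(** The witness is the immediate predecessor of b in the list. This feeds the predecessor hypothesis
    of [ulinksP]. *)
Lemma pairwise_path (T : eqType) (r e : rel T) a s b : pairwise r (a :: s) -> path e a s ->
  b \in s -> exists x, [/\ x \in a :: s, e x b, r x b &
    {in a :: s, forall y, [\/ r b y, y = b, y = x | r y x]}].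
Proof.
move=> pw + bs; case/splitPr: bs pw => p1 p2.
rewrite -cat_cons pairwise_cat cat_path => /and3P[/allrelP r12 pw1 /andP[/allP rb pw2]]
  /and3P[_ e1 _].
exists (last a p1); split=> //.
- by rewrite mem_cat mem_last.
- by apply: r12; rewrite ?mem_last ?mem_head.
move=> y; rewrite mem_cat inE => /or3P[y1|/eqP ->|/rb h]; last by constructor 1.
  by have [->|] := pairwise_last a pw1 y1; [constructor 3|move=> h; constructor 4].
by constructor 2.
Qed.

Lemma wf_root_simple b : wf_root b -> simple b = ~~ dbl b.
Proof. by case/and4P=> h1 h2 _ _; rewrite /simple h1 h2 /= andbT.
Qed.

Section Nonnesting.
Variable s : seq proot.
Hypothesis nn_s : nonnesting s.

Lemma nonnesting_wf_root : {in s, forall a, wf_root a}.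
Proof. by apply/allP; case/andP: nn_s. Qed.

Lemma nonnesting_antichain_lt : {in s &, forall a b, lidx a < lidx b -> antichain_lt a b}.
Proof.
case/andP: nn_s => _ pw a b aS bS ab; case: (pairwise_cmp pw aS bS) => // [ba|/andP[ba _]].
  by rewrite ba ltnn in ab.
by rewrite ltnNge (ltnW ba) in ab.
Qed.

Lemma nonnesting_lidx : pairwise (fun a b => lidx a < lidx b) s.
Proof. by case/andP: nn_s => _; apply: sub_pairwise => a b /andP[]. Qed.

Lemma nonnesting_didx : pairwise (fun a b => didx b < didx a) [seq a <- s | dbl a].
Proof.
case/andP: nn_s => _ /(pairwise_filter dbl) pw.
apply: (sub_in_pairwise (P := dbl)) (filter_all _ _) pw => a b aD bD.
by rewrite /antichain_lt; case/andP => _; rewrite (bD : dbl b) => /andP[].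
Qed.

Lemma nonnesting_fidx : pairwise (fun a b => fidx a < fidx b) [seq a <- s | ~~ dbl a].
Proof.
case/andP: nn_s => _ /(pairwise_filter (predC dbl)) pw.
apply: (sub_in_pairwise (P := predC dbl)) (filter_all _ _) pw => a b /= aD bD.
by rewrite /antichain_lt (negbTE aD) (negbTE bD) => /andP[].
Qed.

Lemma nonnesting_arc_lt : pairwise arc_lt [seq a <- s | ~~ dbl a].
Proof.
pose r a b := fidx a < fidx b; pose r' a b := lidx a < lidx b.
rewrite -[arc_lt]/(fun a b => [rel x y | r x y && r' x y] a b) (pairwise_relI r r').
by rewrite nonnesting_fidx pairwise_filter // nonnesting_lidx.
Qed.

(** All double indices lie below all last indices. Hence no l-link arc reaches a last index, and the
    sorted list of right ends splits into double indices followed by last indices. *)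
Lemma didx_lt_lidx : {in s &, forall a b, dbl a -> didx a < lidx b}.
Proof.
move=> a b aS bS da; have [_ _ ha _] := and4P (nonnesting_wf_root aS).
have [_ _ hb _] := and4P (nonnesting_wf_root bS).
case: (ltngtP (lidx a) (lidx b)) => [ab|ba|<- //]; first exact: ltn_trans ha ab.
have := nonnesting_antichain_lt bS aS ba; rewrite /antichain_lt da => /and3P[_ _ h].
exact: ltn_trans h hb.
Qed.

Lemma uniq_rights : uniq (map lidx s ++ [seq didx a | a <- s & dbl a]).
Proof.
rewrite cat_uniq; apply/and3P; split.
- by apply: (@pairwise_uniq _ ltn) ltnn _; rewrite pairwise_map nonnesting_lidx.
- apply/hasPn => _ /mapP[a + ->]; rewrite mem_filter => /andP[da aS].
  by apply/mapP => -[b bS h]; have := didx_lt_lidx aS bS da; rewrite h ltnn.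
- apply: (@pairwise_uniq _ gtn) ltnn _.
  by rewrite pairwise_map nonnesting_didx.
Qed.

End Nonnesting.

(** The factors pi_1, ..., pi_l, pi_0 of rule (b), with l and the presence of pi_0 read off from the
    size of T instead of from the antichain; [size_f_spec] reconciles the two. *)
Definition tword (T : seq nat) :=
  [seq Root 1 (nth 0 T j) (nth 0 T (size T - j.+1)) | j <- iota 0 (size T)./2] ++
  (if odd (size T) then [:: Root 1 0 (nth 0 T (size T)./2)] else [::]).

(* In the positive half of a type B diagram, w lists the arcs and T the points
   joined to the negative half. *)
Definition f_spec s (T : seq nat) (w : seq proot) :=
  [/\ all simple w,
      perm_eq (map fidx w) [seq fidx b | b <- s & ~~ dbl b && (fidx b != 1)],
      perm_eq (map lidx w ++ T) (map lidx s ++ [seq didx b | b <- s & dbl b]),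
      sorted ltn T &
      {in w &, forall a b, ~~ crosses a b} /\ {in T, forall t, ~~ has (covers t) w}].

(** T absorbs the excess of right ends over left ends: a root with double roots has two right ends
    and no left end, and a root r_1 + ... + r_j has one right end and no left end. *)
Lemma size_f_spec s T w : f_spec s T w ->
  size T = count dbl s * 2 + count (fun b => ~~ dbl b && (fidx b == 1)) s.
Proof.
case=> _ /perm_size + /perm_size + _ _.
rewrite !size_cat !size_map !size_filter => ->.
have : size s = count dbl s + count (fun b => ~~ dbl b && (fidx b == 1)) s
    + count (fun b => ~~ dbl b && (fidx b != 1)) s.
  by elim: s => //= a s ->; case: (dbl a) => /=; case: (fidx a == 1) => /=; lia.
have arith (x y z t : nat) : z + t = x + y + z + x -> t = x * 2 + y by lia.
by move=> ->; apply: arith.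
Qed.

(* Left ends are matched to last double indices like brackets by the l-links.
   The u-links serve the remaining ones first come, first served: this selects
   the same right ends as a bracket matching, and f then uncrosses the pairs.
   Greediness makes both kinds of arcs avoid the right ends left free. *)
Lemma f_double_spec a s : nonnesting (a :: s) -> path meets a s -> dbl a ->
  exists T w, f_double f_word (a :: s) = tword T ++ w /\ f_spec (a :: s) T w.
Proof.
set S := a :: s => nn pm da.
have wfS := nonnesting_wf_root nn.
pose D := [seq a <- S | dbl a]; pose G := [seq a <- S | ~~ dbl a].
have uS : uniq S by apply: pairwise_uniq (nonnesting_lidx nn) => x; apply: ltnn.
have uD : uniq D by apply: filter_uniq.
have uG : uniq G by apply: filter_uniq.
pose L := llinks (size G) D G.
pose adm := [seq b <- G | (fidx b != 1) && (b \notin [seq p.2 | p <- L])].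
pose U := ulinks (size adm) S adm [::].
pose T1 := [seq didx a | a <- D & a \notin [seq p.1 | p <- L]].
pose T2 := [seq lidx a | a <- S & a \notin [seq p.1 | p <- U]].
pose T := sort leq (undup (T1 ++ T2)).
pose tl := [seq dcap p.1 p.2 | p <- sort (fun p q => lidx q.1 <= lidx p.1) L].
pose tu := [seq cap p.1 p.2 | p <- sort (fun p q => lidx p.2 <= lidx q.2) U].
have DS x : x \in D -> x \in S /\ dbl x by rewrite mem_filter => /andP[].
have GS x : x \in G -> x \in S /\ ~~ dbl x by rewrite mem_filter => /andP[].
have [[uL1 sL1 uL2 sL2] L1 L2 L3 L4] :=
  llinksP (leqnn (size G)) (nonnesting_didx nn) (nonnesting_fidx nn) uD uG.
rewrite -/L in uL1 sL1 uL2 sL2 L1 L2 L3 L4.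
have admE b : (b \in adm) = [&& b \in G, fidx b != 1 & b \notin [seq p.2 | p <- L]].
  by rewrite mem_filter andbC.
have subadm : {subset adm <= S} by move=> b; rewrite admE => /andP[/GS[]].
have admG : subseq adm G by apply: filter_subseq.
have [|||||||Usnd Upw U1 U2] := @ulinksP S (size adm) adm [::] (leqnn _) (nonnesting_lidx nn).
- move=> x y xS yS xy ny; have := nonnesting_antichain_lt nn xS yS xy;
  rewrite /antichain_lt (negbTE ny).
  case/andP=> _ /orP[dx|/ltnW //]; have [_ _ _ /implyP/(_ dx)/eqP ->] := and4P (wfS _ xS).
  by have [] := and4P (wfS _ yS).
- exact: subadm.
- exact: subseq_pairwise admG (nonnesting_fidx nn).
- by apply: subseq_pairwise admG _; apply: pairwise_filter; apply: nonnesting_lidx.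
- by apply/allP => b /(mem_subseq admG)/GS[].
- move=> b bA; have bS := subadm b bA.
  have /GS[_ nb] := mem_subseq admG bA.
  (* The head [a] has double roots and [b] has none, so [b] has a predecessor, and connectedness
     makes the two meet. *)
  have bs : b \in s by move: bS; rewrite inE => /predU1P[E|//]; rewrite E da in nb.
  have [x [xS mxb xb xmax]] := pairwise_path (proj2 (andP nn)) pm bs.
  exists x; split=> //.
  + by case/andP: xb.
  + have x0 : 0 < fidx x by case/and4P: (wfS _ xS).
    by case/(meets_coefP _ x0): mxb => k k1 k2; move: k1 (k1); rewrite {2}k2 !coef_gt0;
      clear; lia.
  + move=> y yS yb; case: (xmax y yS) => [/andP[by_ _]|yE|->|/andP[/ltnW //]] //.
      by rewrite ltnNge (ltnW by_) in yb.
    by rewrite yE ltnn in yb.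
- by move=> u.
rewrite -/U in Usnd Upw U1 U2.
have inL p : p \in L -> [/\ p.1 \in D, p.1 \in S, p.2 \in S, dbl p.1 & 0 < fidx p.2].
  move=> pL; have /DS[h1 h2] := sL1 _ (map_f fst pL); have /GS[h3 _] := sL2 _ (map_f snd pL).
  split=> //; first exact: sL1 (map_f fst pL).
  by case/and4P: (wfS _ h3).
have memL p : (p \in sort (fun p q => lidx q.1 <= lidx p.1) L) = (p \in L) by rewrite mem_sort.
(* The bound 2 in [dcap] is harmless since an l-linked root has first index different from 1, and
   the minimum is the double index by [didx_lt_lidx]. *)
have tlE : tl = [seq Root (fidx p.2) 0 (didx p.1) | p <- sort (fun p q => lidx q.1 <= lidx
  p.1) L].
  apply/eq_in_map => p; rewrite memL => pL; have [_ h1 h2 h3 h4] := inL p pL.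
  have [h5 _] := L1 p pL; have h6 := didx_lt_lidx nn h1 h2 h3.
  rewrite /dcap (minn_idPl (ltnW h6)) (maxn_idPr _) //.
  by rewrite ltn_neqAle eq_sym h5.
have inU p : p \in U -> [/\ p.1 \in S, p.2 \in adm, antichain_lt p.1 p.2 & fidx p.1 <= fidx
  p.2].
  move=> pU; have [h1 _ h2 h3] := U1 p pU.
  have h4 : p.2 \in adm by rewrite -Usnd map_f.
  have h5 := nonnesting_antichain_lt nn h1 (subadm _ h4) h2; split=> //.
  have /GS[h6 nb] := mem_subseq admG h4; case/andP: (h5) => _; rewrite (negbTE nb).
  case/orP => [db|/ltnW //]; have [_ _ _ /implyP/(_ db)/eqP ->] := and4P (wfS _ h1).
  by case/and4P: (wfS _ h6).
have sortU : sort (fun p q : proot * proot => lidx p.2 <= lidx q.2) U = U.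
  apply: pairwise_sort; have : pairwise (fun a b => lidx a < lidx b) (map snd U).
    by rewrite Usnd; apply: subseq_pairwise admG _; apply: pairwise_filter;
      apply: nonnesting_lidx.
  by rewrite pairwise_map; apply: sub_pairwise => p q /ltnW.
have tuE : tu = [seq Root (fidx p.2) 0 (lidx p.1) | p <- U].
  rewrite /tu sortU; apply/eq_in_map => p pU; have [_ _ /andP[h1 _] h2] := inU p pU.
  by rewrite /cap (minn_idPl (ltnW h1)) (maxn_idPr h2).
have fidx_tu : map fidx tu = map fidx adm by rewrite tuE -map_comp -Usnd -map_comp.
have lidx_tu : map lidx tu = map lidx (map fst U) by rewrite tuE -!map_comp.
have simple_tu : all simple tu.
  rewrite tuE all_map; apply/allP => p pU; have [h1 _ h2 h3] := U1 p pU.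
  have [_ /subadm h4 _ _] := inU p pU; rewrite /= /simple /dbl /= h3 andbT.
  by case/and4P: (wfS _ h4).
have sorted_tu : sorted arc_lt tu.
  rewrite (sorted_pairwise arc_lt_trans) tuE pairwise_map.
  pose r (p q : proot * proot) := fidx p.2 < fidx q.2.
  pose r' (p q : proot * proot) := lidx p.1 < lidx q.1.
  rewrite (_ : pairwise _ U = pairwise [rel x y | r x y && r' x y] U) // (pairwise_relI r
    r') Upw andbT.
  have : pairwise (fun a b => fidx a < fidx b) (map snd U).
    by rewrite Usnd; apply: subseq_pairwise admG _; apply: nonnesting_fidx.
  by rewrite pairwise_map.
have [sW fW lW ncW covW] := f_word_simple simple_tu sorted_tu.
set W := f_word tu in sW fW lW ncW covW.
have inW x : x \in W -> (exists2 b, b \in adm & fidx x = fidx b) /\ (exists2 a, a \in S &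
  lidx x = lidx a).
  move=> xW; split.
    have := map_f fidx xW; rewrite (perm_mem fW) fidx_tu => /mapP[b bA ->]; by exists b.
  have := map_f lidx xW; rewrite (perm_mem lW) lidx_tu => /mapP[_ /mapP[p pU ->] ->].
  by exists p.1 => //; case: (inU p pU).
have uT : uniq (T1 ++ T2).
  rewrite uniq_catC; apply: subseq_uniq (uniq_rights nn).
  by apply: cat_subseq; apply: map_subseq; apply: filter_subseq.
have permT : perm_eq T (T1 ++ T2) by rewrite /T undup_id // perm_sort.
have spec : f_spec S T (tl ++ W).
  split.
  - rewrite all_cat sW andbT tlE all_map; apply/allP => p; rewrite memL => pL.
    have [_ _ _ _ h1] := inL p pL; have [_ h2] := L1 p pL.
    by rewrite /= /simple /dbl /= h1.
  - rewrite map_cat tlE -map_comp.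
    apply: (@perm_trans _ (map fidx (map snd L) ++ map fidx adm)).
      by apply: perm_cat; rewrite -?map_comp -?fidx_tu // perm_map // perm_sort.
    rewrite -map_cat; apply: perm_map.
    have -> : [seq b <- S | ~~ dbl b && (fidx b != 1)] = [seq b <- G | fidx b != 1].
      by rewrite -filter_predI; apply: eq_filter => x /=; rewrite andbC.
    have -> : adm = [seq b <- [seq b <- G | fidx b != 1] | b \notin [seq p.2 | p <- L]].
      by rewrite -filter_predI; apply: eq_filter => x /=; rewrite andbC.
    apply: perm_cat_filterN => //; first exact: filter_uniq.
    move=> b /[dup] bL; rewrite mem_filter => /sL2 ->; rewrite andbT.
    by case/mapP: bL => p /L1[h _] ->.
  - apply: (@perm_trans _ ((map didx (map fst L) ++ map lidx (map fst U)) ++ (T1 ++ T2))).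
      apply: perm_cat => //; rewrite map_cat tlE -map_comp.
      by apply: perm_cat; rewrite -?lidx_tu // -map_comp perm_map // perm_sort.
    rewrite perm_catACA perm_catC; apply: perm_cat.
      rewrite -map_cat; apply: perm_map; apply: perm_cat_filterN => //.
        apply: (@map_uniq _ _ lidx); rewrite -map_comp.
        by apply: (@pairwise_uniq _ ltn) ltnn _; rewrite pairwise_map.
      by move=> x /mapP[p /inU[h _ _ _] ->].
    by rewrite -map_cat; apply: perm_map; apply: perm_cat_filterN.
  - rewrite ltn_sorted_uniq_leq sort_uniq undup_uniq /=.
    by apply: sort_sorted; apply: leq_total.
  - split.
    + have tlP x : x \in tl -> exists2 p, p \in L & x = Root (fidx p.2) 0 (didx p.1).
        by rewrite tlE => /mapP[p]; rewrite memL => pL ->; exists p.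
      move=> x y; rewrite !mem_cat => /orP[/tlP[p pL ->]|xW] /orP[/tlP[q qL ->]|yW].
      * apply/negP => /andP[/andP[h1 h2] h3]; exact: (L2 p q pL qL).
      * have [[b + E] _] := inW y yW; rewrite admE => /and3P[bG b1 bL].
        have [h _] := L4 b bG bL b1.
        rewrite /crosses /= E; apply/negP => /andP[/andP[h1 h2] _].
        by have := h p pL h1; rewrite ltnNge h2.
      * have [_ [b bS E]] := inW x xW; have [_ qS _ dq _] := inL q qL.
        by rewrite /crosses /= E [lidx b < _]ltnNge (ltnW (didx_lt_lidx nn qS bS dq)) andbF.
      * exact: ncW.
    (* A free double index is avoided by l-link arcs through [L3], and lies before every admissible
       left end through [L4]. A free last index exceeds all double indices, and is avoided by u-link
       arcs through [U2]. In both cases [covW] passes from the intersections to the value of f on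
       them. *)
    + move=> t; rewrite (perm_mem permT) mem_cat has_cat negb_or.
      case/orP => /mapP[c]; rewrite mem_filter => /andP[cN cS] ->.
        apply/andP; split.
          rewrite tlE has_map; apply/hasPn => p; rewrite memL => pL /=.
          by apply/negP => /andP[/= h1]; rewrite ltnNge (L3 c cS cN p pL h1).
        apply: covW; rewrite tuE has_map; apply/hasPn => p pU /=.
        have [_ + _ _] := inU p pU; rewrite admE => /and3P[bG b1 bL].
        have [_ /(_ c cS cN) h] := L4 _ bG bL b1.
        by rewrite /covers /= leqNgt h.
      apply/andP; split.
        rewrite tlE has_map; apply/hasPn => p; rewrite memL => pL /=.
        have [_ pS _ dp _] := inL p pL.
        by rewrite /covers /= [lidx c < _]ltnNge (ltnW (didx_lt_lidx nn pS cS dp)) andbF.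
      apply: covW; rewrite tuE has_map; apply/hasPn => p pU /=.
      apply/negP => /andP[/= h1 h2].
      by have := U2 c cS isT cN p pU h2; rewrite ltnNge h1.
exists T, (tl ++ W); split=> //.
have szT := size_f_spec spec.
have szD : size D = count dbl S by rewrite size_filter.
pose e := count (fun b => ~~ dbl b && (fidx b == 1)) S.
(* First indices increase strictly along [G], so only its head can start at r_1: the test deciding
   pi_0 is the parity of the size of T. *)
have eE : e = (if G is b :: _ then (fidx b == 1) : nat else 0).
  rewrite /e -size_filter.
  have -> : [seq b <- S | ~~ dbl b && (fidx b == 1)] = [seq b <- G | fidx b == 1].
    by rewrite -filter_predI; apply: eq_filter => x /=; rewrite andbC.
  rewrite size_filter; have := nonnesting_fidx nn; have : {in G, forall b, 0 < fidx b}.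
    by move=> b /GS[/wfS/and4P[]].
  rewrite -/G; case: (G) => //= b G' pos /andP[/allP hb _].
  rewrite (_ : count _ G' = 0) ?addn0 //; apply/eqP; rewrite -leqn0 leqNgt -has_count.
  apply/hasPn => x xG; have := hb x xG; have := pos b (mem_head _ _); clear; lia.
have e1 : e <= 1 by rewrite eE; case: (G) => // b _; case: (fidx b == 1).
rewrite -/e -szD in szT.
have half : (size T)./2 = size D by rewrite szT; clear -e1; lia.
have odde : odd (size T) = (e == 1) by rewrite szT; clear -e1; lia.
rewrite /tword half odde eE -catA /f_double -/D -/G -/L -/adm -/U -/T1 -/T2 -/T -/tl -/tu -/W.
congr (_ ++ (_ ++ _)).
by case: (G) => // b _; case: (fidx b == 1).
Qed.

(** Two double roots share the term 2r_1; otherwise both roots contain the term r_k with k the last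
    index of a. Used contrapositively: after the first component only roots without double roots
    remain, all starting further right. *)
Lemma meets_antichain_lt a b : wf_root a -> wf_root b -> antichain_lt a b ->
  dbl b || (fidx b <= lidx a) -> meets a b.
Proof.
move=> /and4P[a0 a1 a2 /implyP a3] /and4P[b0 b1 b2 /implyP b3] /andP[ab abd] h.
apply/(meets_coefP _ a0).
move: abd h; case db: (dbl b) => /= abd h.
  have [da _] := andP abd.
  have fa := eqP (a3 da); have fb := eqP (b3 db).
  have c2 x : 0 < didx x -> fidx x = 1 -> fidx x <= lidx x -> coef x 1 = 2.
    by rewrite /coef => d0 -> ->; rewrite d0.
  by exists 1; rewrite !c2.
exists (lidx a); first by rewrite coef_gt0 a1 leqnn.
rewrite /coef a1 leqnn h (ltnW ab) /= leqNgt a2 /=.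
by move: db; rewrite /dbl => /negbT; rewrite -eqn0Ngt => /eqP ->;
  rewrite leqNgt (leq_trans a0 a1).
Qed.

(** Here the rule for singletons and rule (b) agree, so a component consisting of one double root
    needs no separate treatment. *)
Lemma f_double_single a : wf_root a -> dbl a -> f_double f_word [:: a] = [:: a].
Proof.
move=> wa da; case: (a) wa da => f d l /and4P[_ _ /= dl /implyP h] da.
have /eqP /= f1 := h da; rewrite {}f1 {h} in da *.
rewrite /f_double /= da /= inE (ltn_eqF dl) /=.
have -> : sort leq [:: d; l] = [:: d; l] by apply: sorted_sort;
  [apply: leq_trans | rewrite /= (ltnW dl)].
by [].
Qed.

(** Such an antichain has at most one arc starting at 0, which is not a point in type B. Its right
    end is moved to T, and the absence of crossings with this arc becomes the statement that no arc
    covers that point. *)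
Lemma f_spec_nodouble s : nonnesting s -> ~~ has dbl s ->
  exists T w, perm_eq (f_word s) (tword T ++ w) /\ f_spec s T w.
Proof.
move=> nn nd; have wfs := nonnesting_wf_root nn.
have ndb x : x \in s -> dbl x = false by move=> xs; apply/negbTE/(hasPn nd).
have filtN : [seq a <- s | ~~ dbl a] = s by apply/all_filterP/allP => x /ndb ->.
have simple_s : all simple s by apply/allP => x xs; rewrite wf_root_simple ?ndb ?wfs.
have pw := nonnesting_arc_lt nn; rewrite filtN in pw.
have [sW fW lW ncW _] := f_word_simple simple_s (pairwise_sorted pw).
set W := f_word s in sW fW lW ncW *.
pose W1 := [seq x <- W | fidx x == 1]; pose w := [seq x <- W | fidx x != 1].
have permW : perm_eq W (W1 ++ w) by rewrite perm_sym; apply/permPl/perm_filterC.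
have szW1 : size W1 <= 1.
  have u : uniq (map fidx W).
    rewrite (perm_uniq fW); apply: (@pairwise_uniq _ ltn) ltnn _.
    by rewrite pairwise_map; apply: sub_pairwise pw => x y /andP[].
  rewrite size_filter -(count_map fidx (pred1 1)) count_uniq_mem //.
  by case: (_ \in _).
have tW1 : tword (map lidx W1) = W1.
  have : all (fun x => simple x && (fidx x == 1)) W1.
    by apply/allP => x; rewrite mem_filter => /andP[-> /(allP sW) ->].
  case: (W1) szW1 => [|[f d l] [|]] //= _.
  by rewrite andbT /simple /dbl /= => /andP[/andP[+ _] /eqP ->]; rewrite -eqn0Ngt => /eqP ->.
exists (map lidx W1), w; split; first by rewrite tW1.
split.
- by apply/allP => x; rewrite mem_filter => /andP[_ /(allP sW)].
- have -> : map fidx w = filter (predC1 1) (map fidx W) by rewrite filter_map.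
  have -> : [seq b <- s | ~~ dbl b & fidx b != 1] = [seq b <- s | predC1 1 (fidx b)].
    by apply: eq_in_filter => x xs; rewrite ndb.
  rewrite -[X in perm_eq _ (map _ X)]/(filter (preim fidx (predC1 1)) s) -filter_map.
  exact: perm_filter.
- rewrite (_ : [seq b <- s | dbl b] = [::]) ?cats0; last first.
    by apply/eqP; rewrite -[_ == _]negbK -has_filter.
  by rewrite -(permPr lW) -map_cat perm_map // perm_catC perm_sym.
- have : size (map lidx W1) <= 1 by rewrite size_map.
  by case: (map lidx W1) => [|t [|t2 l]] /=.
- split=> [x y|t].
    by rewrite !mem_filter => /andP[_ xW] /andP[_ yW]; apply: ncW.
  case/mapP=> x; rewrite mem_filter => /andP[/eqP x1 xW] ->.
  apply/hasPn => y; rewrite mem_filter => /andP[y1 yW].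
  apply: contra (ncW x y xW yW) => /andP[h1 h2].
  have y2 : 1 < fidx y by rewrite ltn_neqAle eq_sym y1; case/and3P: (allP sW y yW).
  by rewrite /crosses x1 y2 h1 h2.
Qed.

(** Only the first component can contain double roots. The arcs of the other components start no
    earlier than its last right end, so they cross nothing of it and cover no point of T. A
    permutation is allowed because without double roots the arc from 0 need not come first. *)
Lemma f_word_spec s : nonnesting s ->
  exists T w, perm_eq (f_word s) (tword T ++ w) /\ f_spec s T w.
Proof.
move=> nn; case hd: (has dbl s); last by apply: f_spec_nodouble; rewrite ?hd.
case: s nn hd => // a s nn hd; have wfs := nonnesting_wf_root nn.
have da : dbl a.
  case/orP: hd => // /hasP[b bs db]; case/andP: nn => _ /= /andP[/allP/(_ b bs) + _].
  by rewrite /antichain_lt db => /and3P[].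
have [c [s' [sE -> pc sep]]] := f_word_cons a s.
have nnc : nonnesting (a :: c).
  case/andP: nn; rewrite sE -cat_cons all_cat pairwise_cat => /andP[h1 _] /and3P[_ h2 _].
  exact/andP.
have nns' : nonnesting s'.
  case/andP: nn; rewrite sE -cat_cons all_cat pairwise_cat => /andP[_ h1] /and3P[_ _ h2].
  exact/andP.
have acs x y : x \in a :: c -> y \in s' -> antichain_lt x y.
  case/andP: nn; rewrite sE -cat_cons pairwise_cat => _ /and3P[/allrelP h _ _]; exact: h.
have wfc := nonnesting_wf_root nnc; have wfs' := nonnesting_wf_root nns'.
have sep' x y : x \in a :: c -> y \in s' -> ~~ dbl y && (lidx x < fidx y).
  move=> xc; have lc := mem_last a c.
  have xl : lidx x <= lidx (last a c).
    by have [->|/ltnW] := pairwise_last a (nonnesting_lidx nnc) xc.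
  case: s' sep nns' acs wfs' {sE} => // b s' sep nns' acs wfs' ys'.
  have bs' := mem_head b s'.
  have : ~~ (dbl b || (fidx b <= lidx (last a c))).
    by apply: contra sep; apply: meets_antichain_lt; [exact: wfc|exact: wfs'|exact: acs].
  rewrite negb_or -ltnNge => /andP[nb lb].
  have [-> /=|] := pairwise_head b (proj2 (andP nns')) ys';
    first by rewrite nb (leq_ltn_trans xl).
  case/andP=> _; rewrite /= (negbTE nb) /=; case: (dbl y) => //= h.
  exact: leq_ltn_trans xl (ltn_trans lb h).
have [T [w1 [fE [s1 f1 l1 sT [nc1 cov1]]]]] := f_double_spec nnc pc da.
have {fE}fE : f_connected f_word (a :: c) = tword T ++ w1.
  rewrite -fE; case: (c) nnc => [nna|b c' _]; last by rewrite /f_connected /= da.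
  by rewrite f_double_single // (nonnesting_wf_root nna) // mem_head.
have nd' : ~~ has dbl s'.
  by apply/hasPn => y ys'; case/andP: (sep' a y (mem_head _ _) ys').
have filtN : [seq a <- s' | ~~ dbl a] = s'.
  by apply/all_filterP; apply/allP => y ys'; case/andP: (sep' a y (mem_head _ _) ys').
have ss' : all simple s'.
  by apply/allP => x xs; rewrite wf_root_simple ?wfs' //; apply: (hasPn nd').
have pw := nonnesting_arc_lt nns'; rewrite filtN in pw.
have [s2 f2 l2 nc2 _] := f_word_simple ss' (pairwise_sorted pw).
set w2 := f_word s' in s2 f2 l2 nc2 *.
have w12 x y : x \in w1 -> y \in w2 -> lidx x < fidx y.
  move=> xw yw; have := map_f fidx yw; rewrite (perm_mem f2) => /mapP[z zs ->].
  have : lidx x \in map lidx w1 ++ T by rewrite mem_cat map_f.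
  rewrite (perm_mem l1) mem_cat => /orP[] /mapP[z' + ->].
    by move=> zc; case/andP: (sep' _ _ zc zs).
  rewrite mem_filter => /andP[_ zc]; have [_ _ h _] := and4P (wfc _ zc).
  by apply: ltn_trans h _; case/andP: (sep' _ _ zc zs).
have Tw2 t y : t \in T -> y \in w2 -> t < fidx y.
  move=> tT yw; have := map_f fidx yw; rewrite (perm_mem f2) => /mapP[z zs ->].
  have : t \in map lidx w1 ++ T by rewrite mem_cat tT orbT.
  rewrite (perm_mem l1) mem_cat => /orP[] /mapP[z' + ->].
    by move=> zc; case/andP: (sep' _ _ zc zs).
  rewrite mem_filter => /andP[_ zc]; have [_ _ h _] := and4P (wfc _ zc).
  by apply: ltn_trans h _; case/andP: (sep' _ _ zc zs).
have splitS p : [seq b <- a :: s | p b] = [seq b <- a :: c | p b] ++ [seq b <- s' | p b].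
  by rewrite sE -cat_cons filter_cat.
exists T, (w1 ++ w2); split; first by rewrite fE catA.
split=> //.
- by rewrite all_cat s1.
- rewrite splitS !map_cat; apply: perm_cat => //.
  rewrite (_ : [seq b <- s' | _] = s') //; apply/all_filterP/allP => y ys'.
  have /andP[-> h] := sep' a y (mem_head _ _) ys'; rewrite gtn_eqF //.
  by apply: leq_ltn_trans h; case/and4P: (wfc a (mem_head _ _)) => h1 h2 _ _;
    apply: leq_trans h2.
- rewrite splitS (_ : [seq b <- s' | dbl b] = [::]) ?cats0; last first.
    by apply/eqP; rewrite -[_ == _]negbK -has_filter.
  rewrite map_cat -catA (perm_catCA (map lidx w1)) sE -cat_cons map_cat.
  by rewrite perm_catC perm_sym perm_catAC perm_sym; apply: perm_cat.
- split=> [x y|t tT].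
    rewrite !mem_cat => /orP[xw|xw] /orP[yw|yw].
    + exact: nc1.
    + by rewrite /crosses [fidx y <= _]leqNgt w12 ?andbF.
    + have h : lidx y < lidx x.
        by apply: leq_trans (w12 _ _ yw xw) _; case/and3P: (allP s2 x xw).
      by rewrite /crosses [lidx x < _]ltnNge (ltnW h) andbF.
    + exact: nc2.
  rewrite has_cat negb_or cov1 //; apply/hasPn => y yw.
  by rewrite /covers leqNgt Tw2.
Qed.

(** * Openers and closers of the partition of a word *)

Definition pos_point (Psi : cartan) (n : nat) : 'I_n -> pt Psi n :=
  match Psi return 'I_n -> pt Psi n with
  | TypeA => fun i => i
  | TypeB => fun i => (i, false)
  end.

Section Partition.
Variables (T : finType) (P : {set {set T}}).
Hypothesis pP : partition P [set: T].

Lemma in_pblock x : x \in pblock P x.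
Proof. by rewrite mem_pblock (cover_partition pP) inE. Qed.

Lemma pblock_in x : pblock P x \in P.
Proof. by apply: pblock_mem; rewrite (cover_partition pP) inE. Qed.

Lemma pblockE B x : B \in P -> x \in B -> pblock P x = B.
Proof. by apply: def_pblock; apply: partition_trivIset pP. Qed.

End Partition.

Section Blocks.
Variables (Psi : cartan) (n : nat).
Implicit Types (P : {set {set pt Psi n}}) (x y : pt Psi n) (i : 'I_n).
Local Open Scope ring_scope.

Lemma label_pos_point i : label (pos_point Psi i) = (i.+1)%:Z.
Proof. by case: Psi => //=; rewrite expr0 mul1r. Qed.

Lemma absval_pos_point i : absval (pos_point Psi i) = i.
Proof. by case: Psi. Qed.

Lemma pos_point_absval x : 0 < label x -> x = pos_point Psi (absval x).
Proof. by case: Psi x => //= -[i []] //=; rewrite expr1 mulN1r; lia. Qed.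

Lemma label_neq0 x : label x != 0.
Proof. by case: Psi x => //= -[i s]; rewrite mulf_neq0 // signr_eq0. Qed.

Lemma label_pos_point_gt0 i : 0 < label (pos_point Psi i).
Proof. by rewrite label_pos_point. Qed.

Lemma mem_op P i : partition P [set: pt Psi n] ->
  reflect {in pblock P (pos_point Psi i), forall y, label (pos_point Psi i) <= label y} (i
    \in op P).
Proof.
move=> pP; apply: (iffP imsetP) => [[x]|h].
  rewrite inE => /existsP[B /and3P[BP /forall_inP pos /andP[xB /forall_inP least]]] iE.
  have xE : x = pos_point Psi i by rewrite iE; apply: pos_point_absval; apply: pos.
  by rewrite -xE (pblockE pP BP xB).
exists (pos_point Psi i); last by rewrite absval_pos_point.
rewrite inE; apply/existsP; exists (pblock P (pos_point Psi i)); rewrite pblock_in //=.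
apply/andP; split; last by rewrite /least_in in_pblock //; apply/forall_inP.
by apply/forall_inP => y /h; apply: lt_le_trans; apply: label_pos_point_gt0.
Qed.

(** If -i is the least element of a block with both signs, then i is the greatest element of the
    opposite block; so invariance reduces the two ways of being a closer in type B to one. *)
Lemma mem_cl P i : partition P [set: pt Psi n] -> invariant_under_opp P ->
  reflect {in pblock P (pos_point Psi i), forall y, label y <= label (pos_point Psi i)} (i
    \in cl P).
Proof.
move=> pP inv; apply: (iffP imsetP) => [[x]|h].
  rewrite inE => /existsP[B /andP[BP h]] iE.
  suff [] : (0 < label x /\ greatest_in B x) \/ (label x < 0 /\ least_in B x).
  - case=> pos /andP[xB /forall_inP great]; have xE : x = pos_point Psi i by rewrite iE;
    apply: pos_point_absval.
    by rewrite -xE (pblockE pP BP xB).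
  - case: Psi P i pP inv B x BP h iE => /=; first by move=> P i pP inv B x BP h iE [].
    move=> P i pP /forall_inP inv B [j s] /inv oB _ -> [neg].
    have {neg} -> : s = true by case: s neg.
    case/andP=> xB /forall_inP least y; rewrite (pblockE pP oB); last first.
      by apply/imsetP; exists (j, true).
    case/imsetP => z zB ->; have := least z zB; case: (z) => k [] /=; clear;
    by rewrite ?expr1 ?expr0 ?mul1r ?mulN1r; lia.
  case/orP: h => [/andP[/forall_inP pos great]|/andP[/andP[/exists_inP[u uB u0]
    /exists_inP[v vB v0]]]].
    by left; split=> //; apply: pos; case/andP: great.
  case/orP=> /andP[xB /forall_inP ext]; [right|left]; split.
  - exact: le_lt_trans (ext v vB) v0.
  - by rewrite /least_in xB; apply/forall_inP.
  - exact: lt_le_trans u0 (ext u uB).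
  - by rewrite /greatest_in xB; apply/forall_inP.
exists (pos_point Psi i); last by rewrite absval_pos_point.
rewrite inE; apply/existsP; exists (pblock P (pos_point Psi i)); rewrite pblock_in //=.
have great : greatest_in (pblock P (pos_point Psi i)) (pos_point Psi i).
  by rewrite /greatest_in in_pblock //; apply/forall_inP.
rewrite great orbT !andbT; case: (boolP (positive_block _)) => //=.
rewrite negb_forall_in => /exists_inP[y yB]; rewrite -leNgt => y0.
apply/andP; split; apply/exists_inP.
  by exists (pos_point Psi i); rewrite ?in_pblock // label_pos_point_gt0.
by exists y => //; rewrite lt_neqAle label_neq0.
Qed.

End Blocks.

(** * Words in the roots as graphs on the points *)

Lemma mem_pos_roots Psi n b : (b \in pos_roots Psi n) =
  [&& wf_root b, lidx b <= rank Psi n & if Psi is TypeA then ~~ dbl b else true].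
Proof.
apply/idP/idP; rewrite mem_cat.
  case/orP=> [/allpairsPdep[j [i [+ + ->]]]|].
    by rewrite !mem_iota /wf_root /dbl /=; case: Psi => /=; lia.
  case: Psi => // /allpairsPdep[i [j [+ + ->]]].
  by rewrite !mem_iota /wf_root /dbl /=; lia.
case: b => f d l /and3P[/and4P[/= f0 fl dl /implyP h] ln ndb].
case: d dl h ndb => [|d] dl h ndb.
  apply/orP; left; apply/allpairsPdep; exists l, f; rewrite !mem_iota; split=> //; lia.
have /eqP /= f1 := h isT; rewrite {}f1 in f0 fl *.
apply/orP; right; case: Psi ln ndb => //= ln _.
apply/allpairsPdep; exists l, d.+1; rewrite !mem_iota; split=> //; lia.
Qed.

(** In type B first index 1 would give the left end 0, which is no point: e_j joins j to -j, and has
    a right end only. *)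
Definition lends (Psi : cartan) b : seq nat :=
  if dbl b then [::]
  else match Psi with
       | TypeA => [:: (fidx b).-1]
       | TypeB => if fidx b == 1 then [::] else [:: (fidx b).-1]
       end.

Definition is_typeB Psi := if Psi is TypeB then true else false.

Definition rends b : seq nat := if dbl b then [:: didx b; lidx b] else [:: lidx b].

Definition lefts Psi (w : seq proot) := flatten [seq lends Psi b | b <- w].
Definition rights (w : seq proot) := flatten [seq rends b | b <- w].

(* The points are numbered 0, ..., n - 1 in type A and 1, ..., n in type B. *)
Definition idx (Psi : cartan) n (i : 'I_n) : nat :=
  if Psi is TypeA then nat_of_ord i else i.+1.

Definition in_range Psi n k := if Psi is TypeA then k < n else 0 < k <= n.

Lemma in_range_idx Psi n (i : 'I_n) : in_range Psi n (idx Psi i).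
Proof. by case: Psi => /=. Qed.

Section Edges.
Variables (Psi : cartan) (m : nat).
Local Notation n := m.+1.
Implicit Types (b : proot) (w : seq proot).

Definition point (s : bool) (k : nat) : pt Psi n :=
  match Psi return pt Psi n with
  | TypeA => inord k : 'I_n
  | TypeB => (inord k.-1 : 'I_n, s)
  end.

Lemma pos_point_point (i : 'I_n) : pos_point Psi i = point false (idx Psi i).
Proof. by rewrite /point; case: Psi => /=; rewrite inord_val. Qed.

Lemma point_inj s : {in in_range Psi n &, injective (point s)}.
Proof.
rewrite /point => j k; rewrite !unfold_in; case: Psi => /= jn kn.
  by move/(congr1 val); rewrite /= !inordK.
case=> /(congr1 val); rewrite /= !inordK; lia.
Qed.

(** Each edge ascends for the usual order of integers. In the negative half an arc is therefore
    reversed: it runs from its negated right end to its negated left end, so right ends appear there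
    as first components. *)
Definition edges b : seq (pt Psi n * pt Psi n) :=
  match Psi with
  | TypeA => [:: (point false (fidx b).-1, point false (lidx b))]
  | TypeB =>
    if dbl b then [:: (point true (lidx b), point false (didx b));
                      (point true (didx b), point false (lidx b))]
    else if fidx b == 1 then [:: (point true (lidx b), point false (lidx b))]
    else [:: (point true (lidx b), point true (fidx b).-1);
             (point false (fidx b).-1, point false (lidx b))]
  end.

Definition wedges w := flatten [seq edges b | b <- w].

Lemma ends_in_range b : b \in pos_roots Psi n ->
  [/\ all (in_range Psi n) (lends Psi b), all (in_range Psi n) (rends b) &
      {in lends Psi b & rends b, forall j k, j < k}].
Proof.
rewrite mem_pos_roots /lends /rends => /and3P[/and4P[h1 h2 h3 h4] h5 h6].
split.
- case: (dbl b) => //; case: Psi h5 => /= h; first by lia.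
  by case: eqP => //= f1; lia.
- case: ifP h6 => db; rewrite /dbl in db; case: Psi h5 => //= h; rewrite /dbl; lia.
- move=> j k; case: (dbl b) => //; case: Psi => /=;
  first by rewrite !inE => /eqP -> /eqP ->; lia.
  by case: eqP => // _; rewrite !inE => /eqP -> /eqP ->; lia.
Qed.

Lemma word_ends_in_range w : {subset w <= pos_roots Psi n} ->
  all (in_range Psi n) (lefts Psi w) /\ all (in_range Psi n) (rights w).
Proof.
move=> sub; split; apply/allP => k /flattenP[_ /mapP[b /sub bw ->]];
  have [/allP h1 /allP h2 _] := ends_in_range bw; [exact: h1 | exact: h2].
Qed.

Lemma perm_ends w : {subset w <= pos_roots Psi n} ->
  perm_eq (map fst (wedges w)) (map (point false) (lefts Psi w) ++
      if is_typeB Psi then map (point true) (rights w) else [::]) /\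
  perm_eq (map snd (wedges w)) (map (point false) (rights w) ++
      if is_typeB Psi then map (point true) (lefts Psi w) else [::]).
Proof.
elim: w => [|b w IH] sub; first by rewrite /wedges /lefts /rights /=; case: is_typeB.
have [|IH1 IH2] := IH; first by move=> x xw; apply: sub; rewrite inE xw orbT.
have splitB (s1 s2 : seq nat) :
    (if is_typeB Psi then map (point true) s1 ++ map (point true) s2 else [::]) =
    (if is_typeB Psi then map (point true) s1 else [::]) ++
    (if is_typeB Psi then map (point true) s2 else [::]) by case: is_typeB.
rewrite /wedges /lefts /rights /= !map_cat -/(wedges w) -/(lefts Psi w) -/(rights w) !splitB.
have ndb : is_true (if Psi is TypeA then ~~ dbl b else true).
  by have := sub b (mem_head _ _); rewrite mem_pos_roots => /and3P[].
have swap (T : eqType) (x y : T) : perm_eq [:: x; y] [:: y; x].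
  exact/permPl/(perm_catC [:: x] [:: y]).
split; rewrite perm_sym perm_catACA perm_sym; apply: perm_cat => //;
  move: ndb; clear -swap; rewrite /edges /lends /rends /point; case: Psi => /= ndb.
- by rewrite (negbTE ndb).
- case: (dbl b); [apply: swap | case: (fidx b == 1) => //=; apply: swap].
- by rewrite (negbTE ndb).
- by case: (dbl b) => //; case: (fidx b == 1) => //=; apply: swap.
Qed.

Lemma insub_inord k : k < n -> insub k = Some (inord k : 'I_n).
Proof. by move=> kn; rewrite insubT; congr Some; apply: val_inj; rewrite /= inordK. Qed.

Lemma reflectionE b : b \in pos_roots Psi n -> reflection Psi n b = eperm (edges b).
Proof.
rewrite mem_pos_roots => /and3P[/and4P[h1 h2 h3 h4]]; rewrite /reflection /edges /point.
case: Psi => /= h5 h6.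
  by rewrite /swapA /= !insub_inord; [rewrite mul1g|lia..].
rewrite /swapB /spoint; case: ifP h3 h4; rewrite /dbl => h6' h3 h4.
  rewrite !insub_inord; [rewrite /= mul1g|lia..].
  by congr (_ * _)%g; apply: tpermC.
case: (fidx b == 1) => /=; rewrite !insub_inord; try lia.
  by rewrite /= mul1g tpermC.
by rewrite /= mul1g; congr (_ * _)%g; apply: tpermC.
Qed.

Lemma word_permE w : {subset w <= pos_roots Psi n} -> word_perm Psi n w = eperm (wedges w).
Proof.
elim: w => //= b w IH sub; rewrite IH; last by move=> x xw; apply: sub; rewrite inE xw orbT.
by rewrite /wedges /= eperm_cat reflectionE // sub ?mem_head.
Qed.

Lemma ascending_edges w : {subset w <= pos_roots Psi n} -> ascending (@label Psi n) (wedges w).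
Proof.
move=> sub e /flattenP[_ /mapP[b /sub + ->]] {sub w};
  rewrite mem_pos_roots => /and3P[/and4P[h1 h2 h3 h4]].
rewrite /edges /point; case: Psi e => /= e h5 h6.
  by rewrite inE => /eqP -> /=; rewrite !inordK; clear -h1 h2 h5; lia.
have lB (k : nat) : 0 < k <= n -> (((inord k.-1 : 'I_n) : nat).+1)%:Z%R = k%:Z%R.
  by move=> /andP[k0 kn]; rewrite inordK prednK.
case: ifP h4; rewrite /dbl => db h4.
  by rewrite !inE => /orP[] /eqP -> /=; rewrite expr0 mul1r expr1 mulN1r !lB;
    clear -db h3 h5; lia.
case: eqP => f1; rewrite !inE.
  by move/eqP=> -> /=; rewrite expr0 mul1r expr1 mulN1r !lB; clear -h1 h2 h5; lia.
by case/orP => /eqP -> /=; rewrite ?expr0 ?mul1r ?expr1 ?mulN1r !lB; clear -h1 h2 h5 f1; lia.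
Qed.

Lemma uniq_point (s : bool) (sq : seq nat) : all (in_range Psi n) sq ->
  uniq (map (point s) sq) = uniq sq.
Proof.
move=> /allP r; apply: map_inj_in_uniq => j k /r hj /r hk; exact: point_inj.
Qed.

Lemma point_sign j k : is_typeB Psi -> point true j != point false k.
Proof. by rewrite /point; case: Psi => //= _; rewrite xpair_eqE andbF. Qed.

Definition good_word w := [/\ {subset w <= pos_roots Psi n}, uniq (lefts Psi w) & uniq
  (rights w)].

Lemma uniq_ends w : good_word w -> uniq (map fst (wedges w)) /\ uniq (map snd (wedges w)).
Proof.
case=> sub ul ur; have [p1 p2] := perm_ends sub; have [rl rr] := word_ends_in_range sub.
rewrite (perm_uniq p1) (perm_uniq p2) !cat_uniq !uniq_point // ul ur.
case tB: is_typeB => //=.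
rewrite !uniq_point // ul ur !andbT.
by split; apply/hasPn => _ /mapP[k _ ->]; apply/mapP => -[j _ /eqP]; apply/negP;
  apply: point_sign.
Qed.

Lemma pos_point_fst w (i : 'I_n) : {subset w <= pos_roots Psi n} ->
  (pos_point Psi i \in map fst (wedges w)) = (idx Psi i \in lefts Psi w).
Proof.
move=> sub; have [p1 _] := perm_ends sub; have [/allP rl _] := word_ends_in_range sub.
rewrite (perm_mem p1) mem_cat pos_point_point; apply/orP/idP => [[/mapP[k kl]|]|il].
- by move/(point_inj (in_range_idx _ _) (rl _ kl)) => ->.
- by case tB: is_typeB => // /mapP[k _ /esym /eqP]; rewrite (negbTE (point_sign _ _ tB)).
by left; apply: map_f.
Qed.

Lemma pos_point_snd w (i : 'I_n) : {subset w <= pos_roots Psi n} ->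
  (pos_point Psi i \in map snd (wedges w)) = (idx Psi i \in rights w).
Proof.
move=> sub; have [_ p1] := perm_ends sub; have [_ /allP rl] := word_ends_in_range sub.
rewrite (perm_mem p1) mem_cat pos_point_point; apply/orP/idP => [[/mapP[k kl]|]|il].
- by move/(point_inj (in_range_idx _ _) (rl _ kl)) => ->.
- by case tB: is_typeB => // /mapP[k _ /esym /eqP]; rewrite (negbTE (point_sign _ _ tB)).
by left; apply: map_f.
Qed.

Definition word_blocks w := equivalence_partition (connect (adj (wedges w))) [set: pt Psi n].

Lemma connect_equiv w : {in [set: pt Psi n] & &, equivalence_rel (connect (adj (wedges w)))}.
Proof.
move=> x y z _ _ _; split; first exact: connect0.
by move=> xy; apply: same_connect; first exact: connect_adjC.
Qed.

Lemma word_blocks_partition w : partition (word_blocks w) [set: pt Psi n].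
Proof. exact/equivalence_partitionP/connect_equiv. Qed.

Lemma pblock_word_blocks w x y : (y \in pblock (word_blocks w) x) = connect (adj (wedges
  w)) x y.
Proof. by apply: pblock_equivalence_partition; rewrite ?inE //; apply: connect_equiv. Qed.

Lemma porbits_word w : good_word w -> porbits (word_perm Psi n w) = word_blocks w.
Proof.
move=> gw; have [sub _ _] := gw; have [u _] := uniq_ends gw.
have E x : porbit (eperm (wedges w)) x = [set y in [set: pt Psi n] | connect (adj (wedges
  w)) x y].
  by apply/setP => y; rewrite (porbit_eperm _ _ (ascending_edges sub) u) !inE.
rewrite word_permE //; apply/setP => B.
by apply/imsetP/imsetP => -[x _ ->]; exists x; rewrite ?E.
Qed.

Lemma connect_reflections w : {subset w <= pos_roots Psi n} ->
  connect [rel x y | has (fun b => reflection Psi n b x == y) w] =2 connect (adj (wedges w)).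
Proof.
move=> sub; set e := [rel x y | _].
have good1 b : b \in w -> good_word [:: b].
  move=> bw; split; first by move=> x; rewrite inE => /eqP ->; apply: sub.
    rewrite /lefts /= cats0 /lends; case: (dbl b) => //; case: Psi => //.
    by case: (fidx b == 1).
  have := sub b bw; rewrite mem_pos_roots => /and3P[/and4P[_ _ h _] _ _].
  by rewrite /rights /= cats0 /rends; case: (dbl b); rewrite //= inE andbT ltn_eqF.
have orb b x y : b \in w -> (y \in porbit (reflection Psi n b) x) = connect (adj (edges b)) x y.
  move=> bw; have gb := good1 b bw; have [sb _ _] := gb; have [u _] := uniq_ends gb.
  have := porbit_eperm x y (ascending_edges sb) u.
  by rewrite /wedges /= cats0 reflectionE // sub.
move=> x y; apply/idP/idP; apply: connect_sub => {x y} x y.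
  case/hasP=> b bw /eqP <-; apply: (@connect_adj_sub _ (edges b)).
    by move=> u ub; apply/flattenP; exists (edges b) => //; apply: map_f.
  by rewrite -orb // -[reflection _ _ b in X in X \in _]expg1 mem_porbit.
move=> xy; have [b bw] : exists2 b, b \in w & adj (edges b) x y.
  by case/orP: xy => /flattenP[_ /mapP[b bw ->] h]; exists b; rewrite // /adj h ?orbT.
move/connect1; rewrite -orb // => /porbitP[i ->].
elim: i => [|i IH]; first by rewrite perm1.
by rewrite expgSr permM; apply: connect_trans IH (connect1 _); apply/hasP; exists b.
Qed.

(** A right end has a neighbour with a smaller label; any other point is least in its component by
    [component_min]. *)
Lemma mem_op_word_blocks w (i : 'I_n) : good_word w ->
  (i \in op (word_blocks w)) = (idx Psi i \notin rights w).
Proof.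
move=> gw; have [sub _ _] := gw; have [u1 u2] := uniq_ends gw.
rewrite -pos_point_snd //; apply/mem_op/idP; first exact: word_blocks_partition.
  move=> h; apply/mapP => -[[x y] xy /= E]; rewrite -{y}E in xy.
  have := ascending_edges sub xy; rewrite ltNge h // pblock_word_blocks connect_adjC.
  by apply: connect1; rewrite /adj xy.
by move=> iN y; rewrite pblock_word_blocks; apply: component_min => //; apply: ascending_edges.
Qed.

Lemma mem_cl_word_blocks w (i : 'I_n) : good_word w -> invariant_under_opp (word_blocks w) ->
  (i \in cl (word_blocks w)) = (idx Psi i \notin lefts Psi w).
Proof.
move=> gw inv; have [sub _ _] := gw; have [u1 u2] := uniq_ends gw.
rewrite -pos_point_fst //; apply/mem_cl/idP => //; first exact: word_blocks_partition.
  move=> h; apply/mapP => -[[x y] xy /= E]; rewrite -{x}E in xy.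
  have := ascending_edges sub xy; rewrite ltNge h // pblock_word_blocks.
  by apply: connect1; rewrite /adj xy.
by move=> iN y; rewrite pblock_word_blocks; apply: component_max => //; apply: ascending_edges.
Qed.

End Edges.

Lemma word_blocks_invariant Psi m w : {subset w <= pos_roots Psi m.+1} ->
  invariant_under_opp (word_blocks Psi m w).
Proof.
case: Psi => //= sub; pose opp (x : 'I_m.+1 * bool) := (x.1, ~~ x.2).
have oppK : involutive opp by case=> i s; rewrite /opp negbK.
have edges_opp b x y : (x, y) \in edges TypeB m b -> (opp y, opp x) \in edges TypeB m b.
  rewrite /edges /opp; case: (dbl b); last case: (fidx b == 1).
  - by rewrite !inE => /orP[] /eqP [-> ->] /=; rewrite eqxx ?orbT.
  - by rewrite !inE => /eqP [-> ->].
  - by rewrite !inE => /orP[] /eqP [-> ->] /=; rewrite eqxx ?orbT.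
have adj_opp x y : adj (wedges TypeB m w) x y -> adj (wedges TypeB m w) (opp x) (opp y).
  by case/orP => /flattenP[_ /mapP[b bw ->] /edges_opp h]; apply/orP; [right|left];
    apply/flattenP; exists (edges TypeB m b) => //; apply: map_f.
have connect_opp x y : connect (adj (wedges TypeB m w)) x y ->
    connect (adj (wedges TypeB m w)) (opp x) (opp y).
  case/connectP => p + ->; elim: p x => [|z p IH] x /=; first by rewrite connect0.
  by case/andP => /adj_opp/connect1 xz /IH; apply: connect_trans.
apply/forall_inP => _ /imsetP[x _ ->]; apply/imsetP; exists (opp x); rewrite ?inE //.
apply/setP => y; rewrite inE in_setT /=; apply/imsetP/idP => [[z + ->]|xy].
  by rewrite inE => /andP[_]; apply: connect_opp.
by exists (opp y); rewrite -?[(_, _)]/(opp _) ?oppK // !inE -[x]oppK connect_opp.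
Qed.

Section Words.
Variables (Psi : cartan) (m : nat).
Local Notation n := m.+1.

Lemma perm_lefts w w' : perm_eq w w' -> perm_eq (lefts Psi w) (lefts Psi w').
Proof. by move=> h; apply: perm_flatten; apply: perm_map. Qed.

Lemma perm_rights w w' : perm_eq w w' -> perm_eq (rights w) (rights w').
Proof. by move=> h; apply: perm_flatten; apply: perm_map. Qed.

Lemma wedges_mem w w' : w =i w' -> wedges Psi m w =i wedges Psi m w'.
Proof.
move=> ww' e; apply/flattenP/flattenP => -[_ /mapP[b bw ->] h]; exists (edges Psi m b) => //;
  by apply: map_f; rewrite ?ww' // -ww'.
Qed.

End Words.

Lemma lefts_typeA w : lefts TypeA w = [seq (fidx b).-1 | b <- w & ~~ dbl b].
Proof.
by elim: w => //= b w IH; rewrite -[LHS]/(lends TypeA b ++ lefts TypeA w) IH /lends;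
  case: (dbl b).
Qed.

Lemma lefts_typeB w : lefts TypeB w = [seq (fidx b).-1 | b <- w & ~~ dbl b && (fidx b != 1)].
Proof.
elim: w => //= b w IH; rewrite -[LHS]/(lends TypeB b ++ lefts TypeB w) IH /lends.
by case: (dbl b) => //; case: (fidx b == 1).
Qed.

Lemma rights_perm w : perm_eq (rights w) (map lidx w ++ [seq didx b | b <- w & dbl b]).
Proof.
elim: w => //= b w IH; rewrite -[rights _]/(rends b ++ rights w) /rends; case: ifP => _ /=;
  last by rewrite perm_cons.
by apply/seq.permP => p; have /seq.permP/(_ p) := IH; rewrite /= !count_cat /= => ->;
  rewrite !addnA; congr addn; lia.
Qed.

Lemma uniq_lefts Psi s : nonnesting s -> uniq (lefts Psi s).
Proof.
move=> nn; have : uniq [seq (fidx b).-1 | b <- s & ~~ dbl b].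
  apply: (@pairwise_uniq _ ltn) ltnn _; rewrite pairwise_map.
  apply: (sub_in_pairwise (P := fun b => 0 < fidx b)) (nonnesting_fidx nn).
    by move=> a b; rewrite !unfold_in /=; lia.
  by apply/allP => b; rewrite mem_filter => /andP[_ /(nonnesting_wf_root nn)/and4P[]].
case: Psi; first by rewrite lefts_typeA.
rewrite lefts_typeB; apply: subseq_uniq; apply: map_subseq.
rewrite (_ : [seq b <- s | _] = [seq b <- [seq b <- s | ~~ dbl b] | fidx b != 1]).
  exact: filter_subseq.
by rewrite -filter_predI; apply: eq_filter => x /=; rewrite andbC.
Qed.

Lemma good_word_nonnesting Psi m s : {subset s <= pos_roots Psi m.+1} -> nonnesting s ->
  good_word Psi m s.
Proof.
move=> sub nn; split=> //; first exact: uniq_lefts.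
by rewrite (perm_uniq (rights_perm s)); apply: uniq_rights.
Qed.

(** * The partition f(A) is noncrossing *)

Section Tword.
Variable T : seq nat.
Hypotheses (sorted_T : sorted ltn T) (T_gt0 : {in T, forall t, 0 < t}).

Local Notation t_ j := (nth 0 T j).

Lemma tword_nth_gt0 j : j < size T -> 0 < t_ j.
Proof. by move=> jT; apply: T_gt0; apply: mem_nth. Qed.

Lemma tword_ltn_nth i j : i < size T -> j < size T -> (t_ i < t_ j) = (i < j).
Proof.
move=> iT jT; apply/idP/idP; last by apply: (sorted_ltn_nth ltn_trans 0 sorted_T).
apply: contraTT; rewrite -!leqNgt leq_eqVlt => /predU1P[->//|ji].
by apply: ltnW; apply: (sorted_ltn_nth ltn_trans 0 sorted_T).
Qed.

Lemma mem_tword b : b \in tword T ->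
  (exists j, j < (size T)./2 /\ b = Root 1 (t_ j) (t_ (size T - j.+1))) \/
  (odd (size T) /\ b = Root 1 0 (t_ (size T)./2)).
Proof.
rewrite mem_cat => /orP[/mapP[j + ->]|].
  by rewrite mem_iota => jT; left; exists j.
by case: ifP => // oT; rewrite inE => /eqP ->; right.
Qed.

Lemma tword_wf b : b \in tword T -> [/\ wf_root b, lidx b \in T & fidx b = 1].
Proof.
case/mem_tword => [[j [jT ->]]|[oT ->]]; split=> //=.
- have h0 : 0 < t_ j by apply: tword_nth_gt0; lia.
  have h1 : t_ j < t_ (size T - j.+1) by rewrite tword_ltn_nth; lia.
  by rewrite /wf_root /= h1 implybT (ltn_trans h0 h1).
- have h : size T - j.+1 < size T by lia.
  exact: mem_nth h.
- have h0 : 0 < t_ (size T)./2 by apply: tword_nth_gt0; case: (size T) oT => //=; lia.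
  by rewrite /wf_root /= h0.
- have h : (size T)./2 < size T by case: (size T) oT => //=; lia.
  exact: mem_nth h.
Qed.

Lemma tword_lefts : lefts TypeB (tword T) = [::].
Proof.
rewrite lefts_typeB (_ : [seq b <- _ | _] = [::]) //.
apply/eqP; rewrite -[_ == _]negbK -has_filter; apply/hasPn => b /tword_wf[_ _ ->].
by rewrite andbF.
Qed.

Lemma tword_dbl j : j < (size T)./2 -> dbl (Root 1 (t_ j) (t_ (size T - j.+1))).
Proof. by move=> jT; rewrite /dbl /= tword_nth_gt0 //; lia. Qed.

Lemma tword_rights : perm_eq (rights (tword T)) T.
Proof.
have uT : uniq T by move: sorted_T; rewrite ltn_sorted_uniq_leq => /andP[].
have sub : {subset T <= rights (tword T)}.
  move=> t /(nthP 0) [i iT0 <-]; have {iT0}iT : i < @size nat T := iT0; apply/flattenP.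
  have memL j : j < (size T)./2 -> Root 1 (t_ j) (t_ (size T - j.+1)) \in tword T.
    by move=> jT; rewrite mem_cat (map_f (fun j => Root 1 (t_ j) (t_ (size T - j.+1)))) //
      mem_iota.
  case: (ltnP i (size T)./2) => h1.
    exists (rends (Root 1 (t_ i) (t_ (size T - i.+1)))); first by apply: map_f; apply: memL.
    by rewrite /rends tword_dbl //= mem_head.
  case: (ltnP (size T - i.+1) (size T)./2) => h2.
    exists (rends (Root 1 (t_ (size T - i.+1)) (t_ (size T - (size T - i.+1).+1)))).
      by apply: map_f; apply: memL.
    have E : size T - (size T - i.+1).+1 = i by lia.
    by rewrite /rends tword_dbl //= !inE E eqxx orbT.
  have oT : odd (size T) by lia.
  have -> : i = (size T)./2 by lia.
  exists (rends (Root 1 0 (t_ (size T)./2))); last by rewrite mem_head.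
  by apply: map_f; rewrite mem_cat oT inE eqxx orbT.
have szR : size (rights (tword T)) <= size T.
  rewrite (perm_size (rights_perm _)) size_cat !size_map size_filter.
  rewrite /tword size_cat count_cat size_map size_iota.
  have := count_size (fun b => dbl b) [seq Root 1 (t_ j) (t_ (size T - j.+1)) | j <- iota 0
    (size T)./2].
  rewrite size_map size_iota; case: ifP => oT /=; lia.
by have [] := uniq_min_size uT sub szR => h1 h2; rewrite perm_sym; apply: uniq_perm => //;
  rewrite -(eq_uniq _ h2) //; lia.
Qed.

(** The two edges of each double root and the single edge of pi_0 obey one formula: the point of
    rank j is joined to the negative of the point of rank j from the end. *)
Lemma tword_edges m e : e \in wedges TypeB m (tword T) ->
  exists2 j, j < size T & e = (point TypeB m true (t_ (size T - j.+1)), point TypeB m false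
    (t_ j)).
Proof.
case/flattenP => _ /mapP[b /mem_tword[[j [jT ->]]|[oT ->]] ->].
  rewrite /edges tword_dbl // !inE => /orP[] /eqP -> /=; first by exists j => //; lia.
  exists (size T - j.+1); first by lia.
  by rewrite (_ : size T - (size T - j.+1).+1 = j) //; lia.
rewrite inE => /eqP -> /=; exists (size T)./2; first by lia.
by rewrite (_ : size T - (size T)./2.+1 = (size T)./2) //; lia.
Qed.

End Tword.

Lemma noncrossing_adj_mem (V : finType) (pos : V -> nat) (ed ed' : seq (V * V)) :
  ed =i ed' -> noncrossing_adj pos ed -> noncrossing_adj pos ed'.
Proof. by move=> h nc x y u v; rewrite /adj -!h => xy uv; apply: nc. Qed.

(** Edges are oriented by labels, whereas crossings are measured by positions; [R] lists the edges
    again as increasing pairs of positions. *)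
Lemma noncrossing_adjW (V : finType) (pos : V -> nat) (ed : seq (V * V)) (R : nat -> nat ->
  Prop) :
  (forall x y, (x, y) \in ed -> R (pos x) (pos y) \/ R (pos y) (pos x)) ->
  (forall i j, R i j -> i < j) ->
  (forall i j k l, R i k -> R j l -> ~ [/\ i < j, j < k & k < l]) ->
  noncrossing_adj pos ed.
Proof.
move=> RE Rlt Rnc x y u v xy uv [h1 h2 h3].
have adjR z t : adj ed z t -> pos z < pos t -> R (pos z) (pos t).
  by case/orP => /RE [] // /[dup] /Rlt; lia.
apply: (Rnc (pos x) (pos u) (pos y) (pos v)) => //; apply: adjR => //; lia.
Qed.

Lemma position_point Psi m s k : in_range Psi m.+1 k ->
  position (point Psi m s k) = if Psi is TypeA then k else s * m.+1 + k.-1.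
Proof. by rewrite /point; case: Psi => /= kn; rewrite inordK //; lia. Qed.

Lemma f_word_typeA m s : nonnesting s -> {subset s <= pos_roots TypeA m.+1} ->
  [/\ good_word TypeA m (f_word s), perm_eq (lefts TypeA (f_word s)) (lefts TypeA s),
      perm_eq (rights (f_word s)) (rights s) &
      noncrossing_adj (@position TypeA m.+1) (wedges TypeA m (f_word s))].
Proof.
move=> nn sub; have ndb x : x \in s -> dbl x = false.
  by move/sub; rewrite mem_pos_roots => /and3P[_ _ /negbTE].
have filtN : [seq a <- s | ~~ dbl a] = s by apply/all_filterP/allP => x /ndb ->.
have simple_s : all simple s.
  by apply/allP => x xs; rewrite wf_root_simple ?ndb // (nonnesting_wf_root nn).
have pw := nonnesting_arc_lt nn; rewrite filtN in pw.
have [sW fW lW ncW _] := f_word_simple simple_s (pairwise_sorted pw).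
set W := f_word s in sW fW lW ncW *.
have ndbW x : x \in W -> dbl x = false by move=> /(allP sW)/andP[/negbTE].
have nodbl w : {in w, forall x, dbl x = false} ->
    [seq b <- w | dbl b] = [::] /\ [seq b <- w | ~~ dbl b] = w.
  move=> h; split; last by apply/all_filterP/allP => x /h ->.
  by apply/eqP; rewrite -[_ == _]negbK -has_filter; apply/hasPn => x /h ->.
have subW : {subset W <= pos_roots TypeA m.+1}.
  move=> x xW; rewrite mem_pos_roots ndbW // andbT; case/and3P: (allP sW x xW) => h0 h1 h2.
  apply/andP; split.
    have d0 : didx x = 0 by move: h0; rewrite /dbl; clear; lia.
    by rewrite /wf_root h1 h2 /dbl d0 /= (leq_trans h1 h2).
  have := map_f lidx xW; rewrite (perm_mem lW) => /mapP[y /sub + ->].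
  by rewrite mem_pos_roots => /and3P[].
have pl : perm_eq (lefts TypeA W) (lefts TypeA s).
  rewrite !lefts_typeA (nodbl W ndbW).2 (nodbl s ndb).2.
  by rewrite (map_comp predn fidx W) (map_comp predn fidx s) perm_map.
have pr : perm_eq (rights W) (rights s).
  rewrite (perm_trans (rights_perm W)) // perm_sym (perm_trans (rights_perm s)) //.
  by rewrite (nodbl W ndbW).1 (nodbl s ndb).1 !cats0 perm_sym.
have [_ ul ur] := good_word_nonnesting sub nn.
split=> //; first by split=> //; rewrite ?(perm_uniq pl) ?(perm_uniq pr).
pose R i k := exists2 b, b \in W & i = (fidx b).-1 /\ k = lidx b.
apply: (@noncrossing_adjW _ _ _ R).
- move=> x y /flattenP[_ /mapP[b bW ->]]; rewrite inE => /eqP[-> ->]; left; exists b => //.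
  have [h1 h2 _] := ends_in_range (subW b bW).
  move: h1 h2; rewrite /lends /rends (ndbW b bW) /= !andbT => h1 h2.
  by rewrite /= !inordK.
- move=> _ _ [b bW [-> ->]]; case/and3P: (allP sW b bW) => _; clear; lia.
- move=> _ _ _ _ [b bW [-> ->]] [c cW [-> ->]] [h1 h2 h3]; have := ncW b c bW cW.
  by case/and3P: (allP sW b bW) => _; case/and3P: (allP sW c cW) => _; rewrite /crosses;
    clear -h1 h2 h3; lia.
Qed.

Lemma f_word_typeB m s : nonnesting s -> {subset s <= pos_roots TypeB m.+1} ->
  [/\ good_word TypeB m (f_word s), perm_eq (lefts TypeB (f_word s)) (lefts TypeB s),
      perm_eq (rights (f_word s)) (rights s) &
      noncrossing_adj (@position TypeB m.+1) (wedges TypeB m (f_word s))].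
Proof.
move=> nn sub; have [T [w [fE [sw fw lw sT [ncw covw]]]]] := f_word_spec nn.
have wfs := nonnesting_wf_root nn.
have rangeT t : t \in T -> 0 < t <= m.+1.
  move=> tT; have : t \in map lidx w ++ T by rewrite mem_cat tT orbT.
  rewrite (perm_mem lw) mem_cat => /orP[] /mapP[b + ->].
    by move/sub; rewrite mem_pos_roots => /and3P[/and4P[h1 h2 _ _] h3 _];
      rewrite h3 (leq_trans h1).
  rewrite mem_filter => /andP[db /sub]; rewrite mem_pos_roots => /and3P[/and4P[_ _ h2 _] h3 _].
  by apply/andP; split; [exact: db | exact: leq_trans (ltnW h2) h3].
have posT : {in T, forall t, 0 < t} by move=> t /rangeT/andP[].
have ndbw x : x \in w -> dbl x = false by move=> /(allP sw)/andP[/negbTE].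
have fidxw x : x \in w -> 1 < fidx x.
  move=> xw; have := map_f fidx xw; rewrite (perm_mem fw) => /mapP[b + ->].
  rewrite mem_filter => /andP[/andP[_ b1] /wfs/and4P[b0 _ _ _]].
  by rewrite ltn_neqAle eq_sym b1.
have lidxw x : x \in w -> lidx x <= m.+1.
  move=> xw; have : lidx x \in map lidx w ++ T by rewrite mem_cat map_f.
  rewrite (perm_mem lw) mem_cat => /orP[] /mapP[b + ->].
    by move/sub; rewrite mem_pos_roots => /and3P[].
  rewrite mem_filter => /andP[_ /sub]; rewrite mem_pos_roots => /and3P[/and4P[_ _ h2 _] h3 _].
  exact: leq_trans (ltnW h2) h3.
have subw : {subset w <= pos_roots TypeB m.+1}.
  move=> x xw; rewrite mem_pos_roots lidxw // andbT; case/and3P: (allP sw x xw) => h0 h1 h2.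
  have d0 : didx x = 0 by move: h0; rewrite /dbl; clear; lia.
  by rewrite /wf_root h1 h2 /dbl d0 /= (leq_trans h1 h2).
have subT : {subset tword T <= pos_roots TypeB m.+1}.
  move=> x /(tword_wf sT posT)[wx xT _]; rewrite mem_pos_roots wx andbT.
  by case/andP: (rangeT _ xT).
have subW : {subset f_word s <= pos_roots TypeB m.+1}.
  by move=> x; rewrite (perm_mem fE) mem_cat => /orP[/subT|/subw].
have pl : perm_eq (lefts TypeB (f_word s)) (lefts TypeB s).
  apply: (perm_trans (perm_lefts _ fE)).
  rewrite /lefts map_cat flatten_cat -/(lefts TypeB (tword T)) -/(lefts TypeB w) -/(lefts
    TypeB s).
  rewrite tword_lefts // cat0s !lefts_typeB.
  rewrite (map_comp predn fidx) (map_comp predn fidx [seq b <- s | _]) perm_map //.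
  rewrite (_ : [seq b <- w | _] = w) //; apply/all_filterP/allP => x xw.
  by rewrite ndbw // gtn_eqF // fidxw.
have pr : perm_eq (rights (f_word s)) (rights s).
  apply: (perm_trans (perm_rights fE)).
  rewrite /rights map_cat flatten_cat -/(rights (tword T)) -/(rights w) -/(rights s).
  rewrite perm_catC; apply: (@perm_trans _ (map lidx w ++ T)).
    apply: perm_cat; last exact: tword_rights.
    rewrite (perm_trans (rights_perm w)) // (_ : [seq b <- w | dbl b] = [::]) ?cats0 //.
    by apply/eqP; rewrite -[_ == _]negbK -has_filter; apply/hasPn => x /ndbw ->.
  by rewrite (perm_trans lw) // perm_sym rights_perm.
have [_ ul ur] := good_word_nonnesting sub nn.
split=> //; first by split=> //; rewrite ?(perm_uniq pl) ?(perm_uniq pr).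
(* The point k has position k - 1 and -k has position m.+1 + (k - 1), which explains the second
   predecessor on the left end. The three cases of [R] are the arcs of the positive half, their
   negative copies, and the edges joining the halves. *)
pose Rw i k := exists2 b, b \in w & i = (fidx b).-1.-1 /\ k = (lidx b).-1.
pose R i k := [\/ Rw i k, exists i' k', [/\ Rw i' k', i = m.+1 + i' & k = m.+1 + k'] |
  exists2 j, j < size T & i = (nth 0 T j).-1 /\ k = m.+1 + (nth 0 T (size T - j.+1)).-1].
have Rw_lt i k : Rw i k -> i < k < m.+1.
  case=> b bw [-> ->]; have := fidxw b bw; have := lidxw b bw.
  by case/and3P: (allP sw b bw) => _; clear; lia.
have Rw_nc i j k l : Rw i k -> Rw j l -> ~ [/\ i < j, j < k & k < l].
  move=> [b bw [-> ->]] [c cw [-> ->]] [h1 h2 h3]; have := ncw b c bw cw.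
  have := fidxw b bw; have := fidxw c cw.
  by case/and3P: (allP sw b bw) => _; case/and3P: (allP sw c cw) => _; rewrite /crosses;
    clear -h1 h2 h3; lia.
have Rw_cov i k t : Rw i k -> t \in T -> ~ (i < t.-1 < k).
  move=> [b bw [-> ->]] tT ht; have /hasPn/(_ b bw) := covw t tT.
  have := fidxw b bw; case/and3P: (allP sw b bw) => _.
  by have := posT t tT; rewrite /covers; clear -ht; lia.
have revT j : j < size T -> size T - j.+1 < size T.
  by move=> jT; rewrite ltn_subrL (leq_ltn_trans (leq0n j) jT).
have T_nth j : j < size T -> 0 < nth 0 T j <= m.+1 by move=> jT; apply: rangeT; apply: mem_nth.
apply: (@noncrossing_adj_mem _ _ (wedges TypeB m (tword T ++ w))).
  by apply: wedges_mem => x; rewrite (perm_mem fE).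
apply: (@noncrossing_adjW _ _ _ R).
- move=> x y; rewrite /wedges map_cat flatten_cat mem_cat => /orP[|].
    case/(tword_edges sT posT) => j jT [-> ->]; right; constructor 3; exists j => //.
    have h1 := T_nth j jT; have h2 : 0 < nth 0 T (size T - j.+1) <= m.+1 by apply/T_nth/revT.
    by rewrite !(@position_point TypeB) // mul1n mul0n.
  case/flattenP => _ /mapP[b bw ->].
  have [h1 h2] : in_range TypeB m.+1 (fidx b).-1 /\ in_range TypeB m.+1 (lidx b).
    have [] := ends_in_range (subw b bw).
    by rewrite /lends /rends ndbw // gtn_eqF ?fidxw //= !andbT.
  rewrite /edges ndbw // gtn_eqF ?fidxw //.
  have RwB : Rw (fidx b).-1.-1 (lidx b).-1 by exists b.
  rewrite !inE => /orP[] /eqP[-> ->]; rewrite !(@position_point TypeB) //.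
    by right; constructor 2; exists (fidx b).-1.-1, (lidx b).-1; rewrite !mul1n.
  by left; constructor 1; rewrite !mul0n.
- move=> i k [/Rw_lt/andP[]//|[i' [k' [/Rw_lt/andP[h _] -> ->]]]|[j jT [-> ->]]].
    by rewrite ltn_add2l.
  by have /andP[h1 h2] := T_nth j jT; clear -h1 h2; lia.
- move=> i j k l [Rik|[i' [k' [Rik iE kE]]]|[a aT [iE kE]]] [Rjl|[j' [l' [Rjl jE lE]]]|[b
  bT [jE lE]]] [h1 h2 h3].
  + exact: (Rw_nc i j k l).
  + by have := Rw_lt _ _ Rik; clear -jE h2; lia.
  + apply: (Rw_cov i k (nth 0 T b)) => //; first exact: mem_nth.
    by rewrite -jE h1.
  + by have := Rw_lt _ _ Rjl; clear -iE h1 h2 h3 kE; lia.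
  + by apply: (Rw_nc i' j' k' l') => //; clear -iE jE kE lE h1 h2 h3; split; lia.
  + by have := T_nth b bT; clear -iE jE h1; lia.
  + by have := Rw_lt _ _ Rjl; clear -kE h3; lia.
  + apply: (Rw_cov j' l' (nth 0 T (size T - a.+1))) => //; first exact/mem_nth/revT.
    by clear -jE kE lE h2 h3; lia.
  (* Two edges between the halves are nested: the one starting later has its partner earlier, since
     [size T - j.+1] decreases with j. *)
  + have sa := revT a aT; have sb := revT b bT.
    have := tword_ltn_nth sT aT bT; have := tword_ltn_nth sT sa sb.
    have := T_nth _ aT; have := T_nth _ bT; have := T_nth _ sa; have := T_nth _ sb.
    by clear -iE jE kE lE h1 h2 h3 aT bT; lia.
Qed.

Lemma word_blocks_NC Psi m w : {subset w <= pos_roots Psi m.+1} ->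
  noncrossing_adj (@position Psi m.+1) (wedges Psi m w) -> word_blocks Psi m w \in NC Psi m.+1.
Proof.
move=> sub nc; rewrite inE word_blocks_partition word_blocks_invariant //=.
have pos_inj : injective (@position Psi m.+1).
  case: (Psi) => /= [i j /ord_inj //|[i s] [j t]] /= h.
  by have hi := ltn_ord i; have hj := ltn_ord j; congr pair; [apply: ord_inj|]; move: h;
    case: s; case: t; clear -hi hj; lia.
apply/forall_inP => B BP; apply/forall_inP => C CP; apply/forall_inP => a aB.
apply/forall_inP => c cB; apply/forall_inP => b bC; apply/forall_inP => d dC.
apply/implyP => /and3P[ab bc cd].
have pP := word_blocks_partition Psi m w.
have a_c : connect (adj (wedges Psi m w)) a c by rewrite -pblock_word_blocks (pblockE pP BP aB).
have bd : connect (adj (wedges Psi m w)) b d by rewrite -pblock_word_blocks (pblockE pP CP bC).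
have := noncrossing_connect pos_inj nc a_c bd ab bc cd.
rewrite -pblock_word_blocks -(pblockE pP BP aB) -(pblockE pP CP bC) => h.
by rewrite (pblockE pP (pblock_in pP a) h).
Qed.

(** * Antichains and their left and right ends *)

Lemma root_le_coef Psi n a b : a \in pos_roots Psi n -> b \in pos_roots Psi n ->
  (forall k, coef a k <= coef b k) -> root_le Psi n a b.
Proof.
move=> ha hb ab; exists (fun k => coef b k - coef a k); rewrite !root_vecE // -sumrB.
by apply: eq_bigr => k _; rewrite mulrnBr.
Qed.

(* Summing the coordinates from k on, in type B, or from k + 1 on, in type A,
   gives the functional dual to the simple root r_k. *)
Definition dual_form Psi n k (v : 'rV[int]_n) : int :=
  (\sum_(i < n | (if Psi is TypeA then k < i.+1 else k <= i.+1)%N) v ord0 i)%R.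

Lemma dual_formD Psi n k (u v : 'rV[int]_n) :
  dual_form Psi k (u + v)%R = (dual_form Psi k u + dual_form Psi k v)%R.
Proof. by rewrite /dual_form -big_split; apply: eq_bigr => i _; rewrite mxE. Qed.

Lemma dual_formN Psi n k (u : 'rV[int]_n) :
  dual_form Psi k (- u)%R = (- dual_form Psi k u)%R.
Proof. by rewrite /dual_form -sumrN; apply: eq_bigr => i _; rewrite mxE. Qed.

Lemma dual_form_sum Psi n k (r : nat) (F : nat -> 'rV[int]_n) (c : nat -> nat) :
  dual_form Psi k (\sum_(1 <= j < r) F j *+ c j)%R = (\sum_(1 <= j < r) dual_form Psi k (F
    j) *+ c j)%R.
Proof.
rewrite /dual_form (eq_bigr (fun i => \sum_(1 <= j < r) (F j *+ c j) ord0 i)%R); last first.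
  by move=> i _; rewrite summxE.
rewrite exchange_big /=; apply: eq_bigr => j _; rewrite -sumrMnl.
by apply: eq_bigr => i _; rewrite mulmxnE.
Qed.

Lemma dual_form_basis Psi n k j : dual_form Psi k (basis_vec n j) =
  ((if Psi is TypeA then k < j <= n else (k <= j <= n) && (0 < j))%N : nat)%:Z%R.
Proof.
rewrite /dual_form; have [jn|jn] := boolP (0 < j <= n).
  have jn' : j.-1 < n by lia.
  have jE : j.-1.+1 = j by rewrite prednK; case/andP: jn.
  rewrite big_mkcond (bigD1 (Ordinal jn')) //= big1 ?addr0.
    by rewrite mxE /= jE eqxx; move: jn; clear; case: Psi; case: ifP => //=; lia.
  move=> i ij; rewrite mxE (_ : (i.+1 == j) = false) ?if_same //.
  by apply/negbTE; apply: contra ij => /eqP iE; apply/eqP; apply: val_inj; rewrite /= -iE.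
rewrite big1; first by case: Psi; lia.
by move=> i _; rewrite mxE; case: eqP jn => // <-; rewrite ltn_ord.
Qed.

Lemma dual_form_simple Psi n k j : 0 < k -> 0 < j <= rank Psi n ->
  dual_form Psi k (simple_root Psi n j) = ((j == k) : nat)%:Z%R.
Proof.
move=> k0 jn; rewrite /simple_root; case: Psi jn => /= jn.
  by rewrite dual_formD dual_formN !dual_form_basis; lia.
case: eqP => j1; first by rewrite dual_form_basis; lia.
by rewrite dual_formD dual_formN !dual_form_basis; lia.
Qed.

(** The dual form extracts the coefficient of r_k from the difference of the two roots, and that
    coefficient is the natural number [c k]. *)
Lemma coef_root_le Psi n a b k : a \in pos_roots Psi n -> b \in pos_roots Psi n ->
  root_le Psi n a b -> 0 < k <= rank Psi n -> coef a k <= coef b k.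
Proof.
move=> ha hb [c]; rewrite !root_vecE // => /(congr1 (dual_form Psi k)).
move=> + kr; have k0 : 0 < k by case/andP: kr.
have pick c' : dual_form Psi k (\sum_(1 <= j < (rank Psi n).+1) simple_root Psi n j *+ c'
  j)%R = (c' k)%:Z%R.
  rewrite dual_form_sum (eq_big_nat _ _ (F2 := fun j => if j == k then (c' j)%:Z%R else 0%R)).
    by rewrite -big_mkcond big_nat1_eq ltnS kr.
  move=> j jr; rewrite dual_form_simple //; case: eqP => _; last by rewrite mul0rn.
  by rewrite -[RHS]mulr1z -pmulrn natz.
by rewrite dual_formD dual_formN !pick; lia.
Qed.

Lemma antichain_lt_coef a b : wf_root a -> wf_root b -> antichain_lt a b ->
  coef a (lidx b) < coef b (lidx b) /\ exists2 k, 0 < k <= lidx a & coef b k < coef a k.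
Proof.
move=> /and4P[a0 a1 a2 /implyP a3] /and4P[b0 b1 b2 /implyP b3] /andP[ab abd]; split.
  by rewrite {1}/coef [lidx b <= lidx a]leqNgt ab andbF coef_gt0 b1 leqnn.
have dbl_case : dbl a -> didx b < didx a -> exists2 k, 0 < k <= lidx a & coef b k < coef a k.
  move=> da dd; exists (didx a); first by rewrite (ltnW a2) andbT; exact: da.
  have fa := eqP (a3 da); have d0 : 0 < didx a := da.
  rewrite [coef a _]/coef fa (ltnW a2) d0 leqnn /= /coef [didx a <= didx b]leqNgt dd /=.
  by case: ifP.
move: abd; case: ifP => [_ /andP[]//|db /orP[da|ff]].
  apply: dbl_case => //; move: db; rewrite /dbl; clear -da; case: (didx b) => // _; exact: da.
exists (fidx a); first by rewrite a0 a1.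
by rewrite {1}/coef [fidx b <= _]leqNgt ff coef_gt0 leqnn a1.
Qed.

Lemma coef_antichain_lt a b : wf_root a -> wf_root b -> lidx a <= lidx b -> ~ (forall k,
  coef a k <= coef b k) ->
  ~ (forall k, coef b k <= coef a k) -> antichain_lt a b.
Proof.
move=> wa wb ll h1 h2.
have cmp x y : wf_root x -> wf_root y -> fidx y <= fidx x -> didx x <= didx y -> lidx x <=
  lidx y ->
    forall k, coef x k <= coef y k.
  move=> _ _ hf hd hl k; rewrite /coef; case: ifP => // /andP[k1 k2].
  rewrite (leq_trans hf k1) (leq_trans k2 hl); case: ifP => k3; last by case: ifP.
  by rewrite (leq_trans k3 hd).
have d0 x : dbl x = false -> didx x = 0 by rewrite /dbl; case: (didx x).
have fd x : wf_root x -> dbl x -> fidx x = 1 by case/and4P=> _ _ _ /implyP h /h/eqP.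
have f0 x : wf_root x -> 0 < fidx x by case/and4P.
have strict : (fidx a <= fidx b) && (didx b <= didx a) -> lidx a < lidx b.
  case/andP=> hf hd; rewrite ltn_neqAle ll andbT; apply/eqP => E.
  by apply: h2; apply: cmp; rewrite // E.
rewrite /antichain_lt; case da: (dbl a); case db: (dbl b) => /=.
- case: (leqP (didx a) (didx b)) => dd.
    by case: h1; apply: cmp; rewrite // (fd a wa da) (fd b wb db).
  by rewrite andbT; apply: strict; rewrite (fd a wa da) (fd b wb db) leqnn (ltnW dd).
- by rewrite andbT; apply: strict; rewrite (fd a wa da) f0 // d0.
- by case: h1; apply: cmp; rewrite // ?(fd b wb db) ?f0 // (d0 a da).
case: (leqP (fidx b) (fidx a)) => ff.
  by case: h1; apply: cmp; rewrite // (d0 a da).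
by rewrite andbT; apply: strict; rewrite (ltnW ff) (d0 b db).
Qed.

Section Antichains.
Variables (Psi : cartan) (n : nat).
Implicit Types A : {set posroot Psi n}.

Lemma mem_tuple_of A (b : posroot Psi n) : (val b \in tuple_of A) = (b \in A).
Proof. by rewrite mem_sort mem_map ?mem_enum //; apply: val_inj. Qed.

Lemma tuple_of_val A x : x \in tuple_of A -> exists2 b, b \in A & x = val b.
Proof. by rewrite mem_sort => /mapP[b]; rewrite mem_enum; exists b. Qed.

Lemma tuple_of_sub A : {subset tuple_of A <= pos_roots Psi n}.
Proof. by move=> x /tuple_of_val[b _ ->]; apply: valP. Qed.

Lemma tuple_of_uniq A : uniq (tuple_of A).
Proof. by rewrite sort_uniq map_inj_uniq ?enum_uniq //; apply: val_inj. Qed.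

Lemma tuple_of_nonnesting A : NN A -> nonnesting (tuple_of A).
Proof.
move=> nn; have wfA : all wf_root (tuple_of A).
  by apply/allP => x /tuple_of_sub; rewrite mem_pos_roots => /and3P[].
rewrite /nonnesting wfA /=.
have pw : pairwise (fun a b => lidx a <= lidx b) (tuple_of A).
  rewrite -sorted_pairwise; last by move=> b a c; apply: leq_trans.
  by apply: sort_sorted => a b; apply: leq_total.
have := tuple_of_uniq A; rewrite uniq_pairwise => un.
have : pairwise [rel x y | (lidx x <= lidx y) && [rel x y | x != y] x y] (tuple_of A).
  by rewrite (pairwise_relI (fun a b => lidx a <= lidx b)) pw un.
apply: (sub_in_pairwise (P := mem (tuple_of A))); last by apply/allP.
move=> x y xA yA /= /andP[xy xNy].
have [/tuple_of_val[a aA xE] /tuple_of_val[b bA yE]] := (xA, yA).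
apply: coef_antichain_lt => //; try exact: (allP wfA).
  move=> h; case/eqP: xNy; rewrite xE yE; congr val; apply: nn => //.
  by apply: root_le_coef; rewrite -?xE -?yE ?(tuple_of_sub xA) ?(tuple_of_sub yA).
move=> h; case/eqP: xNy; rewrite xE yE; congr val; apply/esym; apply: nn => //.
by apply: root_le_coef; rewrite -?xE -?yE ?(tuple_of_sub xA) ?(tuple_of_sub yA).
Qed.

Lemma NN_of_nonnesting (s : seq proot) : {subset s <= pos_roots Psi n} -> nonnesting s ->
  let A := [set b : posroot Psi n | val b \in s] in NN A /\ perm_eq (tuple_of A) s.
Proof.
move=> sub nn A; have wfs := nonnesting_wf_root nn; split.
  move=> a b; rewrite !inE => aS bS ab; apply: val_inj.
  have rk x : x \in s -> lidx x <= rank Psi n by move/sub; rewrite mem_pos_roots => /and3P[].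
  have coefs := coef_root_le (sub _ aS) (sub _ bS) ab.
  have l0 x : x \in s -> 0 < lidx x by move/wfs/and4P => [h1 h2 _ _]; apply: leq_trans h2.
  case: (pairwise_cmp (proj2 (andP nn)) aS bS) => // h.
    have [_ [k /andP[k0 ka]]] := antichain_lt_coef (wfs _ aS) (wfs _ bS) h.
    by rewrite ltnNge coefs // k0 (leq_trans ka) // rk.
  have [] := antichain_lt_coef (wfs _ bS) (wfs _ aS) h.
  by rewrite ltnNge coefs // l0 ?rk.
have us : uniq s by apply: (@pairwise_uniq _ (fun a b => lidx a < lidx b)) (nonnesting_lidx
  nn) => x; apply: ltnn.
apply: uniq_perm => //; first exact: tuple_of_uniq.
move=> x; apply/idP/idP => [/tuple_of_val[b + ->]|xs]; first by rewrite inE.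
have -> : x = val (Sub x (sub _ xs) : posroot Psi n) by [].
by rewrite mem_tuple_of inE.
Qed.

End Antichains.

Lemma antichain_partitionE Psi m (A : {set posroot Psi m.+1}) :
  antichain_partition A = word_blocks Psi m (tuple_of A).
Proof.
rewrite /antichain_partition /word_blocks /equivalence_partition.
have E : connect [rel x y | [exists a in A, reflection Psi m.+1 (val a) x == y]]
      =2 connect (adj (wedges Psi m (tuple_of A))).
  move=> x y; rewrite -(connect_reflections (@tuple_of_sub _ _ A)).
  apply: eq_connect => {x y} x y /=; apply/exists_inP/hasP => [[a aA h]|[b /tuple_of_val[a
    aA ->] h]].
    by exists (val a); rewrite ?mem_tuple_of.
  by exists a.
apply: eq_imset => x; apply/setP => y; by rewrite !inE E.
Qed.

(** * An antichain is determined by its left and right ends *)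

Lemma sorted_ltn_eq (s t : seq nat) : sorted ltn s -> sorted ltn t -> s =i t -> s = t.
Proof. by apply: irr_sorted_eq; [apply: ltn_trans | apply: ltnn]. Qed.

Lemma eq_proots (s t : seq proot) : map fidx s = map fidx t -> map didx s = map didx t ->
  map lidx s = map lidx t -> s = t.
Proof.
elim: s t => [|[f d l] s IH] [|[f' d' l'] t] //= [-> hf] [-> hd] [-> hl].
by rewrite (IH t).
Qed.

Section Reconstruction.
Variable s : seq proot.
Hypothesis nn : nonnesting s.
Let D := [seq b <- s | dbl b].
Let G := [seq b <- s | ~~ dbl b].

Lemma nonnesting_cat : s = D ++ G.
Proof.
rewrite /D /G; case/andP: nn => _; elim: (s) => //= b s' IH /andP[/allP h pw].
case: ifP => db /=; first by rewrite -IH.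
have nd x : x \in s' -> ~~ dbl x.
  by move/h; rewrite /antichain_lt db /= => /andP[_]; case: (dbl x).
rewrite (_ : [seq b <- s' | dbl b] = [::]).
  by congr cons; apply/esym/all_filterP/allP.
by apply/eqP; rewrite -[_ == _]negbK -has_filter; apply/hasPn.
Qed.

Lemma sorted_fidx : sorted ltn (map fidx G).
Proof. by rewrite (sorted_pairwise ltn_trans) pairwise_map nonnesting_fidx. Qed.

Lemma fidx_gt0 : all (fun f => 0 < f) (map fidx G).
Proof.
rewrite all_map; apply/allP => b; rewrite mem_filter => /andP[_ /(nonnesting_wf_root nn)].
by case/and4P.
Qed.

Lemma map_fidx : map fidx s = nseq (size D) 1 ++ map fidx G.
Proof.
rewrite {1}nonnesting_cat map_cat; congr cat; rewrite -(size_map fidx D); apply/all_pred1P.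
rewrite all_map; apply/allP => b; rewrite mem_filter => /andP[db /(nonnesting_wf_root nn)].
by case/and4P => _ _ _ /implyP/(_ db).
Qed.

Lemma map_didx : map didx s = map didx D ++ nseq (size G) 0.
Proof.
rewrite {1}nonnesting_cat map_cat; congr cat; rewrite -(size_map didx G); apply/all_pred1P.
by rewrite all_map; apply/allP => b; rewrite mem_filter /dbl -eqn0Ngt => /andP[].
Qed.

Lemma sorted_lefts Psi : sorted ltn (lefts Psi s).
Proof.
have pred_sorted t : all (fun f => 0 < f) t -> sorted ltn t -> sorted ltn (map predn t).
  rewrite !(sorted_pairwise ltn_trans) pairwise_map.
  by apply: sub_in_pairwise => a b; rewrite !unfold_in /=; lia.
case: Psi; rewrite (lefts_typeA, lefts_typeB) (map_comp predn fidx); apply: pred_sorted.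
- exact: fidx_gt0.
- exact: sorted_fidx.
- apply/allP => f /mapP[b]; rewrite mem_filter => /andP[_ /(nonnesting_wf_root nn)/and4P[h
  _ _ _]] -> //.
rewrite (_ : [seq b <- s | _] = [seq b <- G | fidx b != 1]).
  by rewrite -[map _ _]/(map fidx (filter (preim fidx (predC1 1)) G)) -filter_map
    sorted_filter ?sorted_fidx //; apply: ltn_trans.
by rewrite -filter_predI; apply: eq_filter => x /=; rewrite andbC.
Qed.

(** In type B the left ends forget a root starting at r_1; the leading bit restores it, and is later
    recovered from a count. *)
Lemma fidx_lefts Psi :
  map fidx G = nseq (if Psi is TypeA then 0 else (1 \in map fidx G)) 1 ++ map succn (lefts
    Psi s).
Proof.
have predK t : all (fun f => 0 < f) t -> map succn (map predn t) = t.
  move/allP=> h; rewrite -map_comp -[RHS]map_id; apply/eq_in_map => f /h.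
  by case: f.
case: Psi; rewrite (lefts_typeA, lefts_typeB) (map_comp predn fidx) predK //=.
- exact: fidx_gt0.
- have -> : [seq fidx b | b <- s & ~~ dbl b && (fidx b != 1)] = filter (predC1 1) (map fidx G).
    rewrite filter_map /G -filter_predI; congr map; apply: eq_filter => x /=; by rewrite andbC.
  have := sorted_fidx; have := fidx_gt0; case: (map fidx G) => //= f t /andP[f0 t0] /=.
  rewrite (path_sortedE ltn_trans) => /andP[/allP ft _].
  have tN1 : all (predC1 1) t.
    by apply/allP => x xt /=; have := ft x xt; rewrite neq_ltn orbC; move=> h';
      rewrite (leq_ltn_trans f0 h').
  rewrite inE (all_filterP tN1) (negbTE (_ : 1 \notin t)) ?orbF; last first.
    by apply/negP => /(allP tN1).
  by rewrite eq_sym; case: eqP => //= ->.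
- by apply/allP => f /mapP[b]; rewrite mem_filter => /andP[_ /(nonnesting_wf_root
  nn)/and4P[h' _ _ _]] ->.
Qed.

Lemma sorted_rights : sorted ltn (rev (map didx D) ++ map lidx s).
Proof.
rewrite (sorted_pairwise ltn_trans) pairwise_cat; apply/and3P; split.
- apply/allrelP => d l; rewrite mem_rev => /mapP[a + ->] /mapP[b bs ->].
  by rewrite mem_filter => /andP[da aS]; apply: didx_lt_lidx nn a b aS bs da.
- rewrite -(sorted_pairwise ltn_trans) rev_sorted (@sorted_pairwise _ gtn);
  last by move=> a b c h1 h2; apply: ltn_trans h2 h1.
  by rewrite pairwise_map nonnesting_didx.
- by rewrite pairwise_map nonnesting_lidx.
Qed.

Lemma mem_rights : rev (map didx D) ++ map lidx s =i rights s.
Proof. by move=> x; rewrite (perm_mem (rights_perm s)) !mem_cat mem_rev orbC. Qed.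

End Reconstruction.

Lemma nonnesting_inj Psi n s s' :
  {subset s <= pos_roots Psi n} -> {subset s' <= pos_roots Psi n} ->
  nonnesting s -> nonnesting s' ->
  lefts Psi s =i lefts Psi s' -> rights s =i rights s' -> s = s'.
Proof.
move=> sub sub' nn nn' hl hr.
have eL : lefts Psi s = lefts Psi s' by apply: sorted_ltn_eq => //; apply: sorted_lefts.
have eR : rev (map didx [seq b <- s | dbl b]) ++ map lidx s =
          rev (map didx [seq b <- s' | dbl b]) ++ map lidx s'.
  by apply: sorted_ltn_eq; rewrite ?sorted_rights // => x; rewrite !mem_rights.
have fG := fidx_lefts nn Psi; have fG' := fidx_lefts nn' Psi.
have sz t : size t = size [seq b <- t | dbl b] + size [seq b <- t | ~~ dbl b].
  by rewrite !size_filter count_predC.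
have := congr1 size fG; have := congr1 size fG'; have := congr1 size eR; have := congr1 size eL.
rewrite !size_cat !size_rev !size_map !size_nseq !(sz s) !(sz s').
set d := size [seq b <- s | dbl b]; set d' := size [seq b <- s' | dbl b].
set g := size [seq b <- s | ~~ dbl b]; set g' := size [seq b <- s' | ~~ dbl b].
move: fG fG'; set e := (if Psi is TypeA then _ else _);
  set e' := (if Psi is TypeA then _ else _).
have e1 : e <= 1 by rewrite /e; case: (Psi) => //; case: (_ \in _).
have e1' : e' <= 1 by rewrite /e'; case: (Psi) => //; case: (_ \in _).
move=> fG fG' h1 h2 h3 h4.
(* With d double roots and g others, there are 2d + g right ends and g - e left ends, so the excess
   is 2d + e with e at most 1, and this determines d and e. *)
have [dd ee gg] : [/\ d = d', e = e' & g = g'] by split; clear -e1 e1' h1 h2 h3 h4; lia.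
have /andP[/eqP hd /eqP hl'] : (rev (map didx [seq b <- s | dbl b]) == rev (map didx [seq b
  <- s' | dbl b]))
    && (map lidx s == map lidx s').
  by rewrite -eqseq_cat ?eR // !size_rev !size_map.
have {}hd := can_inj (@revK _) hd.
apply: eq_proots => //.
  rewrite (map_fidx nn) (map_fidx nn') fG fG' ee eL; congr (nseq _ _ ++ _); exact: dd.
rewrite (map_didx nn) (map_didx nn') hd; congr (_ ++ nseq _ _); exact: gg.
Qed.

(** * Construction of an antichain with prescribed ends *)

Lemma count_geq_nth (t : seq nat) i : sorted ltn t -> i < size t ->
  size t - i <= count (fun x => nth 0 t i <= x) t.
Proof.
move=> st it; rewrite -[X in count _ X](cat_take_drop i t) count_cat -size_drop.
suff : all (fun x => nth 0 t i <= x) (drop i t) by rewrite all_count => /eqP ->;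
  apply: leq_addl.
apply/(all_nthP 0) => j; rewrite size_drop nth_drop => jt.
case: j jt => [|j] jt; first by rewrite addn0.
by apply: ltnW; apply: (sorted_ltn_nth ltn_trans 0 st); rewrite ?inE; clear -it jt; lia.
Qed.

Lemma count_gt_nth (t : seq nat) i p : sorted ltn t -> i < size t -> nth 0 t i <= p ->
  count (fun x => p < x) t < size t - i.
Proof.
move=> st it ip; rewrite -[X in count _ X](cat_take_drop i.+1 t) count_cat.
have -> : count (fun x => p < x) (take i.+1 t) = 0.
  apply/eqP; rewrite -leqn0 leqNgt -has_count; apply/hasPn => x /(nthP 0)[j].
  rewrite size_takel // => jt <-; rewrite nth_take // -leqNgt; apply: leq_trans ip.
  move: jt; rewrite ltnS leq_eqVlt => /predU1P[->//|ji]; apply: ltnW.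
  by apply: (sorted_ltn_nth ltn_trans 0 st); rewrite ?inE // (ltn_trans ji).
by rewrite add0n (leq_ltn_trans (count_size _ _)) // size_drop; clear -it; lia.
Qed.

Section Build.
Variables (Psi : cartan) (n : nat) (L R : seq nat).
Hypotheses (sorted_L : sorted ltn L) (sorted_R : sorted ltn R).
Hypotheses (range_L : all (in_range Psi n) L) (range_R : all (in_range Psi n) R).
Hypothesis ballot : forall p, count (fun x => p <= x) L <= count (fun x => p < x) R.
Hypothesis typeA_size : Psi = TypeA -> size L = size R.

(* The antichain with left ends L and right ends R has l double roots, and a
   root r_1 + ... + r_j exactly when e is true (in type A, l = 0 and e is
   false). *)
Let l := (size R - size L)./2.
Let e := odd (size R - size L).
Let F := nseq e 1 ++ map succn L.

Lemma build_size : size L + e + l + l = size R.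
Proof.
have : size L <= size R.
  have := ballot 0; rewrite (@eq_count _ _ predT) // count_predT => h.
  exact: leq_trans h (count_size _ _).
by rewrite /e /l; lia.
Qed.

Let d := rev (take l R).
Let m := take l (drop l R).
Let g := drop l (drop l R).

Lemma build_size_dbl : size d = l /\ size m = l.
Proof.
have bs := build_size; have lR : l <= size R by rewrite -bs leq_addl.
rewrite /d /m size_rev !size_takel // size_drop -bs addnK leq_addl //.
Qed.

Lemma build_size_ndbl : size g = size F.
Proof. by have := build_size; rewrite /g /F !size_drop size_cat size_nseq size_map; clear;
  lia. Qed.

Lemma build_sorted_fidx : sorted ltn F.
Proof.
have h : sorted ltn (map succn L) by rewrite sorted_map; apply: sub_sorted sorted_L.
rewrite /F; case ee: e => //=.
rewrite (path_sortedE ltn_trans) h andbT all_map; apply/allP => x xL /=.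
have := allP range_L x xL; case: (Psi) typeA_size => /= [E|_ /andP[] //].
by move: ee; rewrite /e E // subnn.
Qed.

Lemma build_right_gt0 : Psi = TypeB -> all (fun x => 0 < x) R.
Proof. by move=> E; apply: sub_all range_R => x; rewrite /in_range E => /andP[]. Qed.

(** If the i-th remaining right end did not exceed its left end p, at least |L| - (i - e) left ends
    would be at least p, while fewer than |R| - 2l - i right ends would exceed p. The two bounds are
    equal by [build_size], contradicting the ballot condition at p. *)
Lemma build_fidx_leq p : p \in zip F g -> 0 < p.1 <= p.2.
Proof.
case/(nthP (0, 0)) => i; rewrite size_zip build_size_ndbl minnn => iF <-;
  rewrite nth_zip ?build_size_ndbl //=.
have bs := build_size; have sF : size F = e + size L by rewrite size_cat size_nseq size_map.
have gE : nth 0 g i = nth 0 R (l + l + i) by rewrite /g !nth_drop addnA.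
have iR : l + l + i < size R by move: iF; rewrite sF -bs; move: (size L) (l) (e : nat);
  clear; lia.
rewrite gE /F nth_cat size_nseq; case: (ltnP i e) => ie.
  have e1 : (e : nat) = 1 by move: ie; move: (e : bool); clear; case.
  have i0 : i = 0 by move: ie; rewrite e1; clear; lia.
  rewrite nth_nseq ie /=; case E : (Psi).
    by move: e1; rewrite /e typeA_size // subnn.
  by apply: (allP (build_right_gt0 E)); apply: mem_nth.
have iL : i - e < size L by move: iF ie; rewrite sF; move: (size L) (e : nat); clear; lia.
rewrite (nth_map 0) //= ltnNge; apply/negP => h.
have h1 := leq_trans (count_geq_nth sorted_L iL) (ballot (nth 0 L (i - e))).
have := leq_ltn_trans h1 (count_gt_nth sorted_R iR h).
by move: ie iL; rewrite -bs; move: (size L) (l) (e : nat); clear; lia.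
Qed.

Lemma build_typeA : Psi = TypeA -> l = 0.
Proof. by move=> E; rewrite /l typeA_size // subnn. Qed.

Lemma build_didx_lt p : p \in zip d m -> 0 < p.1 < p.2.
Proof.
have [sd sm] := build_size_dbl.
move=> pz; have p1 : p.1 \in take l R.
  by have := map_f fst pz; rewrite -/(unzip1 _) unzip1_zip ?sd ?sm // mem_rev.
have p2 : p.2 \in drop l R.
  by have := map_f snd pz; rewrite -/(unzip2 _) unzip2_zip ?sd ?sm // => /mem_take.
apply/andP; split.
  case E : (Psi); first by move: p1; rewrite build_typeA // take0.
  by apply: (allP (build_right_gt0 E)); apply: mem_take p1.
move: sorted_R; rewrite (sorted_pairwise ltn_trans) -(cat_take_drop l R) pairwise_cat.
by case/and3P => /allrelP h _ _; apply: h.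
Qed.

Let D := [seq Root 1 p.1 p.2 | p <- zip d m].
Let G := [seq Root p.1 0 p.2 | p <- zip F g].

Lemma build_dblP b : b \in D -> [/\ fidx b = 1, 0 < didx b & didx b < lidx b].
Proof. by case/mapP => p /build_didx_lt/andP[h1 h2] ->. Qed.

Lemma build_ndblP b : b \in G -> didx b = 0 /\ 0 < fidx b <= lidx b.
Proof. by case/mapP => p /build_fidx_leq h ->. Qed.

Lemma build_lidx : map lidx (D ++ G) = drop l R.
Proof.
have [sd sm] := build_size_dbl.
rewrite map_cat -!map_comp -[X in X ++ _]/(unzip2 (zip d m)) -[X in _ ++ X]/(unzip2 (zip F g)).
by rewrite !unzip2_zip ?sd ?sm ?build_size_ndbl // cat_take_drop.
Qed.

Lemma build_didx : map didx D = d.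
Proof.
have [sd sm] := build_size_dbl.
by rewrite -map_comp -[LHS]/(unzip1 (zip d m)) unzip1_zip ?sd ?sm.
Qed.

Lemma build_fidx : map fidx G = F.
Proof. by rewrite -map_comp -[LHS]/(unzip1 (zip F g)) unzip1_zip ?build_size_ndbl. Qed.

Lemma build_filter : [seq b <- D ++ G | dbl b] = D /\ [seq b <- D ++ G | ~~ dbl b] = G.
Proof.
have hD b : b \in D -> dbl b by case/build_dblP.
have hG b : b \in G -> ~~ dbl b by case/build_ndblP; rewrite /dbl => ->.
rewrite !filter_cat; split.
  rewrite (_ : [seq b <- G | dbl b] = [::]) ?cats0; first by apply/all_filterP/allP.
  by apply/eqP; rewrite -[_ == _]negbK -has_filter; apply/hasPn.
rewrite (_ : [seq b <- D | ~~ dbl b] = [::]) /=; first by apply/all_filterP/allP.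
apply/eqP; rewrite -[_ == _]negbK -has_filter; apply/hasPn => b /hD -> //.
Qed.

Lemma build_nonnesting : nonnesting (D ++ G).
Proof.
apply/andP; split.
  rewrite all_cat; apply/andP; split; apply/allP => b.
    by case/build_dblP => h1 h2 h3; rewrite /wf_root h1 h3 (ltn_trans h2 h3) eqxx implybT.
  by case/build_ndblP => h1 /andP[h2 h3]; rewrite /wf_root /dbl h1 h2 h3 /= (leq_trans h2 h3).
have pl : pairwise (fun a b => lidx a < lidx b) (D ++ G).
  rewrite -(pairwise_map lidx ltn) build_lidx -(sorted_pairwise ltn_trans).
  exact: drop_sorted.
move: (pl); rewrite !pairwise_cat => /and3P[/allrelP lDG lD lG].
apply/and3P; split.
- apply/allrelP => a b aD bG; rewrite /antichain_lt lDG //=.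
  by have [hb _] := build_ndblP bG; have [_ h _] := build_dblP aD; rewrite /dbl hb h.
- have pd : pairwise (fun a b => didx b < didx a) D.
    rewrite -(pairwise_map didx gtn) build_didx -sorted_pairwise;
      last by move=> a b c h1 h2; apply: ltn_trans h2 h1.
    by rewrite /d rev_sorted; apply: take_sorted.
  have : pairwise [rel a b | (lidx a < lidx b) && (didx b < didx a)] D.
    by rewrite (pairwise_relI (fun a b => lidx a < lidx b) (fun a b => didx b < didx a)) lD pd.
  apply: (sub_in_pairwise (P := mem D)); last by apply/allP.
  move=> a b aD bD /= /andP[h1 h2]; rewrite /antichain_lt h1 /= h2.
  by have [_ ha _] := build_dblP aD; have [_ hb _] := build_dblP bD; rewrite /dbl ha hb.
- have pf : pairwise (fun a b => fidx a < fidx b) G.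
    by rewrite -(pairwise_map fidx ltn) build_fidx -(sorted_pairwise ltn_trans)
      build_sorted_fidx.
  have : pairwise [rel a b | (lidx a < lidx b) && (fidx a < fidx b)] G.
    by rewrite (pairwise_relI (fun a b => lidx a < lidx b) (fun a b => fidx a < fidx b)) lG pf.
  apply: (sub_in_pairwise (P := mem G)); last by apply/allP.
  move=> a b aG bG /= /andP[h1 h2]; rewrite /antichain_lt h1 /= h2 orbT.
  by have [hb _] := build_ndblP bG; rewrite /dbl hb.
Qed.

Lemma build_sub : {subset D ++ G <= pos_roots Psi n}.
Proof.
move=> b bDG; rewrite mem_pos_roots (nonnesting_wf_root build_nonnesting) //=; apply/andP;
  split.
  have : lidx b \in R by apply: (@mem_drop l); rewrite -build_lidx map_f.
  by move/(allP range_R); rewrite /in_range /rank; case: (Psi) => [|/andP[]//]; clear; lia.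
case E : (Psi) => //; move: bDG; rewrite mem_cat => /orP[|/build_ndblP[h _]];
  last by rewrite /dbl h.
by rewrite /D /d /m build_typeA // !take0.
Qed.

Lemma build_lefts : lefts Psi (D ++ G) = L.
Proof.
have succK t : map predn (map succn t) = t by rewrite -map_comp map_id.
case E : (Psi); rewrite (lefts_typeA, lefts_typeB) (map_comp predn fidx).
  by rewrite build_filter.2 build_fidx /F /e typeA_size // subnn /= succK.
have -> : [seq b <- D ++ G | ~~ dbl b && (fidx b != 1)] =
    [seq b <- [seq b <- D ++ G | ~~ dbl b] | fidx b != 1].
  by rewrite -filter_predI; apply: eq_filter => x /=; rewrite andbC.
rewrite build_filter.2.
rewrite -[map fidx _]/(map fidx (filter (preim fidx (predC1 1)) G)) -filter_map build_fidx
  /F filter_cat.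
rewrite (_ : filter _ (nseq e 1) = [::]); last by case: (e).
rewrite cat0s -[RHS]succK; congr map; apply/all_filterP/allP => f /mapP[x xL ->] /=.
have := allP range_L x xL; rewrite /in_range E eqSS -lt0n; by case/andP.
Qed.

Lemma build_rights : perm_eq (rights (D ++ G)) R.
Proof.
rewrite (perm_trans (rights_perm _)) // build_lidx build_filter.1 build_didx /d.
by rewrite -{3}(cat_take_drop l R) perm_catC perm_cat2r perm_rev.
Qed.

End Build.

(** * Noncrossing partitions and their openers and closers *)

(* E matches the elements of Lp with elements of Rp like brackets; the elements
   of Rp left unmatched lie under no arc. *)
Record bracket n (Lp Rp : pred 'I_n) (E : rel 'I_n) : Prop := Bracket {
  bracket_lt : forall i j, E i j -> i < j;
  bracket_fun : forall i j j', E i j -> E i j' -> j = j';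
  bracket_inj : forall i i' j, E i j -> E i' j -> i = i';
  bracket_left : forall i, Lp i -> exists j, E i j;
  bracket_leftE : forall i j, E i j -> Lp i;
  bracket_rightE : forall i j, E i j -> Rp j;
  bracket_nc : forall i j k l, E i k -> E j l -> i < j -> j < k -> l <= k;
  bracket_cover : forall i j k, Rp j -> E i k -> i < j -> j < k -> exists i', E i' j
}.

(** Induction on the length of the arc. If E and E' send p to different points, the nearer of the
    two is a right end strictly under the longer arc, hence matched there by a shorter arc nested
    inside; by induction shorter arcs of E belong to E', which gives some point two partners. *)
Lemma bracket_unique n (Lp Rp : pred 'I_n) (E E' : rel 'I_n) :
  bracket Lp Rp E -> bracket Lp Rp E' -> forall i j, E i j -> E' i j.
Proof.
move=> b b' p r; have [N] := ubnP (r - p); elim: N p r => // N IH p r rpN Epr.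
have pr := bracket_lt b Epr.
have [s' E'ps] := bracket_left b' (bracket_leftE b Epr).
have ps := bracket_lt b' E'ps.
case: (ltngtP s' r) => sr; last by rewrite -(val_inj sr : s' = r).
- have [p'' Ep] := bracket_cover b (bracket_rightE b' E'ps) Epr ps sr.
  have p's := bracket_lt b Ep.
  case: (ltngtP p'' p) => pp''.
  + by have := bracket_nc b Ep Epr pp'' ps; rewrite leqNgt sr.
  + have E'p : E' p'' s' by apply: IH => //; lia.
    by rewrite (bracket_inj b' E'p E'ps) ltnn in pp''.
  + have E1 : p'' = p by apply: val_inj.
    by rewrite E1 in Ep; rewrite (bracket_fun b Ep Epr) ltnn in sr.
- have [q' E'q] := bracket_cover b' (bracket_rightE b Epr) E'ps pr sr.
  have q'r := bracket_lt b' E'q.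
  case: (ltngtP q' p) => qp.
  + by have := bracket_nc b' E'q E'ps qp pr; rewrite leqNgt sr.
  + have [s Eqs] := bracket_left b (bracket_leftE b' E'q).
    have qs := bracket_lt b Eqs.
    have := bracket_nc b Epr Eqs qp q'r; rewrite leq_eqVlt => /orP[/eqP E1|sr'].
      have E2 : s = r by apply: val_inj.
      by rewrite E2 in Eqs; rewrite (bracket_inj b Eqs Epr) ltnn in qp.
    have E's : E' q' s by apply: IH => //; lia.
    by rewrite (bracket_fun b' E's E'q) ltnn in sr'.
  + have E1 : q' = p by apply: val_inj.
    by rewrite E1 in E'q; rewrite (bracket_fun b' E'q E'ps) ltnn in sr.
Qed.

(* The least t where two order-reversing involutions of the same set differ
   cannot exist: the larger of the two values is attained before t by one of
   them, hence by both. *)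
Lemma antitone_unique n (T : pred 'I_n) (F F' : rel 'I_n) :
  (forall t, T t -> exists u, F t u) -> (forall t, T t -> exists u, F' t u) ->
  (forall t u, F t u -> T t /\ F u t) -> (forall t u, F' t u -> T t /\ F' u t) ->
  (forall t t' u u', F t u -> F t' u' -> t < t' -> u' < u) ->
  (forall t t' u u', F' t u -> F' t' u' -> t < t' -> u' < u) ->
  forall t u, F t u -> F' t u.
Proof.
move=> tot tot' sym sym' anti anti'.
suff H N (t : 'I_n) : t < N -> forall u, F t u = F' t u by move=> t u; rewrite (H t.+1).
elim: N t => // N IH t tN.
suff H (G G' : rel 'I_n) : (forall t, T t -> exists u, G t u) -> (forall t, T t -> exists
  u, G' t u) ->
    (forall t u, G t u -> T t /\ G u t) -> (forall t u, G' t u -> T t /\ G' u t) ->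
    (forall t t' u u', G t u -> G t' u' -> t < t' -> u' < u) ->
    (forall t t' u u', G' t u -> G' t' u' -> t < t' -> u' < u) ->
    (forall t' : 'I_n, t' < t -> forall u, G t' u = G' t' u) -> forall u, G t u -> G' t u.
  have IH' (t' : 'I_n) : t' < t -> forall u, F t' u = F' t' u by move=> h; apply: IH;
    apply: leq_trans h tN.
  by move=> u; apply/idP/idP; apply: H => // t' /IH' h v; rewrite h.
move=> {tot tot' sym sym' anti anti' IH} tot tot' sym sym' anti anti' IH u Gtu.
have fct (H : rel 'I_n) : (forall t u, H t u -> T t /\ H u t) ->
    (forall t t' u u', H t u -> H t' u' -> t < t' -> u' < u) ->
    forall t u u', H t u -> H t u' -> u = u'.
  move=> symH antiH x y y' h1 h2; apply: val_inj; case: (ltngtP y y') => // yy.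
    by have := antiH _ _ _ _ (symH _ _ h1).2 (symH _ _ h2).2 yy; rewrite ltnn.
  by have := antiH _ _ _ _ (symH _ _ h2).2 (symH _ _ h1).2 yy; rewrite ltnn.
have [u' G'tu'] := tot' t (sym _ _ Gtu).1.
case: (ltngtP u u') => uu; last by rewrite (val_inj uu : u = u').
- have [w Gu'w] := tot u' (sym' _ _ (sym' _ _ G'tu').2).1.
  have Gwu' := (sym _ _ Gu'w).2.
  case: (ltngtP t w) => tw.
  + by have := anti _ _ _ _ Gtu Gwu' tw; rewrite ltnNge (ltnW uu).
  + by have := anti' _ _ _ _ (etrans (esym (IH w tw u')) Gwu') G'tu' tw; rewrite ltnn.
  + have E1 : t = w by apply: val_inj.
    by rewrite -E1 in Gwu'; rewrite (fct G sym anti _ _ _ Gtu Gwu') ltnn in uu.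
- have [w G'uw] := tot' u (sym _ _ (sym _ _ Gtu).2).1.
  have G'wu := (sym' _ _ G'uw).2.
  case: (ltngtP t w) => tw.
  + by have := anti' _ _ _ _ G'tu' G'wu tw; rewrite ltnNge (ltnW uu).
  + by have := anti _ _ _ _ (etrans (IH w tw u) G'wu) Gtu tw; rewrite ltnn.
  + have E1 : t = w by apply: val_inj.
    by rewrite -E1 in G'wu; rewrite (fct G' sym' anti' _ _ _ G'tu' G'wu) ltnn in uu.
Qed.

Section Blocks.
Variables (Psi : cartan) (n : nat) (P : {set {set pt Psi n}}).
Hypothesis P_NC : P \in NC Psi n.
Implicit Types (i j k : 'I_n).

Let pP : partition P [set: pt Psi n].
Proof. by move: P_NC; rewrite inE => /and3P[]. Qed.

Let inv : invariant_under_opp P.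
Proof. by move: P_NC; rewrite inE => /and3P[]. Qed.

Definition same_block x y := y \in pblock P x.

Lemma same_block_refl x : same_block x x.
Proof. exact: in_pblock. Qed.

Lemma same_block_sym x y : same_block x y = same_block y x.
Proof.
by apply/idP/idP => h; rewrite /same_block (pblockE pP (pblock_in pP _) h) in_pblock.
Qed.

Lemma same_block_trans : transitive same_block.
Proof. by move=> y x z xy; rewrite /same_block (pblockE pP (pblock_in pP _) xy). Qed.

Lemma same_block_noncrossing x y z t : position x < position y -> position y < position z ->
  position z < position t -> same_block x z -> same_block y t -> same_block x y.
Proof.
move=> xy yz zt xz yt; move: P_NC; rewrite inE => /and3P[_ _].
move=> /forall_inP/(_ _ (pblock_in pP x))/forall_inP/(_ _ (pblock_in pP y)).
move=> /forall_inP/(_ _ (in_pblock pP x))/forall_inP/(_ _ xz).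
move=> /forall_inP/(_ _ (in_pblock pP y))/forall_inP/(_ _ yt).
by rewrite xy yz zt => /eqP E; rewrite /same_block E in_pblock.
Qed.

Lemma position_pos_point i : position (pos_point Psi i) = i.
Proof. by case: Psi. Qed.

Lemma position_neg (y : pt Psi n) : (label y < 0)%R -> n <= position y.
Proof. by case: Psi y => //= -[j []] //= _; rewrite mul1n leq_addr. Qed.

Definition same_pos i j := same_block (pos_point Psi i) (pos_point Psi j).

(** Joins consecutive positive elements of a block, so that each point starts and ends at most one
    arc. *)
Definition arc i j := [&& i < j, same_pos i j & [forall k : 'I_n, (i < k < j) ==> ~~
  same_pos i k]].

Lemma arcP i j : arc i j -> [/\ i < j, same_pos i j & forall k : 'I_n, i < k -> k < j -> ~~
  same_pos i k].
Proof.
case/and3P=> h1 h2 /forallP h3; split=> // k ik kj.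
by have := h3 k; rewrite ik kj.
Qed.

Lemma next_arc i j : i < j -> same_pos i j -> exists2 k, arc i k & k <= j.
Proof.
move=> ij sij; pose Q (k : 'I_n) := (i < k) && same_pos i k.
have Qj : Q j by rewrite /Q ij.
case: (arg_minnP (fun k : 'I_n => k : nat) Qj) => k /andP[ik sik] kmin.
exists k; last exact: kmin.
rewrite /arc ik sik; apply/forallP => k'; apply/implyP => /andP[h1 h2].
by apply: contraL h2 => h; rewrite -leqNgt kmin // /Q h1.
Qed.

Lemma prev_arc i j : i < j -> same_pos i j -> exists k, arc k j.
Proof.
move=> ij sij; pose Q (k : 'I_n) := (k < j) && same_pos k j.
have Qi : Q i by rewrite /Q ij.
case: (arg_maxnP (fun k : 'I_n => k : nat) Qi) => k /andP[kj skj] kmax.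
exists k; rewrite /arc kj skj; apply/forallP => k'; apply/implyP => /andP[h1 h2].
apply: contraL h1 => h; rewrite -leqNgt; apply: kmax.
by rewrite /Q h2 /=; move: h; rewrite /same_pos same_block_sym => h;
  apply: same_block_trans h skj.
Qed.

Lemma label_leq i j : (label (pos_point Psi i) <= label (pos_point Psi j))%R = (i <= j).
Proof. by rewrite !label_pos_point lez_nat. Qed.

Lemma label_ltn i j : (label (pos_point Psi i) < label (pos_point Psi j))%R = (i < j).
Proof. by rewrite !label_pos_point ltz_nat. Qed.

Lemma cl_arc i : (i \notin cl P) -> exists j, arc i j.
Proof.
move=> iN; have /forall_inPn[y yB yi] : ~~ [forall y in pblock P (pos_point Psi i), (label
  y <= label (pos_point Psi i))%R].
  by apply: contra iN => /forall_inP h; apply/mem_cl.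
rewrite -ltNge in yi; have y0 := lt_trans (label_pos_point_gt0 Psi i) yi.
rewrite (pos_point_absval y0) in yi yB; rewrite label_ltn in yi.
by have [k ik _] := next_arc yi yB; exists k.
Qed.

Lemma arc_cl i j : arc i j -> i \notin cl P.
Proof.
case/arcP => ij sij _; apply/negP => /(mem_cl _ pP inv)/(_ _ sij).
by rewrite label_leq leqNgt ij.
Qed.

Lemma arc_op i j : arc i j -> j \notin op P.
Proof.
case/arcP => ij sij _; apply/negP => /(mem_op _ pP) h.
have sji : same_block (pos_point Psi j) (pos_point Psi i) by rewrite same_block_sym.
by have := h _ sji; rewrite label_leq leqNgt ij.
Qed.

Lemma op_arc j : j \notin op P -> (exists i, arc i j) \/
  exists2 y, same_block (pos_point Psi j) y & (label y < 0)%R.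
Proof.
move=> jN; have /forall_inPn[y yB yj] : ~~ [forall y in pblock P (pos_point Psi j), (label
  (pos_point Psi j) <= label y)%R].
  by apply: contra jN => /forall_inP h; apply/mem_op.
rewrite -ltNge in yj; case: (ltP 0%R (label y)) => y0; last first.
  by right; exists y => //; rewrite lt_neqAle label_neq0.
left; rewrite (pos_point_absval y0) in yj yB; rewrite label_ltn in yj.
by apply: prev_arc yj _; rewrite /same_pos same_block_sym.
Qed.

(** The covering clause is the one that sees the negative half: an unmatched non-opener shares its
    block with a negative element, which comes after all positive ones in position, so an arc above
    it would be crossed. *)
Lemma arc_bracket : bracket (fun i => i \notin cl P) (fun j => j \notin op P) arc.
Proof.
split.
- by move=> i j /arcP[].
- move=> i j j' /arcP[h1 h2 h3] /arcP[g1 g2 g3]; apply: val_inj.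
  case: (ltngtP j j') => // h; first by have := g3 j h1 h; rewrite h2.
  by have := h3 j' g1 h; rewrite g2.
- move=> i i' j /arcP[h1 h2 h3] /arcP[g1 g2 g3]; apply: val_inj.
  have ii' : same_pos i i' by apply: same_block_trans h2 _; rewrite same_block_sym.
  case: (ltngtP i i') => // h; first by have := h3 i' h g1; rewrite ii'.
  by have := g3 i h h1; rewrite /same_pos same_block_sym -/(same_pos i i') ii'.
- exact: cl_arc.
- exact: arc_cl.
- exact: arc_op.
- move=> i j k l /arcP[h1 h2 h3] /arcP[g1 g2 g3] ij jk; rewrite leqNgt; apply/negP => kl.
  by have /negP := h3 j ij jk; apply; apply: same_block_noncrossing h2 g2;
    rewrite !position_pos_point.
- move=> i j k /op_arc[//|[y jy y0]] /arcP[h1 h2 h3] ij jk.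
  have /negP := h3 j ij jk; case; apply: same_block_noncrossing h2 jy;
    rewrite !position_pos_point //.
  exact: leq_trans (ltn_ord k) (position_neg y0).
Qed.

End Blocks.

Lemma NC_partition Psi n (P : {set {set pt Psi n}}) : P \in NC Psi n -> partition P [set:
  pt Psi n].
Proof. by rewrite inE => /and3P[]. Qed.

Lemma partition_ext Psi n (P P' : {set {set pt Psi n}}) :
  partition P [set: pt Psi n] -> partition P' [set: pt Psi n] ->
  (forall x y, same_block P x y = same_block P' x y) -> P = P'.
Proof.
move=> pP pP' h; rewrite -(equivalence_partition_pblock pP) -(equivalence_partition_pblock pP').
apply/setP => B; apply/imsetP/imsetP => -[x _ ->]; exists x; rewrite ?inE //;
  by apply/setP => y; have := h x y; rewrite !inE /same_block => ->.
Qed.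

Lemma same_pos_arc Psi n (P P' : {set {set pt Psi n}}) : P \in NC Psi n -> P' \in NC Psi n ->
  (forall i j, arc P i j -> arc P' i j) -> forall i j, same_pos P i j -> same_pos P' i j.
Proof.
move=> PN PN' aa.
suff H (i j : 'I_n) : i < j -> same_pos P i j -> same_pos P' i j.
  move=> i j; case: (ltngtP i j) => ij sij; first exact: H.
    by rewrite /same_pos same_block_sym //; apply: H => //; rewrite /same_pos same_block_sym.
  have -> : i = j by apply: val_inj.
  exact: same_block_refl.
have [N] := ubnP (j - i); elim: N i j => // N IH i j jiN ij sij.
have [k aik kj] := next_arc ij sij.
have [ik sik _] := arcP aik; have [_ sik' _] := arcP (aa _ _ aik).
move: kj; rewrite leq_eqVlt => /predU1P[kj|kj]; first by rewrite -(val_inj kj : k = j).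
apply: same_block_trans sik' _ => //; apply: IH => //; first by lia.
by apply: same_block_trans sij => //; rewrite same_block_sym.
Qed.

Section TypeBMixed.
Variables (n : nat) (P : {set {set pt TypeB n}}).
Hypothesis P_NC : P \in NC TypeB n.
Implicit Types (i j t u : 'I_n).

Lemma same_block_opp (x y : 'I_n * bool) : same_block P x y -> same_block P (x.1, ~~ x.2)
  (y.1, ~~ y.2).
Proof.
move: (P_NC); rewrite inE => /and3P[pP /forall_inP /(_ _ (pblock_in pP x)) oP _] xy.
have x' : (x.1, ~~ x.2) \in [set (z.1, ~~ z.2) | z in pblock P x].
  by apply/imsetP; exists x => //; apply: in_pblock.
rewrite /same_block (pblockE pP oP x'); apply/imsetP; by exists y.
Qed.

Definition cross_same i j := @same_block TypeB n P (i, false) (j, true).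

Lemma cross_sameC i j : cross_same i j = cross_same j i.
Proof.
suff H a b : cross_same a b -> cross_same b a by apply/idP/idP; apply: H.
by move/same_block_opp => /=; rewrite /cross_same same_block_sym.
Qed.

(* The least positive elements of the blocks with both signs; x -> -x exchanges
   these blocks, and reverses the order of their least positive elements since
   the partition is noncrossing. *)
Definition least_mixed t := (t \notin op P) && [forall i : 'I_n, (i < t) ==> ~~ same_pos P i t].

Definition mixed_pair t u := [&& least_mixed t, least_mixed u & cross_same t u].

Lemma same_posC i j : same_pos P i j = same_pos P j i.
Proof. exact: same_block_sym. Qed.

Lemma least_mixed_inj t u : least_mixed t -> least_mixed u -> same_pos P t u -> t = u.
Proof.
case/andP=> _ /forallP ht /andP[_ /forallP hu] tu; apply: val_inj.
case: (ltngtP t u) => // h; first by have := hu t; rewrite h tu.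
by have := ht u; rewrite h same_posC tu.
Qed.

Lemma cross_op i j : cross_same i j -> i \notin op P.
Proof.
move=> ij; apply/negP => /(mem_op _ (NC_partition P_NC))/(_ _ ij) /=.
by rewrite expr0 mul1r expr1 mulN1r.
Qed.

Lemma cross_same_pos i i' j : same_pos P i i' -> cross_same i j -> cross_same i' j.
Proof. by move=> ii ij; apply: same_block_trans ij => //;
  rewrite -/(same_pos P i' i) same_posC. Qed.

Lemma least_mixedP i j : cross_same i j -> exists2 t, least_mixed t & same_pos P i t.
Proof.
move=> ij; have si : same_pos P i i by apply: same_block_refl.
case: (arg_minnP (fun k : 'I_n => k : nat) (P := same_pos P i) si) => t st tmin.
exists t => //; rewrite /least_mixed (cross_op (cross_same_pos st ij)) /=.
apply/forallP => k; apply/implyP; apply: contraTN => kt; rewrite -leqNgt; apply: tmin.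
by apply: same_block_trans st _ => //; rewrite -/(same_pos P t k) same_posC.
Qed.

Lemma mixed_pairP i j : cross_same i j -> exists t u, [/\ mixed_pair t u, same_pos P i t &
  same_pos P j u].
Proof.
move=> ij; have [t tm it] := least_mixedP ij.
have ji : cross_same j i by rewrite cross_sameC.
have [u um ju] := least_mixedP ji; exists t, u; split=> //.
rewrite /mixed_pair tm um; apply: (cross_same_pos it).
by rewrite cross_sameC; apply: (cross_same_pos ju).
Qed.

Lemma mixed_pair_total t : least_mixed t -> exists u, mixed_pair t u.
Proof.
move=> tm; have [tN /forallP tmin] := andP tm.
have [[i /arcP[it sit _]]|[[j []]]] := op_arc P_NC tN.
- by have := tmin i; rewrite it sit.
- move=> tj _; have [t' [u [tu tt' _]]] := mixed_pairP (tj : cross_same t j).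
  have [t'm _ _] := and3P tu; exists u.
  by rewrite (least_mixed_inj tm t'm tt').
- by rewrite /= expr0 mul1r.
Qed.

Lemma mixed_pair_sym t u : mixed_pair t u -> least_mixed t /\ mixed_pair u t.
Proof. by case/and3P=> h1 h2 h3; rewrite /mixed_pair h1 h2 cross_sameC. Qed.

Lemma mixed_pair_anti t t' u u' : mixed_pair t u -> mixed_pair t' u' -> t < t' -> u' < u.
Proof.
case/and3P=> tm um tu /and3P[t'm u'm tu'] tt'; rewrite ltnNge leq_eqVlt; apply/negP => uu.
suff stt : same_pos P t t' by rewrite (least_mixed_inj tm t'm stt) ltnn in tt'.
case/predU1P: uu => [uu|uu].
  rewrite -(val_inj uu : u = u') in tu'; apply: same_block_trans tu _ => //.
  by rewrite same_block_sym.
apply: same_block_noncrossing tu tu' => //=; rewrite ?mul1n ?ltn_add2l //.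
exact: leq_trans (ltn_ord t') (leq_addr _ _).
Qed.

End TypeBMixed.

(** Openers and closers give the arcs by [bracket_unique], hence the blocks restricted to the
    positive points, hence the least positive elements of the mixed blocks. The pairing of these
    under negation is order-reversing, so [antitone_unique] determines it, and with it all relations
    between the two halves. *)
Lemma NC_unique Psi n (P P' : {set {set pt Psi n}}) : P \in NC Psi n -> P' \in NC Psi n ->
  op P = op P' -> cl P = cl P' -> P = P'.
Proof.
move=> PN PN' eop ecl; apply: partition_ext; rewrite ?NC_partition //.
have aa i j : arc P i j -> arc P' i j.
  by apply: (bracket_unique (arc_bracket PN)); rewrite eop ecl; apply: arc_bracket.
have aa' i j : arc P' i j -> arc P i j.
  by apply: (bracket_unique (arc_bracket PN')); rewrite -eop -ecl; apply: arc_bracket.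
have ss i j : same_pos P i j = same_pos P' i j.
  by apply/idP/idP; apply: same_pos_arc.
move: P P' PN PN' eop ecl ss {aa aa'}; case: Psi => P P' PN PN' eop _ ss; first exact: ss.
have lm t : least_mixed P t = least_mixed P' t.
  by rewrite /least_mixed eop; congr (_ && _); apply: eq_forallb => i; rewrite ss.
have cross (Q Q' : {set {set pt TypeB n}}) : Q \in NC TypeB n -> Q' \in NC TypeB n ->
    (forall t, least_mixed Q t = least_mixed Q' t) ->
    (forall i j, same_pos Q i j = same_pos Q' i j) -> forall i j, cross_same Q i j ->
      cross_same Q' i j.
  move=> QN QN' lmQ sQ i j ij; have [t [u [tu it ju]]] := mixed_pairP QN ij.
  have : mixed_pair Q' t u.
    move: t u tu {it ju}; apply: (antitone_unique (T := least_mixed Q)).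
    - exact: mixed_pair_total.
    - by move=> t; rewrite lmQ; apply: mixed_pair_total.
    - exact: mixed_pair_sym.
    - by move=> t u; rewrite lmQ; apply: mixed_pair_sym.
    - exact: mixed_pair_anti.
    - exact: mixed_pair_anti.
  case/and3P => _ _ tu'; apply: (@cross_same_pos _ Q' QN' t); first by rewrite same_posC // -sQ.
  rewrite cross_sameC //; apply: (@cross_same_pos _ Q' QN' u);
    first by rewrite same_posC // -sQ.
  by rewrite cross_sameC.
have cc i j : cross_same P i j = cross_same P' i j by apply/idP/idP; apply: cross.
have oo (Q : {set {set pt TypeB n}}) (QN : Q \in NC TypeB n) i s j t :
    same_block Q (i, s) (j, t) = same_block Q (i, ~~ s) (j, ~~ t).
  by apply/idP/idP => /(same_block_opp QN) //=; rewrite !negbK.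
move=> [i []] [j []].
- by rewrite !(oo _ _ i true) //; apply: ss.
- by rewrite !(oo _ _ i true) //; apply: cc.
- exact: cc.
- exact: ss.
Qed.

(** * The bijection *)

Definition indices Psi n (p : pred 'I_n) : seq nat := [seq idx Psi i | i <- enum 'I_n & p i].

Lemma idx_ltn Psi n (i j : 'I_n) : (idx Psi i < idx Psi j) = (i < j).
Proof. by case: Psi. Qed.

Lemma mem_indices Psi n (p : pred 'I_n) i : (idx Psi i \in indices Psi p) = p i.
Proof.
apply/mapP/idP => [[j]|pi]; last by exists i; rewrite // mem_filter mem_enum pi.
rewrite mem_filter => /andP[pj _] ij; suff -> : i = j by [].
by apply: val_inj; case: Psi ij => [|[]].
Qed.

Lemma sorted_indices Psi n (p : pred 'I_n) : sorted ltn (indices Psi p).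
Proof.
rewrite (sorted_pairwise ltn_trans) pairwise_map; apply: pairwise_filter.
apply: (sub_pairwise (r := fun i j : 'I_n => i < j)); first by move=> i j; rewrite /= idx_ltn.
by rewrite -(pairwise_map val ltn) val_enum_ord -(sorted_pairwise ltn_trans) iota_ltn_sorted.
Qed.

Lemma range_indices Psi n (p : pred 'I_n) : all (in_range Psi n) (indices Psi p).
Proof. by apply/allP => _ /mapP[i _ ->]; apply: in_range_idx. Qed.

Lemma count_indices Psi n (p : pred 'I_n) (q : pred nat) :
  count q (indices Psi p) = #|[set i | p i & q (idx Psi i)]|.
Proof.
rewrite count_map -size_filter -filter_predI cardE; apply: perm_size; apply: uniq_perm.
- by rewrite filter_uniq // enum_uniq.
- exact: enum_uniq.
by move=> i; rewrite mem_filter !mem_enum !inE /= andbT andbC.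
Qed.

Lemma card_matching n (A B : {set 'I_n}) (E : rel 'I_n) :
  {in A, forall i, exists2 j, E i j & j \in B} ->
  (forall i i' j, E i j -> E i' j -> i = i') -> #|A| <= #|B|.
Proof.
move=> tot inj; pose f i := odflt i [pick j | E i j && (j \in B)].
have fP i : i \in A -> E i (f i) && (f i \in B).
  move=> /tot[j ij jB]; rewrite /f; case: pickP => //= /(_ j); by rewrite ij jB.
have finj : {in A &, injective f}.
  move=> i i' /fP/andP[h _] /fP/andP[h' _] e; rewrite -e in h'; exact: inj h h'.
rewrite -(card_in_imset finj); apply: subset_leq_card;
  apply/subsetP => _ /imsetP[i /fP/andP[_ h] ->].
exact: h.
Qed.

Section Ballot.
Variables (Psi : cartan) (n : nat) (P : {set {set pt Psi n}}).
Hypothesis PN : P \in NC Psi n.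

Let L := indices Psi (fun i => i \notin cl P).
Let R := indices Psi (fun i => i \notin op P).

(** Every left end from p on starts an arc, whose right end lies beyond p, and distinct arcs have
    distinct right ends. *)
Lemma NC_ballot p : count (fun x => p <= x) L <= count (fun x => p < x) R.
Proof.
have b := arc_bracket PN; rewrite !count_indices; apply: (card_matching (E := arc P)).
  move=> i; rewrite inE => /andP[il pi]; have [j ij] := bracket_left b il; exists j => //.
  rewrite inE (bracket_rightE b ij) /=; apply: leq_ltn_trans pi _.
  by rewrite idx_ltn (bracket_lt b ij).
exact: bracket_inj b.
Qed.

Lemma NC_typeA_size : Psi = TypeA -> size L = size R.
Proof.
move=> E; have b := arc_bracket PN; apply/eqP; rewrite eqn_leq.
rewrite -(count_predT L) -(count_predT R) !count_indices; apply/andP; split.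
  apply: (card_matching (E := arc P)); last exact: bracket_inj b.
  move=> i; rewrite !inE andbT => il; have [j ij] := bracket_left b il; exists j => //.
  by rewrite inE (bracket_rightE b ij).
apply: (card_matching (E := fun j i => arc P i j)).
  move=> j; rewrite !inE andbT => jr.
  have [[i ij]|[y _ y0]] := op_arc PN jr; first by exists i;
    rewrite // inE (bracket_leftE b ij).
  have label_ge0 Psi' (z : pt Psi' n) : Psi' = TypeA -> (0 <= label z)%R by move=> E';
    move: z; rewrite E'.
  by rewrite ltNge label_ge0 in y0.
by move=> j j' i; apply: (bracket_fun b).
Qed.

End Ballot.

Section Main.
Variables (Psi : cartan) (m : nat).
Implicit Types A : {set posroot Psi m.+1}.

Lemma f_word_good s : nonnesting s -> {subset s <= pos_roots Psi m.+1} ->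
  [/\ good_word Psi m (f_word s), perm_eq (lefts Psi (f_word s)) (lefts Psi s),
      perm_eq (rights (f_word s)) (rights s) &
      noncrossing_adj (@position Psi m.+1) (wedges Psi m (f_word s))].
Proof. by case: Psi; [apply: f_word_typeA | apply: f_word_typeB]. Qed.

Lemma f_mapE A : NN A -> f_map A = word_blocks Psi m (f_word (tuple_of A)).
Proof.
move=> nnA; have [gw _ _ _] := f_word_good (tuple_of_nonnesting nnA) (@tuple_of_sub _ _ A).
by rewrite /f_map /f_perm porbits_word.
Qed.

Lemma f_map_NC A : NN A -> f_map A \in NC Psi m.+1.
Proof.
move=> nnA; have [[sub _ _] _ _ nc] := f_word_good (tuple_of_nonnesting nnA) (@tuple_of_sub
  _ _ A).
by rewrite f_mapE //; apply: word_blocks_NC.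
Qed.

Lemma op_cl_f_map A : NN A ->
  op (f_map A) = [set i | idx Psi i \notin rights (tuple_of A)] /\
  cl (f_map A) = [set i | idx Psi i \notin lefts Psi (tuple_of A)].
Proof.
move=> nnA; have [gw pl pr _] := f_word_good (tuple_of_nonnesting nnA) (@tuple_of_sub _ _ A).
have [sub _ _] := gw; rewrite f_mapE //; split; apply/setP => i; rewrite inE.
  by rewrite mem_op_word_blocks // (perm_mem pr).
by rewrite mem_cl_word_blocks ?word_blocks_invariant // (perm_mem pl).
Qed.

Lemma op_cl_antichain A : NN A ->
  op (antichain_partition A) = [set i | idx Psi i \notin rights (tuple_of A)] /\
  cl (antichain_partition A) = [set i | idx Psi i \notin lefts Psi (tuple_of A)].
Proof.
move=> nnA; have sub := @tuple_of_sub _ _ A.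
have gw := good_word_nonnesting sub (tuple_of_nonnesting nnA).
rewrite antichain_partitionE; split; apply/setP => i; rewrite inE.
  by rewrite mem_op_word_blocks.
by rewrite mem_cl_word_blocks ?word_blocks_invariant.
Qed.

Lemma idx_surj k : in_range Psi m.+1 k -> exists i : 'I_m.+1, k = idx Psi i.
Proof.
case: Psi => /= h; first by exists (Ordinal h).
have h' : k.-1 < m.+1 by lia.
by exists (Ordinal h') => /=; lia.
Qed.

Lemma f_map_inj A A' : NN A -> NN A' -> f_map A = f_map A' -> A = A'.
Proof.
move=> nnA nnA' e; have [o c] := op_cl_f_map nnA; have [o' c'] := op_cl_f_map nnA'.
have [rl rr] := word_ends_in_range (@tuple_of_sub _ _ A).
have [rl' rr'] := word_ends_in_range (@tuple_of_sub _ _ A').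
have ext (s s' : seq nat) : all (in_range Psi m.+1) s -> all (in_range Psi m.+1) s' ->
    [set i : 'I_m.+1 | idx Psi i \notin s] = [set i | idx Psi i \notin s'] -> s =i s'.
  move=> /allP hs /allP hs' /setP h k.
  have hk (i : 'I_m.+1) : (idx Psi i \in s) = (idx Psi i \in s').
    by have := h i; rewrite !inE => /negb_inj.
  apply/idP/idP => kk.
    by have [i ki] := idx_surj (hs _ kk); rewrite ki -hk -ki.
  by have [i ki] := idx_surj (hs' _ kk); rewrite ki hk -ki.
have el : lefts Psi (tuple_of A) =i lefts Psi (tuple_of A').
  by apply: ext => //; rewrite -c -c' e.
have er : rights (tuple_of A) =i rights (tuple_of A').
  by apply: ext => //; rewrite -o -o' e.
have et := nonnesting_inj (@tuple_of_sub _ _ A) (@tuple_of_sub _ _ A')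
  (tuple_of_nonnesting nnA) (tuple_of_nonnesting nnA') el er.
by apply/setP => b; rewrite -!mem_tuple_of et.
Qed.

(** The antichain is chosen only for its ends. Its image then has the openers and closers of P, so
    [NC_unique] identifies the two without inverting the recursion of f. *)
Lemma f_map_surj P : P \in NC Psi m.+1 -> exists2 A, NN A & f_map A = P.
Proof.
move=> PN; pose L := indices Psi (fun i => i \notin cl P).
pose R := indices Psi (fun i => i \notin op P).
have sL : sorted ltn L := sorted_indices Psi _.
have sR : sorted ltn R := sorted_indices Psi _.
have rL : all (in_range Psi m.+1) L := range_indices Psi _.
have rR : all (in_range Psi m.+1) R := range_indices Psi _.
have bal := NC_ballot PN; have szA := NC_typeA_size PN.
have nns := build_nonnesting sL sR rL rR bal szA.
have subs := build_sub sL sR rL rR bal szA.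
have bl := build_lefts sL sR rL rR bal szA.
have br := build_rights sL sR rL rR bal szA.
have [nnA pA] := NN_of_nonnesting subs nns.
set A := [set b | _] in nnA pA; exists A => //.
have [o c] := op_cl_f_map nnA.
apply: NC_unique; rewrite ?f_map_NC // ?o ?c; apply/setP => i; rewrite inE.
  by rewrite (perm_mem (perm_rights pA)) (perm_mem br) mem_indices negbK.
by rewrite (perm_mem (perm_lefts Psi pA)) bl mem_indices negbK.
Qed.

End Main.

Theorem theorem3p4 (n : nat) (hn : (0 < n)%N) (Psi : cartan) :
  [/\ forall A : {set posroot Psi n}, NN A -> f_map A \in NC Psi n,
      forall A A' : {set posroot Psi n},
        NN A -> NN A' -> f_map A = f_map A' -> A = A',
      forall P : {set {set pt Psi n}}, P \in NC Psi n ->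
        exists2 A : {set posroot Psi n}, NN A & f_map A = P
    & forall A : {set posroot Psi n}, NN A ->
        (op (f_map A), cl (f_map A), tr (f_map A)) =
        (op (antichain_partition A), cl (antichain_partition A),
         tr (antichain_partition A))].
Proof.
case: n hn => // m _; split.
- exact: f_map_NC.
- exact: f_map_inj.
- exact: f_map_surj.
move=> A nnA; have [o c] := op_cl_f_map nnA; have [o' c'] := op_cl_antichain nnA.
by rewrite /tr o c o' c'.
Qed.
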